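(* Let $0<|q|<1$. The following identities hold. (i) $$\sum_{n=0}^{\infty}\frac{(-1)^nq^{(n+1)^2}(q;q^2)_{n}}{(-q;q)_{2n+1}}=q\frac{(q;q^2)_{\infty}}{(q^2;q^2)_{\infty}}\sum_{n=0}^{\infty}\sum_{j=-n}^{n}(-1)^{n+j}q^{3n^2+3n-j^2}.$$ (ii) $$\sum_{n=0}^\infty \frac{(-1)^nq^{n(n+1)}(q^2;q^2)_n}{(-q;q)_{2n+1}}=\sum_{n=0}^\infty\sum_{j=-n}^n(-1)^{n+j}(1-q^{2n+1})q^{3n^2+2n-j^2}$$ $$=\overline{f}_{1,2,1}(-q^4,-q^4,q^4)-q^5\,\overline{f}_{1,2,1}(-q^{10},-q^{10},q^4)=\overline{f}_{1,2,1}(q^{3/2},-q^{3/2},q).$$ (iii) $$\sum_{n=0}^\infty \frac{q^{n(n+1)}}{(-q;q^2)_{n+1}}=\frac{(-q^2;q^2)_\infty}{(q^2;q^2)_\infty}\sum_{n=0}^\infty (1-q^{2n+1})q^{3n^2+2n}\sum_{j=-n}^n(-1)^jq^{-j^2}$$ $$=\frac{J_4}{J_{2}^2}\left(f_{1,2,1}(q^4,q^4,q^4)+q^5f_{1,2,1}(q^{10},q^{10},q^4) \right)=2q^{-1}m(q^2,q^{12},-1)-q^{-1}\frac{J_1J_3J_8^2J_{12}^2}{J_2J_4J_6J_{24}^2}.$$ Furthermore, the identity $$\sum_{n=0}^\infty \frac{q^{n(n+1)}}{(-q;q^2)_{n+1}}=\frac{(-q^2;q^2)_\infty}{(q^2;q^2)_\infty}\sum_{n=0}^\infty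 (1-q^{2n+1})q^{3n^2+2n}\sum_{j=-n}^n(-1)^jq^{-j^2}$$ (the first equality in (iii)) is equivalent to the identity $$\sum_{n=0}^{\infty}\frac{q^{n(n+1)}}{(q;q^2)_{n+1}}=\frac{1}{(q;q)_\infty}\sum_{n=0}^{\infty}\sum_{j=-n}^{n}(-1)^nq^{2n^2+2n-j(j+1)/2}.$$
   Context: Notation: $(x;p)_n=\prod_{k=0}^{n-1}(1-xp^k)$ (with $(x;p)_0=1$) and $(x;p)_\infty=\prod_{k\ge0}(1-xp^k)$ for $|p|<1$. Theta function: $j(x;p)=(x;p)_\infty(p/x;p)_\infty(p;p)_\infty=\sum_{n\in\mathbb Z}(-1)^np^{n(n-1)/2}x^n$; $J_k=(q^k;q^k)_\infty$; $q^{3/2}=(q^{1/2})^3$ for a fixed square root $q^{1/2}$ of $q$. Put $\operatorname{sg}(r)=1$ for $r\ge0$, $\operatorname{sg}(r)=-1$ for $r<0$, and $\binom r2=r(r-1)/2$ for all integers $r$. For nonzero $x,y$ and $0<|p|<1$, $$f_{a,b,c}(x,y,p)=\sum_{\operatorname{sg}(r)=\operatorname{sg}(s)}\operatorname{sg}(r)(-1)^{r+s}x^ry^sp^{a\binom r2+brs+c\binom s2},\qquad \overline f_{a,b,c}(x,y,p)=\sum_{\operatorname{sg}(r)=\operatorname{sg}(s)}(-1)^{r+s}x^ry^sp^{a\binom r2+brs+c\binom s2},$$ the sums being over $(r,s)\in\mathbb Z^2$ with $\operatorname{sg}(r)=\operatorname{sg}(s)$. For nonzero $x,z$ with neither $z$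 nor $xz$ an integral power of $p$, $$m(x,p,z)=\frac1{j(z;p)}\sum_{r=-\infty}^\infty\frac{(-1)^rp^{\binom r2}z^r}{1-p^{r-1}xz}.$$ *)

(* Defs.v *)
From HB Require Import structures.
From mathcomp Require Import all_boot all_order all_algebra.
From mathcomp Require Import complex.
From mathcomp Require Import boolp classical_sets reals topology normedtype sequences.
From mathcomp.analysis.showcase Require summability.

Set Implicit Arguments.
Unset Strict Implicit.
Unset Printing Implicit Defensive.

Import Order.TTheory GRing.Theory Num.Theory.
Import numFieldNormedType.Exports.
Local Open Scope ring_scope.

(* The topology of the complex numbers R[i] (from the modulus) is carried by
   the regular module R[i]^o, so every limit below is taken in R[i]^o. As is
   usual in the library, [lim] has an unspecified value when there is no
   limit. *)

Definition csum (R : realType) (u : nat -> R[i]) : R[i] :=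
  limn (fun N => \sum_(0 <= n < N) u n : R[i]^o).

(* Sum of an unordered family: the limit of the finite partial sums along the
   finite subsets of I ordered by inclusion. *)
Definition usum (R : realType) (I : choiceType) (u : I -> R[i]) : R[i] :=
  @summability.sum I R[i] R[i]^o u.

(* \sum_(-n <= j <= n) u j *)
Definition symsum (R : realType) (n : nat) (u : int -> R[i]) : R[i] :=
  \sum_(k < n.*2.+1) u (k%:Z - n%:Z).

(* (x; p)_n *)
Definition qpoch (R : realType) (x p : R[i]) (n : nat) : R[i] :=
  \prod_(k < n) (1 - x * p ^+ k).

(* (x; p)_oo *)
Definition qpoch_oo (R : realType) (x p : R[i]) : R[i] :=
  limn (fun n => qpoch x p n : R[i]^o).

(* j(x; p) *)
Definition theta (R : realType) (x p : R[i]) : R[i] :=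
  qpoch_oo x p * qpoch_oo (p / x) p * qpoch_oo p p.

(* J_k, with the base q made explicit *)
Definition Jk (R : realType) (q : R[i]) (k : nat) : R[i] :=
  qpoch_oo (q ^+ k) (q ^+ k).

Definition sg (r : int) : int := if 0 <= r then 1 else -1.

(* r (r - 1) / 2 for every integer r; the division is exact *)
Definition bin2 (r : int) : int := ((r * (r - 1)) %/ 2)%Z.

(* f_{a,b,c}(x, y, p) *)
Definition hecke_f (R : realType) (a b c : int) (x y p : R[i]) : R[i] :=
  usum (fun rs : int * int => let: (r, s) := rs in
    if sg r == sg s then
      (sg r)%:~R * (-1) ^ (r + s) * x ^ r * y ^ s
        * p ^ (a * bin2 r + b * r * s + c * bin2 s)
    else 0).

(* \overline{f}_{a,b,c}(x, y, p) *)
Definition hecke_fbar (R : realType) (a b c : int) (x y p : R[i]) : R[i] :=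
  usum (fun rs : int * int => let: (r, s) := rs in
    if sg r == sg s then
      (-1) ^ (r + s) * x ^ r * y ^ s
        * p ^ (a * bin2 r + b * r * s + c * bin2 s)
    else 0).

(* m(x, p, z), meaningful when neither z nor x z is an integral power of p *)
Definition appell_m (R : realType) (x p z : R[i]) : R[i] :=
  (theta z p)^-1 *
  usum (fun r : int =>
    (-1) ^ r * p ^ bin2 r * z ^ r / (1 - p ^ (r - 1) * x * z)).

(* Main.v *)
(** The q-hypergeometric sums are evaluated with the limiting Bailey lemma: if
    beta_n = sum_r alpha_r / ((p;p)_(n-r) (p;p)_(n+r+1)), then
    sum_n delta_n beta_n = (p;p)_oo^-1 sum_r alpha_r delta_r (b p^(r+2);p)_oo,
    where delta_n = p^(n(n-1)/2 + 2n) prod_(i<n) (p^i - b).  Taking p = q^2,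
    beta_n = 1/(-q;q)_(2n+1) and b = q^-1, q^-2, -q^-2 gives (i) and the first
    equalities of (ii) and (iii); p = q, beta_n = 1/(q;q^2)_(n+1) and b = 0
    gives the last identity.  As both sides of the final equivalence hold, so
    does the equivalence.

    The Hecke-type double sums come from the substitutions (n, j) = (r+s, r-s)
    and (r+s+1, r-s), which map the quadrants onto the two parity classes of
    one cone in the (n, j) plane.

    For the last equality of (iii), the Bailey pair with beta_n =
    1/(-q;q^2)_(n+1) and b = 0 turns J_1 times the left-hand side into a sum
    over r of (-1)^r q^(3r(r+1)/2) (1-y)/(1+y) with y = q^(2r+1).  Since
    (1-y)/(1+y) = (1-y^3)/(1+y^3) - 2 (y-y^2)/(1+y^3), this is an infinite
    product minus twice a combination of the Appell sums of m(q^2, q^12, z) at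
    z = -q and z = -q^7.  Changing both z to -1 leaves theta quotients, which
    two classical 2-dissections reduce to a single one. *)

Require Import Defs.
From HB Require Import structures.
From mathcomp Require Import all_boot all_order all_algebra finmap.
From mathcomp Require Import complex ring lra zify.
From mathcomp Require Import boolp classical_sets reals topology normedtype sequences exp.
From mathcomp.analysis.showcase Require summability.

Set Implicit Arguments.
Unset Strict Implicit.
Unset Printing Implicit Defensive.

Import Order.TTheory GRing.Theory Num.Theory.
Import numFieldNormedType.Exports.
Local Open Scope ring_scope.
Local Open Scope complex_scope.

(** * Absolutely summable families *)

(** [limn] and [usum] have unspecified values where nothing converges, so an equation between them
    says nothing about convergence. Sums are therefore shown absolutely summable before they are
    split, reindexed or exchanged. Passing to the limit in a sum always goes through dominated
    convergence ([tannery]): the identity is first proved exactly with a truncation N. This serves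
    the Bailey lemma, the triple product and the change of z, where partial fractions in x of
    truncated theta quotients replace the usual argument with elliptic functions.

    The Bailey pairs are checked without Bailey inversion: beta satisfies a first-order recursion,
    and the defining sum satisfies it too by a telescoping certificate. When alpha contains an inner
    sum, that sum enters by Abel summation, and its increments are such that what remains is a
    q-binomial sum at a zero of its product side.

    The change of z multiplies the two Appell sums by j(-q;q^12) and j(-q^5;q^12). These combine by
    a 2-dissection of J_1, which cancels the factor 1/J_1 of the Bailey lemma and leaves m with
    coefficient 2/q. *)

Definition md (R : realType) (z : R[i]) : R := complex.Re `|z|.

Section Modulus.
Context {R : realType}.
Implicit Types z w : R[i].

(** The norm of R[i] is again R[i]-valued; [md] is its value in R, where [lra] and suprema are
    available. Algebraic properties are pulled back along the embedding of R. *)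
Lemma mdE z : `|z| = (md z)%:C.
Proof. by rewrite /md normc_def. Qed.

Lemma md_ge0 z : 0 <= md z.
Proof. by rewrite -lecR -mdE; exact: normr_ge0. Qed.

Lemma mdM z w : md (z * w) = md z * md w.
Proof. by apply: complexI; rewrite rmorphM -!mdE normrM. Qed.

Lemma mdX z n : md (z ^+ n) = md z ^+ n.
Proof. by apply: complexI; rewrite rmorphXn -!mdE normrX. Qed.

Lemma mdV z : md z^-1 = (md z)^-1.
Proof. by apply: complexI; rewrite fmorphV -!mdE normfV. Qed.

Lemma mdN z : md (- z) = md z.
Proof. by apply: complexI; rewrite -!mdE normrN. Qed.

Lemma mdD z w : md (z + w) <= md z + md w.
Proof. by rewrite -lecR rmorphD -!mdE ler_normD. Qed.

Lemma mdB z w : md (z - w) = md (w - z).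
Proof. by rewrite -mdN opprB. Qed.

Lemma md0 : md (0 : R[i]) = 0.
Proof. by apply: complexI; rewrite -!mdE normr0. Qed.

Lemma md1 : md (1 : R[i]) = 1.
Proof. by apply: complexI; rewrite -!mdE normr1. Qed.

Lemma md_eq0 z : (md z == 0) = (z == 0).
Proof. by rewrite -(inj_eq (@complexI R)) -mdE normr_eq0. Qed.

Lemma md_gt0 z : (0 < md z) = (z != 0).
Proof. by rewrite lt_neqAle md_ge0 andbT eq_sym md_eq0. Qed.

Lemma md_real (x : R) : 0 <= x -> md x%:C = x.
Proof. by move=> x0; apply: complexI; rewrite -mdE ger0_norm // ler0c. Qed.

Lemma md_sum (I : Type) (s : seq I) (P : pred I) (F : I -> R[i]) :
  md (\sum_(i <- s | P i) F i) <= \sum_(i <- s | P i) md (F i).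
Proof.
elim/big_rec2: _ => [|i y x _ h]; first by rewrite md0.
by apply: le_trans (mdD _ _) _; rewrite lerD2l.
Qed.

Lemma mdXz z (n : int) : md (z ^ n) = md z ^ n.
Proof. by case: n => n; rewrite ?NegzE -?exprnN -?exprnP ?mdV mdX. Qed.

Lemma Re_le_md z : `|complex.Re z| <= md z.
Proof.
rewrite -[X in X <= _]sqrtr_sqr /md normc_def /= ler_wsqrtr // lerDl.
exact: sqr_ge0.
Qed.

Lemma Im_le_md z : `|complex.Im z| <= md z.
Proof.
rewrite -[X in X <= _]sqrtr_sqr /md normc_def /= ler_wsqrtr // lerDr.
exact: sqr_ge0.
Qed.

End Modulus.

(** * Convergence of complex sequences with a real epsilon *)

Definition tends (R : realType) (u : nat -> R[i]) (l : R[i]) :=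
  forall e : R, 0 < e -> exists N, forall n, (N <= n)%N -> md (u n - l) < e.

Section Tends.
Context {R : realType}.
Implicit Types (u v : nat -> R[i]) (l m : R[i]).

Lemma limn_tends u l : tends u l -> limn (fun n => u n : R[i]^o) = l.
Proof.
move=> h; apply: cvg_lim; first exact: norm_hausdorff.
apply/cvgrPdist_lt => e e0.
(* A positive element of R[i] is real, so the epsilon of the library may be taken in R. *)
have eR : (complex.Re e)%:C = e by rewrite RRe_real // gtr0_real.
have /h[N hN] : 0 < complex.Re e by rewrite -ltcR eR.
exists N => // n /= Nn.
by rewrite -eR mdE ltcR mdB hN.
Qed.

Lemma tends_unique u l m : tends u l -> tends u m -> l = m.
Proof. by move=> /limn_tends <- /limn_tends <-. Qed.

Lemma tends_ext u v l : u =1 v -> tends u l -> tends v l.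
Proof. by move=> uv h e /h[N hN]; exists N => n /hN; rewrite uv. Qed.

Lemma tends_cst l : tends (fun=> l) l.
Proof. by move=> e e0; exists 0%N => n _; rewrite subrr md0. Qed.

Lemma tendsD u v l m : tends u l -> tends v m ->
  tends (fun n => u n + v n) (l + m).
Proof.
move=> hu hv e e0.
have e2 : 0 < e / 2 by rewrite divr_gt0.
have [N hN] := hu _ e2; have [M hM] := hv _ e2.
exists (maxn N M) => n; rewrite geq_max => /andP[/hN h1 /hM h2].
rewrite opprD addrACA; apply: le_lt_trans (mdD _ _) _; lra.
Qed.

Lemma tends_bounded u l : tends u l ->
  exists B : R, 0 < B /\ forall n, md (u n) <= B.
Proof.
move=> /(_ 1 ltr01)[N hN].
exists (1 + md l + \sum_(i < N) md (u i)); split.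
  by rewrite -addrA ltr_pwDl // addr_ge0 ?md_ge0 // sumr_ge0 // => i _; rewrite md_ge0.
move=> n; have [Nn|nN] := leqP N n.
  have h : md (u n) <= md (u n - l) + md l by rewrite -{1}(subrK l (u n)) mdD.
  have h0 : 0 <= \sum_(i < N) md (u i) by rewrite sumr_ge0 // => i _; rewrite md_ge0.
  have := hN _ Nn; lra.
rewrite (bigD1 (Ordinal nN)) //=.
have h0 : 0 <= \sum_(i < N | i != Ordinal nN) md (u i).
  by rewrite sumr_ge0 // => i _; rewrite md_ge0.
have := md_ge0 l; lra.
Qed.

Lemma tendsM u v l m : tends u l -> tends v m ->
  tends (fun n => u n * v n) (l * m).
Proof.
move=> hu hv e e0.
have [B [B0 hB]] := tends_bounded hu.
have m0 := md_ge0 m.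
have e2 : 0 < e / (2 * (1 + md m)) by rewrite divr_gt0 // mulr_gt0 //; lra.
have e3 : 0 < e / (2 * B) by rewrite divr_gt0 // mulr_gt0.
have [N hN] := hu _ e2; have [M hM] := hv _ e3.
exists (maxn N M) => n; rewrite geq_max => /andP[/hN h1 /hM h2].
have -> : u n * v n - l * m = u n * (v n - m) + (u n - l) * m by ring.
apply: le_lt_trans (mdD _ _) _; rewrite !mdM.
have t1 : md (u n) * md (v n - m) < e / 2.
  apply: (@le_lt_trans _ _ (B * md (v n - m))); first by rewrite ler_wpM2r ?md_ge0.
  rewrite mulrC; move: h2; rewrite ltr_pdivlMr ?mulr_gt0 //; lra.
have t2 : md (u n - l) * md m <= e / 2.
  apply: (@le_trans _ _ (md (u n - l) * (1 + md m))).
    by rewrite ler_wpM2l ?md_ge0 // lerDr.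
  move: h1; rewrite ltr_pdivlMr ?mulr_gt0 //; first lra.
  by lra.
lra.
Qed.

Lemma tends_neq0 u l : tends u l -> l != 0 ->
  exists N, forall n, (N <= n)%N -> md l / 2 < md (u n).
Proof.
move=> h l0; have l0' : 0 < md l / 2 by rewrite divr_gt0 ?md_gt0.
have [N hN] := h _ l0'; exists N => n /hN h1.
have h2 : md l <= md (u n) + md (u n - l).
  by rewrite -{1}(subKr (u n) l) -(mdN (u n - l)) mdD.
lra.
Qed.

Lemma tendsV u l : tends u l -> l != 0 -> tends (fun n => (u n)^-1) l^-1.
Proof.
move=> h l0 e e0.
have l0' : 0 < md l by rewrite md_gt0.
have [N hN] := tends_neq0 h l0.
have e1 : 0 < e * (md l / 2 * md l) by rewrite !mulr_gt0 // invr_gt0.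
have [M hM] := h _ e1.
exists (maxn N M) => n; rewrite geq_max => /andP[/hN h1 /hM h2].
have un0 : 0 < md (u n) by apply: lt_trans h1; rewrite divr_gt0.
have un0' : u n != 0 by rewrite -md_gt0.
have -> : (u n)^-1 - l^-1 = (l - u n) / (u n * l) by field; apply/andP.
rewrite mdM mdV mdM mdB ltr_pdivrMr ?mulr_gt0 //.
apply: lt_trans h2 _; rewrite ltr_pM2l // ltr_pM2r //.
Qed.

Lemma tendsZ u l m : tends u l -> tends (fun n => m * u n) (m * l).
Proof. by apply: tendsM; apply: tends_cst. Qed.

Lemma tends_sub u l (f : nat -> nat) : (forall n, n <= f n)%N ->
  tends u l -> tends (fun n => u (f n)) l.
Proof.
move=> hf h e /h[N hN]; exists N => n Nn; apply: hN.
exact: leq_trans Nn (hf n).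
Qed.

Lemma tends_eventually u v l N : (forall n, N <= n -> u n = v n)%N ->
  tends u l -> tends v l.
Proof.
move=> uv h e /h[M hM]; exists (maxn N M) => n.
by rewrite geq_max => /andP[/uv <- /hM].
Qed.

End Tends.

(** * Unordered sums *)

Definition abs_summable (R : realType) (I : choiceType) (u : I -> R[i]) :=
  exists B : R, forall A : {fset I}, \sum_(i <- A) md (u i) <= B.

Definition has_sum (R : realType) (I : choiceType) (u : I -> R[i]) (s : R[i]) :=
  forall e : R, 0 < e -> exists A : {fset I},
    forall B : {fset I}, (A `<=` B)%fset -> md (\sum_(i <- B) u i - s) < e.

Section Sums.
Context {R : realType}.

Lemma usum_has_sum (I : choiceType) (u : I -> R[i]) s :
  has_sum u s -> usum u = s.
Proof.
move=> h; have F := @summability.totally_filter I.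
have H : (@summability.partial_sum I R[i]^o u @ @summability.totally I
           --> (s : R[i]^o))%classic.
  apply/cvgrPdist_lt => e e0.
  have eR : (complex.Re e)%:C = e by rewrite RRe_real // gtr0_real.
  have /h[A hA] : 0 < complex.Re e by rewrite -ltcR eR.
  exists A => // B /= AB; rewrite -eR mdE ltcR mdB.
  by have := hA _ AB; rewrite big_seq_fsetE.
exact: (cvg_lim (@norm_hausdorff _ _) H).
Qed.

Lemma has_sum_ext (I : choiceType) (u v : I -> R[i]) s :
  u =1 v -> has_sum u s -> has_sum v s.
Proof.
move=> uv h e /h[A hA]; exists A => B /hA.
by rewrite (eq_bigr _ (fun i _ => uv i)).
Qed.

Lemma has_sumD (I : choiceType) (u v : I -> R[i]) s t :
  has_sum u s -> has_sum v t -> has_sum (fun i => u i + v i) (s + t).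
Proof.
move=> hu hv e e0; have e2 : 0 < e / 2 by rewrite divr_gt0.
have [A hA] := hu _ e2; have [B hB] := hv _ e2.
exists (A `|` B)%fset => D; rewrite fsubUset => /andP[/hA h1 /hB h2].
rewrite big_split opprD addrACA; apply: le_lt_trans (mdD _ _) _; lra.
Qed.

Lemma has_sumZ (I : choiceType) (u : I -> R[i]) s c :
  has_sum u s -> has_sum (fun i => c * u i) (c * s).
Proof.
move=> hu e e0; have c0 := md_ge0 c.
have e2 : 0 < e / (1 + md c) by rewrite divr_gt0 //; lra.
have [A hA] := hu _ e2; exists A => B /hA h.
rewrite -mulr_sumr -mulrBr mdM.
apply: (@le_lt_trans _ _ ((1 + md c) * md (\sum_(i <- B) u i - s))).
  by rewrite ler_wpM2r ?md_ge0 // lerDr.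
move: h; rewrite ltr_pdivlMr; last lra.
by rewrite mulrC.
Qed.

(** Finite sums of nonnegative terms increase with the index set, so they converge to their
    supremum. *)
Lemma has_sum_ge0 (I : choiceType) (v : I -> R) (B : R) :
  (forall i, 0 <= v i) -> (forall A : {fset I}, \sum_(i <- A) v i <= B) ->
  exists s : R, has_sum (fun i => (v i)%:C) s%:C.
Proof.
move=> v0 hB.
pose S : set R := [set x : R | exists A : {fset I}, x = \sum_(i <- A) v i]%classic.
have hS : has_sup S.
  split; first by exists 0, fset0; rewrite big_seq_fset0.
  by exists B => x [A ->].
exists (sup S) => e e0.
have [x [A ->] hx] := sup_adherent e0 hS.
exists A => D AD.
have le1 : \sum_(i <- A) v i <= \sum_(i <- D) v i.
  rewrite [leRHS](big_fsetID _ (mem A)) /=.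
  have -> : [fset x in D | x \in A]%fset = A.
    apply/fsetP => y; rewrite !inE /=; apply: andb_idl => /=.
    exact: (fsubsetP AD).
  by rewrite lerDl sumr_ge0.
have le2 : \sum_(i <- D) v i <= sup S.
  by apply: sup_upper_bound => //; exists D.
rewrite mdB -rmorph_sum -rmorphB.
rewrite md_real ?subr_ge0 //=; lra.
Qed.

(** [v] is the difference of the nonnegative families [|v|] and [|v| - v], each with bounded finite
    sums. *)
Lemma has_sum_real (I : choiceType) (v : I -> R) (B : R) :
  (forall A : {fset I}, \sum_(i <- A) `|v i| <= B) ->
  exists s : R[i], has_sum (fun i => (v i)%:C) s.
Proof.
move=> hB.
have [|A|s hs] := @has_sum_ge0 I (fun i => `|v i|) B; rewrite //.
have [|A|t ht] := @has_sum_ge0 I (fun i => `|v i| - v i) (2 * B).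
- by move=> i; rewrite subr_ge0 ler_norm.
- have h : \sum_(i <- A) (`|v i| - v i) <= \sum_(i <- A) (2 * `|v i|).
    apply: ler_sum => i _; have := ler_norm (- v i); rewrite normrN; lra.
  by rewrite (le_trans h) // -mulr_sumr ler_pM2l.
exists (s%:C + -1 * t%:C).
apply: has_sum_ext (has_sumD hs (has_sumZ (-1) ht)) => i /=.
by rewrite rmorphB; ring.
Qed.

(** Source of all existence statements for sums: the real and imaginary parts are dominated by the
    modulus and converge separately. *)
Lemma abs_summableP (I : choiceType) (u : I -> R[i]) :
  abs_summable u -> has_sum u (usum u).
Proof.
move=> [B hB].
have [A|s hs] := @has_sum_real I (fun i => complex.Re (u i)) B.
  by apply: le_trans (hB A); apply: ler_sum => i _; apply: Re_le_md.
have [A|t ht] := @has_sum_real I (fun i => complex.Im (u i)) B.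
  by apply: le_trans (hB A); apply: ler_sum => i _; apply: Im_le_md.
have h : has_sum u (s + 'i%C * t).
  apply: has_sum_ext (has_sumD hs (has_sumZ _ ht)) => i /=.
  by rewrite -complexE.
by rewrite (usum_has_sum h).
Qed.

Lemma abs_summable_le (I : choiceType) (u : I -> R[i]) (v : I -> R[i]) :
  abs_summable v -> (forall i, md (u i) <= md (v i)) -> abs_summable u.
Proof.
by move=> [B hB] h; exists B => A; apply: le_trans (hB A); apply: ler_sum.
Qed.

Lemma abs_summableD (I : choiceType) (u v : I -> R[i]) :
  abs_summable u -> abs_summable v -> abs_summable (fun i => u i + v i).
Proof.
move=> [B hB] [D hD]; exists (B + D) => A.
apply: le_trans (lerD (hB A) (hD A)); rewrite -big_split.
by apply: ler_sum => i _; apply: mdD.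
Qed.

Lemma abs_summableZ (I : choiceType) (u : I -> R[i]) c :
  abs_summable u -> abs_summable (fun i => c * u i).
Proof.
move=> [B hB]; exists (md c * B) => A.
rewrite (eq_bigr (fun i => md c * md (u i))) => [|i _]; last by rewrite mdM.
by rewrite -mulr_sumr ler_wpM2l ?md_ge0.
Qed.

Lemma abs_summable_inj (I J : choiceType) (u : I -> R[i]) (f : J -> I) :
  injective f -> abs_summable u -> abs_summable (u \o f).
Proof.
move=> finj [B hB]; exists B => A.
apply: le_trans (hB [fset f x | x in A]%fset).
by rewrite big_imfset //=; move=> x y _ _; apply: finj.
Qed.

Lemma usumD (I : choiceType) (u v : I -> R[i]) :
  abs_summable u -> abs_summable v ->
  usum (fun i => u i + v i) = usum u + usum v.
Proof.
move=> /abs_summableP hu /abs_summableP hv.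
exact: usum_has_sum (has_sumD hu hv).
Qed.

Lemma usumZ (I : choiceType) (u : I -> R[i]) c :
  abs_summable u -> usum (fun i => c * u i) = c * usum u.
Proof. move=> /abs_summableP hu; exact: usum_has_sum (has_sumZ c hu). Qed.

Lemma eq_usum (I : choiceType) (u v : I -> R[i]) : u =1 v -> usum u = usum v.
Proof. by move=> uv; congr usum; apply/funext. Qed.

Lemma eq_csum (u v : nat -> R[i]) : u =1 v -> csum u = csum v.
Proof. by move=> uv; congr csum; apply/funext. Qed.

Lemma eq_abs_summable (I : choiceType) (u v : I -> R[i]) :
  u =1 v -> abs_summable u -> abs_summable v.
Proof. by move=> /funext ->. Qed.

Lemma has_sum_finite (I : choiceType) (u : I -> R[i]) (A : {fset I}) :
  (forall i, i \notin A -> u i = 0) -> has_sum u (\sum_(i <- A) u i).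
Proof.
move=> hA e e0; exists A => B AB.
rewrite (big_fsetID _ (mem A)) /=.
have -> : [fset x in B | x \in A]%fset = A.
  apply/fsetP => y; rewrite !inE /=; apply: andb_idl => /=.
  exact: (fsubsetP AB).
rewrite [X in _ + X - _]big_seq [X in _ + X - _]big1 ?addr0 ?subrr ?md0 // => i.
by rewrite !inE /= => /andP[_ /hA].
Qed.

Lemma has_sum_reindex (I J : choiceType) (u : I -> R[i]) (f : J -> I)
    (g : I -> J) s :
  cancel f g -> cancel g f -> has_sum u s -> has_sum (u \o f) s.
Proof.
move=> fg gf h e /h[A hA]; exists [fset g x | x in A]%fset => B AB.
have := hA [fset f x | x in B]%fset; rewrite big_imfset /=; last first.
  by move=> x y _ _; apply: (can_inj fg).
apply; apply/fsubsetP => x xA; apply/imfsetP; exists (g x); rewrite ?gf //=.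
by apply: (fsubsetP AB); rewrite in_imfset.
Qed.

Lemma usum_reindex (I J : choiceType) (u : I -> R[i]) (f : J -> I)
    (g : I -> J) :
  cancel f g -> cancel g f -> abs_summable u -> usum u = usum (u \o f).
Proof.
move=> fg gf /abs_summableP hu; symmetry.
exact: usum_has_sum (has_sum_reindex fg gf hu).
Qed.

Lemma big_uniq_fset (V : nmodType) (I : choiceType) (s : seq I) (F : I -> V) :
  uniq s -> \sum_(i <- [fset x in s]%fset) F i = \sum_(i <- s) F i.
Proof.
by move=> us; apply/perm_big/uniq_perm => // x; rewrite inE.
Qed.

Lemma has_sum_csum (u : nat -> R[i]) s :
  has_sum u s -> tends (fun n => \sum_(0 <= i < n) u i) s.
Proof.
move=> h e /h[A hA]; exists (\max_(i <- A) i.+1)%N => n hn.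
rewrite /index_iota subn0 -big_uniq_fset ?iota_uniq //; apply: hA.
apply/fsubsetP => x xA; rewrite inE /= mem_iota add0n /=.
by apply: leq_trans hn; apply: (@leq_bigmax_seq _ _ xpredT (fun i => i.+1)).
Qed.

Lemma csum_tends (u : nat -> R[i]) s :
  tends (fun n => \sum_(0 <= i < n) u i) s -> csum u = s.
Proof. by move=> /limn_tends. Qed.

(** Makes ordered series available to reindexing and splitting, which are proved for unordered sums
    only. *)
Lemma csum_usum (u : nat -> R[i]) : abs_summable u -> csum u = usum u.
Proof. by move=> /abs_summableP/has_sum_csum/csum_tends. Qed.

End Sums.

(** * Dominated convergence and Fubini *)

Section Exchange.
Context {R : realType}.

Lemma md_eq (x y : R[i]) : (forall e : R, 0 < e -> md (x - y) <= e) -> x = y.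
Proof.
move=> h; apply/eqP; rewrite -subr_eq0 -md_eq0 eq_le md_ge0 andbT.
by apply/ler_addgt0Pr => e /h; rewrite add0r.
Qed.

Lemma has_sum_seq (I : choiceType) (u : I -> R[i]) s e :
  has_sum u s -> 0 < e -> exists A : {fset I},
  forall t : seq I, uniq t -> {subset A <= t} -> md (\sum_(i <- t) u i - s) < e.
Proof.
move=> h /h[A hA]; exists A => t ut At; rewrite -big_uniq_fset //.
by apply: hA; apply/fsubsetP => x /At; rewrite inE.
Qed.

Lemma abs_summable_seq (I : choiceType) (u : I -> R[i]) : abs_summable u ->
  exists B : R, forall t : seq I, uniq t -> \sum_(i <- t) md (u i) <= B.
Proof. by move=> [B hB]; exists B => t ut; rewrite -big_uniq_fset. Qed.

(** The point is the order of the quantifiers: one finite set A serves all families dominated by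
    [g]. *)
Lemma abs_summable_tail (I : choiceType) (g : I -> R[i]) (e : R) :
  abs_summable g -> 0 < e -> exists A : {fset I},
  forall u : I -> R[i], (forall i, md (u i) <= md (g i)) ->
    md (usum u - \sum_(i <- A) u i) <= e.
Proof.
move=> hg e0.
have [B0 hB0] := hg.
have [i|s hs] := @has_sum_ge0 R I (fun i => md (g i)) B0 _ hB0.
  exact: md_ge0.
have e4 : 0 < e / 4 by rewrite divr_gt0.
have [A hA] := hs _ e4.
exists A => u hu.
have su := abs_summableP (abs_summable_le hg hu).
have [D hD] := su _ e4.
(* D depends on u but A does not; the part of E outside A is estimated through [g] alone. *)
pose E := (A `|` D)%fset.
have hE1 := hD E (fsubsetUr _ _); have hE2 := hA E (fsubsetUl _ _).
have hE3 := hA A (fsubset_refl _).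
have split_sum (V : nmodType) (F : I -> V) :
    \sum_(i <- E) F i = \sum_(i <- A) F i + \sum_(i <- E | i \notin A) F i.
  rewrite (big_fsetID _ (mem A)) /=; congr (_ + _).
    by apply: eq_fbigl => x; rewrite !inE /=; case: (x \in A); rewrite ?andbF.
  rewrite [RHS]big_fset_condE; apply: eq_fbigl => x; rewrite !inE /=.
  by case: (x \in A); rewrite ?andbF.
(* The sums of [md (g i)] over A and over E both lie within e / 4 of s. *)
have hT : \sum_(i <- E | i \notin A) md (g i) <= e / 2.
  have h := mdD (\sum_(i <- E) (md (g i))%:C - s%:C) (- (\sum_(i <- A) (md (g i))%:C - s%:C)).
  have hEA : \sum_(i <- E) (md (g i))%:C - s%:C - (\sum_(i <- A) (md (g i))%:C - s%:C)
      = (\sum_(i <- E | i \notin A) md (g i))%:C.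
    by rewrite split_sum rmorph_sum; ring.
  rewrite hEA mdN md_real in h; first by apply: le_trans h _; lra.
  by rewrite sumr_ge0 // => i _; apply: md_ge0.
have hT2 : md (\sum_(i <- E | i \notin A) u i) <= e / 2.
  by apply: le_trans (md_sum _ _ _) (le_trans _ hT); apply: ler_sum.
have -> : usum u - \sum_(i <- A) u i =
    - (\sum_(i <- E) u i - usum u) + \sum_(i <- E | i \notin A) u i.
  rewrite (split_sum _ u); ring.
by apply: le_trans (mdD _ _) _; rewrite mdN; lra.
Qed.

Lemma sum_subset_le (I : choiceType) (v : I -> R) (A : {fset I}) (t : seq I) :
  (forall i, 0 <= v i) -> uniq t -> {subset A <= t} ->
  \sum_(i <- A) v i <= \sum_(i <- t) v i.
Proof.
move=> v0 ut At.
have pA : perm_eq [seq x <- t | x \in A] A.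
  apply: uniq_perm; rewrite ?filter_uniq ?fset_uniq // => x.
  by rewrite mem_filter; apply: andb_idr => /At.
by rewrite -(perm_big _ pA) big_filter [leRHS](bigID (mem A)) /= lerDl sumr_ge0.
Qed.

Lemma tends_sum (I : Type) (s : seq I) (u : nat -> I -> R[i]) v :
  (forall i, tends (u^~ i) (v i)) ->
  tends (fun n => \sum_(i <- s) u n i) (\sum_(i <- s) v i).
Proof.
move=> h; elim: s => [|i s IH].
  rewrite big_nil; apply: tends_ext (tends_cst _) => n; by rewrite big_nil.
rewrite big_cons; apply: tends_ext (tendsD (h i) IH) => n.
by rewrite big_cons.
Qed.

Lemma tends_prod (I : Type) (s : seq I) (u : nat -> I -> R[i]) v :
  (forall i, tends (u^~ i) (v i)) ->
  tends (fun n => \prod_(i <- s) u n i) (\prod_(i <- s) v i).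
Proof.
move=> h; elim: s => [|i s IH].
  rewrite big_nil; apply: tends_ext (tends_cst _) => n; by rewrite big_nil.
rewrite big_cons; apply: tends_ext (tendsM (h i) IH) => n.
by rewrite big_cons.
Qed.

Lemma tends_md_le (u : nat -> R[i]) l (B : R) :
  tends u l -> (forall n, md (u n) <= B) -> md l <= B.
Proof.
move=> h hB; apply/ler_addgt0Pr => e /h[N /(_ N (leqnn N)) hN].
have := mdD (u N) (- (u N - l)); rewrite mdN subKr.
have := hB N; lra.
Qed.

(** Dominated convergence: the uniform tail estimate leaves finitely many indices, where pointwise
    convergence suffices. *)
Lemma tannery (I : choiceType) (u : nat -> I -> R[i]) (v g : I -> R[i]) :
  abs_summable g -> (forall n i, md (u n i) <= md (g i)) ->
  (forall i, tends (u^~ i) (v i)) ->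
  tends (fun n => usum (u n)) (usum v).
Proof.
move=> hg hu huv e e0.
have e4 : 0 < e / 4 by rewrite divr_gt0.
have hv i : md (v i) <= md (g i) by apply: tends_md_le (huv i) _.
have [A hA] := abs_summable_tail hg e4.
have [N hN] := tends_sum A huv e4.
exists N => n /hN h1.
have h2 := hA _ (hu n); have h3 := hA _ hv.
have -> : usum (u n) - usum v = (usum (u n) - \sum_(i <- A) u n i)
   + (\sum_(i <- A) u n i - \sum_(i <- A) v i)
   + - (usum v - \sum_(i <- A) v i) by ring.
apply: le_lt_trans (mdD _ _) _; rewrite mdN.
have := mdD (usum (u n) - \sum_(i <- A) u n i) (\sum_(i <- A) u n i - \sum_(i <- A) v i).
lra.
Qed.

Lemma usum_sum_type (J K : choiceType) (v : J + K -> R[i]) :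
  abs_summable v -> usum v = usum (v \o inl) + usum (v \o inr).
Proof.
move=> hv; apply: md_eq => e e0; have e4 : 0 < e / 4 by rewrite divr_gt0.
have [A0 h0] := has_sum_seq (abs_summableP hv) e4.
have hl : abs_summable (v \o inl) by apply: abs_summable_inj hv => x y [].
have hr : abs_summable (v \o inr) by apply: abs_summable_inj hv => x y [].
have [A1 h1] := has_sum_seq (abs_summableP hl) e4.
have [A2 h2] := has_sum_seq (abs_summableP hr) e4.
pose D1 := undup (A1 ++ pmap (fun z : J + K => if z is inl x then Some x else None) A0).
pose D2 := undup (A2 ++ pmap (fun z : J + K => if z is inr x then Some x else None) A0).
have u1 : uniq D1 by apply: undup_uniq.
have u2 : uniq D2 by apply: undup_uniq.
have H1 : md (\sum_(i <- D1) (v \o inl) i - usum (v \o inl)) < e / 4.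
  by apply: h1 => // x xA; rewrite mem_undup mem_cat xA.
have H2 : md (\sum_(i <- D2) (v \o inr) i - usum (v \o inr)) < e / 4.
  by apply: h2 => // x xA; rewrite mem_undup mem_cat xA.
have := h0 (map inl D1 ++ map inr D2).
rewrite cat_uniq !map_inj_uniq ?u1 ?u2 ?andbT /=; try by move=> x y [].
have -> : ~~ has (in_mem^~ (mem [seq inl i | i <- D1])) [seq inr i | i <- D2].
  apply/hasPn => x /mapP[y _ ->]; apply/negP => /mapP[z _]; by [].
move=> /(_ isT); rewrite big_cat !big_map /= => H0.
have {}H0 : md (\sum_(i <- D1) v (inl i) + \sum_(i <- D2) v (inr i) - usum v) < e / 4.
  apply: H0 => -[x|x] xA; rewrite mem_cat.
    rewrite map_f // mem_undup mem_cat mem_pmap; apply/orP; right.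
    by apply/mapP; exists (inl x).
  rewrite [X in _ || X]map_f ?orbT // mem_undup mem_cat mem_pmap; apply/orP; right.
  by apply/mapP; exists (inr x).
rewrite /= in H1 H2.
have -> : usum v - (usum (v \o inl) + usum (v \o inr)) =
  - (\sum_(i <- D1) v (inl i) + \sum_(i <- D2) v (inr i) - usum v) +
  (\sum_(i <- D1) v (inl i) - usum (v \o inl)) +
  (\sum_(i <- D2) v (inr i) - usum (v \o inr)) by ring.
apply: le_trans (mdD _ _) _.
have := mdD (- (\sum_(i <- D1) v (inl i) + \sum_(i <- D2) v (inr i) - usum v)) 
  (\sum_(i <- D1) v (inl i) - usum (v \o inl)).
rewrite mdN; lra.
Qed.

Lemma fubini_rows (I J : choiceType) (u : I * J -> R[i]) i :
  abs_summable u -> abs_summable (fun j => u (i, j)).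
Proof. by apply: abs_summable_inj => x y []. Qed.

(** For finitely many rows, each row sum is replaced by a finite sum with an error of at most e /
    (size A + 1). Letting [H] also contain the columns of D makes the finite region large enough to
    approximate the full double sum. *)
Lemma fubini_exhaust (I J : choiceType) (u : I * J -> R[i]) (A : seq I)
    (D : {fset I * J}) (e : R) :
  abs_summable u -> 0 < e -> exists H : I -> {fset J},
  [/\ md (\sum_(i <- A) usum (fun j => u (i, j))
         - \sum_(i <- A) \sum_(j <- H i) u (i, j)) <= e,
    \sum_(i <- A) md (usum (fun j => u (i, j)))
       <= \sum_(i <- A) \sum_(j <- H i) md (u (i, j)) + e &
    forall i j, (i, j) \in D -> j \in H i].
Proof.
move=> hu e0; pose d := e / (size A).+1%:R.
have d0 : 0 < d by rewrite divr_gt0 // ltr0n.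
have /choice[H0 hH0] : forall i, exists H : {fset J}, forall t : {fset J},
    (H `<=` t)%fset -> md (\sum_(j <- t) u (i, j) - usum (fun j => u (i, j))) < d.
  by move=> i; apply: (abs_summableP (fubini_rows i hu)).
pose H i := (H0 i `|` [fset x.2 | x in D])%fset.
have hH i := hH0 i (H i) (fsubsetUl _ _).
have dA : \sum_(i <- A) d <= e.
  rewrite big_const_seq count_predT iter_addr_0 -mulr_natr /d.
  rewrite mulrAC ler_pdivrMr ?ltr0n // ler_pM2l // ler_nat.
  exact: leqnSn.
exists H; split.
- rewrite -sumrB; apply: le_trans (md_sum _ _ _) (le_trans _ dA).
  by apply: ler_sum => i _; rewrite mdB ltW.
- apply: le_trans (lerD (lexx _) dA); rewrite -big_split; apply: ler_sum => i _.
  have := mdD (\sum_(j <- H i) u (i, j)) (- (\sum_(j <- H i) u (i, j) - usum (fun j => u (i, j)))).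
  rewrite mdN subKr => h; apply: le_trans h _.
  by apply: lerD; [apply: md_sum|apply/ltW/hH].
- by move=> i j ijD; rewrite !inE; apply/orP; right; apply/imfsetP; exists (i, j).
Qed.

Lemma uniq_pairs (I J : choiceType) (A : seq I) (H : I -> {fset J}) :
  uniq A -> uniq [seq (i, j) | i <- A, j <- H i].
Proof.
move=> uA; apply: allpairs_uniq_dep => //.
by move=> [a b] [c d] _ _ /= [-> ->].
Qed.

Lemma fubini_abs_summable (I J : choiceType) (u : I * J -> R[i]) :
  abs_summable u -> abs_summable (fun i => usum (fun j => u (i, j))).
Proof.
move=> hu; have [B hB] := abs_summable_seq hu; exists B => A.
apply/ler_addgt0Pr => e e0.
have [H [_ h _]] := fubini_exhaust A fset0 hu e0.
apply: le_trans h _; rewrite lerD2r.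
have := hB [seq (i, j) | i <- A, j <- H i] (uniq_pairs _ (fset_uniq A)).
by rewrite big_allpairs_dep.
Qed.

(** One finite region is close to both sides: its rows exhaust the iterated sum and it contains the
    set A0 that exhausts the double sum. *)
Lemma fubini (I J : choiceType) (u : I * J -> R[i]) :
  abs_summable u -> usum u = usum (fun i => usum (fun j => u (i, j))).
Proof.
move=> hu; apply: md_eq => e e0; have e4 : 0 < e / 4 by rewrite divr_gt0.
have [A0 h0] := has_sum_seq (abs_summableP hu) e4.
have [A1 h1] := has_sum_seq (abs_summableP (fubini_abs_summable hu)) e4.
pose A := undup (A1 ++ [seq x.1 | x <- A0]).
have uA : uniq A by apply: undup_uniq.
have [H [h2 _ hH]] := fubini_exhaust A A0 hu e4.
have {}h1 : md (\sum_(i <- A) usum (fun j => u (i, j)) - usum (fun i => usum (fun j => u (i, j)))) < e / 4.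
  by apply: h1 => // x xA; rewrite mem_undup mem_cat xA.
have := h0 _ (uniq_pairs H uA); rewrite big_allpairs_dep => {}h0.
have {}h0 : md (\sum_(i <- A) \sum_(j <- H i) u (i, j) - usum u) < e / 4.
  apply: h0 => -[i j] ijA; apply/allpairsPdep; exists i, j; split => //.
    by rewrite mem_undup mem_cat; apply/orP; right; apply/mapP; exists (i, j).
  exact: hH.
rewrite -(mdN (_ - _)) in h0; rewrite -(mdN (_ - _)) in h2.
set X := usum u; set Y := usum (fun i => _).
set P := \sum_(i <- A) \sum_(j <- H i) u (i, j) in h0 h2.
set Q := \sum_(i <- A) usum (fun j => u (i, j)) in h1 h2.
have -> : X - Y = - (P - X) + - (Q - P) + (Q - Y) by ring.
apply: le_trans (mdD _ _) _.
have := mdD (- (P - X)) (- (Q - P)).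
rewrite -/X -/Y in h0 h1; lra.
Qed.

Lemma abs_summable_pair (I J : choiceType) (g : I -> R[i]) (h : J -> R[i]) :
  abs_summable g -> abs_summable h ->
  abs_summable (fun x : I * J => g x.1 * h x.2).
Proof.
move=> [B hB] [D hD].
have B0 : 0 <= B by have := hB fset0; rewrite big_seq_fset0.
exists (B * D) => A.
pose A1 := [fset x.1 | x in A]%fset; pose A2 := [fset x.2 | x in A]%fset.
have uP : uniq [seq (i, j) | i <- A1, j <- A2].
  by apply: (@uniq_pairs _ _ A1 (fun=> A2)).
apply: (@le_trans _ _ (\sum_(x <- [seq (i, j) | i <- A1, j <- A2]) md (g x.1 * h x.2))).
  apply: sum_subset_le => // [x|[i j] ijA]; first exact: md_ge0.
  by apply/allpairsP; exists (i, j); split => //; apply/imfsetP; exists (i, j).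
rewrite big_allpairs_dep /=.
rewrite (eq_bigr (fun i => md (g i) * \sum_(j <- A2) md (h j))) => [|i _]; last first.
  by rewrite mulr_sumr; apply: eq_bigr => j _; rewrite mdM.
rewrite -mulr_suml; apply: ler_pM => //; rewrite sumr_ge0 // => i _; exact: md_ge0.
Qed.

Lemma abs_summable_geom (r : R) : 0 <= r -> r < 1 ->
  abs_summable (fun n : nat => (r ^+ n)%:C).
Proof.
move=> r0 r1; exists (1 - r)^-1 => A.
rewrite (eq_bigr (fun n => r ^+ n)) => [|n _]; last by rewrite md_real ?exprn_ge0.
pose N := (\max_(i <- A) i.+1)%N.
apply: (@le_trans _ _ (\sum_(0 <= i < N) r ^+ i)).
  apply: sum_subset_le => // [i||x xA]; rewrite ?exprn_ge0 ?iota_uniq //.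
  rewrite mem_index_iota /=.
  exact: (@leq_bigmax_seq _ _ xpredT (fun i => i.+1)).
rewrite -[leRHS]mul1r ler_pdivlMr ?subr_gt0 // big_mkord.
have -> : (\sum_(i < N) r ^+ i) * (1 - r) = 1 - r ^+ N.
  by rewrite mulrC -[1 - r]opprB mulNr -subrX1 opprB.
by rewrite gerBl exprn_ge0.
Qed.
End Exchange.

(** * Summability criteria and decompositions of index sets *)

Section Families.
Context {R : realType}.

Lemma abs_summable_nat (u : nat -> R[i]) (C r : R) : 0 <= r -> r < 1 ->
  (forall n, md (u n) <= C * r ^+ n) -> abs_summable u.
Proof.
move=> r0 r1 h.
have C0 : 0 <= C by have := h 0%N; rewrite mulr1; apply: le_trans; apply: md_ge0.
apply: abs_summable_le (abs_summableZ C%:C (abs_summable_geom r0 r1)) _ => n.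
by rewrite mdM !md_real ?exprn_ge0.
Qed.

Lemma abs_summable_finType (I : finType) (u : I -> R[i]) : abs_summable u.
Proof.
exists (\sum_(i <- enum I) md (u i)) => A.
by apply: sum_subset_le; rewrite ?enum_uniq // => i; rewrite ?md_ge0 ?mem_enum.
Qed.

Lemma abs_summable_int (u : int -> R[i]) (C r : R) : 0 <= r -> r < 1 ->
  (forall n, md (u n) <= C * r ^+ `|n|%N) -> abs_summable u.
Proof.
move=> r0 r1 h.
have C0 : 0 <= C by have := h 0; rewrite mulr1; apply: le_trans; apply: md_ge0.
have h1 := abs_summable_pair (@abs_summable_finType bool (fun=> C%:C)) (abs_summable_geom r0 r1).
apply: (@abs_summable_le _ _ _ (fun n : int => C%:C * (r ^+ `|n|%N)%:C)) => [|n].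
  apply: (abs_summable_inj (f := fun n : int => (0 <= n, `|n|%N)) _ h1).
  by move=> x y /= [h2 h3]; lia.
by rewrite mdM !md_real ?exprn_ge0.
Qed.

Lemma abs_summable_int2 (u : int * int -> R[i]) (C r : R) : 0 <= r -> r < 1 ->
  (forall a b, md (u (a, b)) <= C * r ^+ (`|a| + `|b|)%N) -> abs_summable u.
Proof.
move=> r0 r1 h.
have C0 : 0 <= C by have := h 0 0; rewrite mulr1; apply: le_trans; apply: md_ge0.
have hr : abs_summable (fun n : int => (r ^+ `|n|%N)%:C).
  by apply: (@abs_summable_int _ 1 r) => // n; rewrite mul1r md_real ?exprn_ge0.
apply: abs_summable_le (abs_summableZ C%:C (abs_summable_pair hr hr)) _ => -[a b].
by rewrite !mdM !md_real ?exprn_ge0 // -exprD.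
Qed.

Lemma usum_seq (I : choiceType) (s : seq I) (u : I -> R[i]) :
  uniq s -> (forall i, i \notin s -> u i = 0) -> usum u = \sum_(i <- s) u i.
Proof.
move=> us h; rewrite -big_uniq_fset //.
by apply/usum_has_sum/has_sum_finite => i; rewrite inE; apply: h.
Qed.

Lemma usum_nat_finite (u : nat -> R[i]) n : (forall i, (n <= i)%N -> u i = 0) ->
  usum u = \sum_(i < n) u i.
Proof.
move=> h; rewrite -(big_mkord xpredT); apply: usum_seq => [|i].
  exact: iota_uniq.
by rewrite mem_index_iota /= -leqNgt; apply: h.
Qed.

Lemma usum_symsum (u : int -> R[i]) n : (forall j, (n < `|j|)%N -> u j = 0) ->
  usum u = symsum n u.
Proof.
move=> h; rewrite /symsum -(big_mkord xpredT (fun k : nat => u (k%:Z - n%:Z))).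
rewrite -(big_map (fun k : nat => k%:Z - n%:Z) xpredT u).
apply: usum_seq => [|i hi].
  by rewrite map_inj_uniq ?iota_uniq // => x y; lia.
apply: h; rewrite ltnNge; apply: contra hi => hi.
by apply/mapP; exists (absz ((i : int) + n%:Z)); rewrite ?mem_index_iota; lia.
Qed.

(** Version for ranges that grow with n: the array is extended by 0 beyond k = n, which for fixed k
    changes only finitely many n. *)
Lemma tannery_nat (a : nat -> nat -> R[i]) (v : nat -> R[i]) (C r : R) :
  0 <= r -> r < 1 -> (forall n k, (k <= n)%N -> md (a n k) <= C * r ^+ k) ->
  (forall k, tends (a^~ k) (v k)) ->
  tends (fun n => \sum_(k < n.+1) a n k) (csum v).
Proof.
move=> r0 r1 h hv.
have C0 : 0 <= C by have := h 0%N 0%N (leqnn _); rewrite mulr1; apply: le_trans; apply: md_ge0.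
have hg : abs_summable (fun k : nat => (C * r ^+ k)%:C).
  by apply: (@abs_summable_nat _ C r) => // n; rewrite md_real // mulr_ge0 ?exprn_ge0.
pose b n k := if (k <= n)%N then a n k else 0.
have hb n k : md (b n k) <= md (C * r ^+ k)%:C.
  rewrite /b md_real ?mulr_ge0 ?exprn_ge0 //.
  by case: leqP => [/h//|_]; rewrite md0 mulr_ge0 ?exprn_ge0.
have hbv k : tends (b^~ k) (v k).
  apply: (@tends_eventually _ (a^~ k) _ _ k) (hv k) => n kn.
  by rewrite /b kn.
have H := tannery hg hb hbv.
rewrite csum_usum; last first.
  by apply: abs_summable_le hg _ => k; apply: tends_md_le (hbv k) _.
apply: tends_ext H => n; rewrite (@usum_nat_finite _ n.+1) => [|i ni].
  by apply: eq_bigr => k _; rewrite /b -ltnS ltn_ord.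
by rewrite /b leqNgt ni.
Qed.

Lemma tannery_int (a : nat -> int -> R[i]) (v : int -> R[i]) (C r : R) :
  0 <= r -> r < 1 -> (forall n k, (`|k| <= n)%N -> md (a n k) <= C * r ^+ `|k|%N) ->
  (forall k, tends (a^~ k) (v k)) ->
  abs_summable v /\ tends (fun n => symsum n (a n)) (usum v).
Proof.
move=> r0 r1 h hv.
have C0 : 0 <= C by have := h 0%N 0 (leqnn _); rewrite mulr1; apply: le_trans; apply: md_ge0.
have hg : abs_summable (fun k : int => (C * r ^+ `|k|%N)%:C).
  by apply: (@abs_summable_int _ C r) => // n; rewrite md_real // mulr_ge0 ?exprn_ge0.
pose b n k := if (`|k| <= n)%N then a n k else 0.
have hb n k : md (b n k) <= md (C * r ^+ `|k|%N)%:C.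
  rewrite /b md_real ?mulr_ge0 ?exprn_ge0 //.
  by case: leqP => [/h//|_]; rewrite md0 mulr_ge0 ?exprn_ge0.
have hbv k : tends (b^~ k) (v k).
  apply: (@tends_eventually _ (a^~ k) _ _ `|k|%N) (hv k) => n kn.
  by rewrite /b kn.
split; first by apply: abs_summable_le hg _ => k; apply: tends_md_le (hbv k) _.
have H := tannery hg hb hbv.
apply: tends_ext H => n; rewrite (@usum_symsum _ n) => [|i ni].
  rewrite /symsum; apply: eq_bigr => k _; rewrite /b.
  by have -> : (absz ((k : nat)%:Z - n%:Z)%R <= n)%N by have := ltn_ord k; lia.
by rewrite /b leqNgt ni.
Qed.

(** The hypotheses on [h] say that [f] and [g] are injective with disjoint images covering I. *)
Lemma usum_split (I J K : choiceType) (f : J -> I) (g : K -> I)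
    (h : I -> J + K) (u : I -> R[i]) :
  cancel h (fun x => match x with inl j => f j | inr k => g k end) ->
  (forall j, h (f j) = inl j) -> (forall k, h (g k) = inr k) ->
  abs_summable u ->
  usum u = usum (u \o f) + usum (u \o g).
Proof.
move=> hK hf hg hu.
pose F x := match x with inl j => f j | inr k => g k end.
have FK : cancel F h by case=> x /=; rewrite ?hf ?hg.
rewrite (usum_reindex FK hK hu) usum_sum_type //.
exact: (abs_summable_inj (can_inj FK) hu).
Qed.

Lemma usum_int_nat (u : int -> R[i]) : abs_summable u ->
  usum u = usum (fun n : nat => u n%:Z) + usum (fun n : nat => u (- n.+1%:Z)).
Proof.
move=> hu.
rewrite (@usum_split _ _ _ Posz Negz (fun n => match n with Posz n => inl n | Negz n => inr n end)) //.
by case.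
Qed.

Lemma usum_int_parity (u : int -> R[i]) : abs_summable u ->
  usum u = usum (fun n : int => u (2 * n)) + usum (fun n : int => u (2 * n + 1)).
Proof.
move=> hu.
apply: (@usum_split _ _ _ (fun n : int => 2 * n) (fun n : int => 2 * n + 1)
  (fun n => if (n %% 2 == 0)%Z then inl (n %/ 2)%Z else inr (n %/ 2)%Z)) => //.
- by move=> n; case: ifP => /= h; lia.
- by move=> n; case: ifP => /= h; [congr inl|]; lia.
- by move=> n; case: ifP => /= h; [|congr inr]; lia.
Qed.

Lemma usum_lattice (u : int * int -> R[i]) : abs_summable u ->
  usum u = usum (fun x : int * int => u (x.1 + x.2, x.1 - x.2)) +
           usum (fun x : int * int => u (x.1 + x.2 + 1, x.1 - x.2)).
Proof.
move=> hu.
apply: (@usum_split _ _ _ (fun x : int * int => (x.1 + x.2, x.1 - x.2)) 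
  (fun x : int * int => (x.1 + x.2 + 1, x.1 - x.2))
  (* On both classes half of [x.1 + x.2], rounded down, is the first coordinate of the preimage, and
     [x.2] is the difference of its coordinates. *)
  (fun x => let s := ((x.1 + x.2) %/ 2)%Z in
    if ((x.1 + x.2) %% 2 == 0)%Z then inl (s, s - x.2) else inr (s, s - x.2))) => //.
- by move=> [m n] /=; case: ifP => /= h; congr pair; lia.
- by move=> [m n] /=; case: ifP => /= h; [congr (inl (_, _))|]; lia.
- by move=> [m n] /=; case: ifP => /= h; [|congr (inr (_, _))]; lia.
Qed.

Lemma usum_nat_parity (u : nat -> R[i]) : abs_summable u ->
  usum u = usum (fun n : nat => u (2 * n)%N) + usum (fun n : nat => u (2 * n + 1)%N).
Proof.
move=> hu.
apply: (@usum_split _ _ _ (fun n : nat => (2 * n)%N) (fun n : nat => (2 * n + 1)%N)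
  (fun n => if ~~ odd n then inl n./2 else inr n./2)) => //.
- by move=> n; case: ifP => /= h; lia.
- by move=> n; case: ifP => /= h; [congr inl|]; lia.
- by move=> n; case: ifP => /= h; [|congr inr]; lia.
Qed.

End Families.

(** * Infinite products *)

Section QPoch.
Context {R : realType}.
Implicit Types x p : R[i].

Lemma qpoch0 x p : qpoch x p 0 = 1.
Proof. by rewrite /qpoch big_ord0. Qed.

Lemma qpochS x p n : qpoch x p n.+1 = qpoch x p n * (1 - x * p ^+ n).
Proof. by rewrite /qpoch big_ord_recr. Qed.

Lemma qpochSl x p n : qpoch x p n.+1 = (1 - x) * qpoch (x * p) p n.
Proof.
rewrite /qpoch big_ord_recl expr0 mulr1; congr (_ * _).
by apply: eq_bigr => i _; rewrite /= exprS mulrA.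
Qed.

Lemma qpochD x p m n : qpoch x p (m + n) = qpoch x p m * qpoch (x * p ^+ m) p n.
Proof.
elim: n => [|n IH]; first by rewrite addn0 qpoch0 mulr1.
by rewrite addnS !qpochS IH exprD !mulrA.
Qed.

Lemma qpoch_neq0 x p n : (forall k, (k < n)%N -> x * p ^+ k != 1) ->
  qpoch x p n != 0.
Proof.
move=> h; rewrite /qpoch; apply/prodf_neq0 => k _.
by rewrite subr_eq0 eq_sym h.
Qed.

Lemma abs_summable_tends0 (u : nat -> R[i]) : abs_summable u -> tends u 0.
Proof.
move=> /abs_summableP/has_sum_csum h.
have h1 := tends_sub (f := S) (fun n => leqnSn n) h.
rewrite -(subrr (usum u)).
have := tendsD h1 (tendsZ (-1) h); rewrite mulN1r; apply: tends_ext => n.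
rewrite big_nat_recr //=; ring.
Qed.

Lemma tends_expr p : md p < 1 -> tends (fun n => p ^+ n) 0.
Proof.
move=> p1; apply: abs_summable_tends0.
by apply: (@abs_summable_nat _ _ 1 (md p)) => // [|n]; rewrite ?md_ge0 // mul1r mdX.
Qed.

Lemma geom_sum_le (r : R) n : 0 <= r -> r < 1 -> \sum_(i < n) r ^+ i <= (1 - r)^-1.
Proof.
move=> r0 r1; rewrite -[leRHS]mul1r ler_pdivlMr ?subr_gt0 //.
have -> : (\sum_(i < n) r ^+ i) * (1 - r) = 1 - r ^+ n.
  by rewrite mulrC -[1 - r]opprB mulNr -subrX1 opprB.
by rewrite gerBl exprn_ge0.
Qed.

(** Each factor is bounded by 1 + t <= exp t, and the t form a geometric series. *)
Lemma qpoch_bounded x p : md p < 1 ->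
  exists B : R, 0 < B /\ forall n, md (qpoch x p n) <= B.
Proof.
move=> p1; exists (expR (md x / (1 - md p))); split; first exact: expR_gt0.
move=> n.
have h : md (qpoch x p n) <= expR (\sum_(i < n) md x * md p ^+ i).
  elim: n => [|n IH]; first by rewrite qpoch0 md1 big_ord0 expR0.
  rewrite qpochS mdM big_ord_recr /= expRD.
  apply: ler_pM; rewrite ?md_ge0 //.
  apply: le_trans (mdD _ _) _; rewrite mdN md1 mdM mdX; exact: expR_ge1Dx.
apply: le_trans h _; rewrite ler_expR -mulr_sumr ler_wpM2l ?md_ge0 //.
by apply: geom_sum_le; rewrite ?md_ge0.
Qed.

(** Consecutive products differ by - x p^n (x;p)_n, which decays geometrically because the products
    are bounded; the product is thus a convergent telescoping series. *)
Lemma qpoch_cvg x p : md p < 1 -> tends (qpoch x p) (qpoch_oo x p).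
Proof.
move=> p1; have [B [B0 hB]] := qpoch_bounded x p1.
have hs : abs_summable (fun n => - (x * p ^+ n * qpoch x p n)).
  apply: (@abs_summable_nat _ _ (md x * B) (md p)); rewrite ?md_ge0 // => n.
  rewrite mdN !mdM mdX -mulrA [md p ^+ n * _]mulrC mulrA.
  by rewrite ler_wpM2r ?exprn_ge0 ?md_ge0 // ler_wpM2l ?md_ge0.
have := tendsD (tends_cst 1) (has_sum_csum (abs_summableP hs)).
set l := _ + _ => hl.
have {}hl : tends (qpoch x p) l.
  apply: tends_ext hl => n; elim: n => [|n IH]; first by rewrite big_geq // qpoch0 addr0.
  by rewrite big_nat_recr //= addrA IH qpochS; ring.
by rewrite /qpoch_oo (limn_tends hl).
Qed.

Lemma qpoch_oo_shift x p n : md p < 1 ->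
  qpoch_oo x p = qpoch x p n * qpoch_oo (x * p ^+ n) p.
Proof.
move=> p1.
have h1 := tends_sub (f := addn n) (fun m => leq_addl n m) (qpoch_cvg x p1).
have h2 := tendsZ (qpoch x p n) (qpoch_cvg (x * p ^+ n) p1).
apply: tends_unique h1 _; apply: tends_ext h2 => m; by rewrite qpochD.
Qed.

(** A product of factors 1 - t_i is at least 1 minus the sum of the t_i as long as that sum is at
    most 1; otherwise the bound is trivial. *)
Lemma qpoch_ge x p n : md p < 1 -> 1 - md x / (1 - md p) <= md (qpoch x p n).
Proof.
move=> p1; wlog small : / md x / (1 - md p) <= 1.
  move=> h; have [/h//|big] := leP (md x / (1 - md p)) 1.
  by apply: le_trans (md_ge0 _); rewrite subr_le0 ltW.
have p1' : 0 < 1 - md p by rewrite subr_gt0.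
have h : 1 - \sum_(i < n) md x * md p ^+ i <= md (qpoch x p n).
  elim: n => [|n IH]; first by rewrite qpoch0 md1 big_ord0 subr0.
  have s1 m : \sum_(i < m) md x * md p ^+ i <= 1.
    apply: le_trans small; rewrite -mulr_sumr ler_wpM2l ?md_ge0 //.
    by apply: geom_sum_le; rewrite ?md_ge0.
  have s0 : 0 <= \sum_(i < n) md x * md p ^+ i.
    by rewrite sumr_ge0 // => i _; rewrite mulr_ge0 ?exprn_ge0 ?md_ge0.
  have := s1 n.+1; rewrite big_ord_recr /= qpochS mdM => s2.
  have t0 : 0 <= md x * md p ^+ n by rewrite mulr_ge0 ?exprn_ge0 ?md_ge0.
  have t1 : 1 - md x * md p ^+ n <= md (1 - x * p ^+ n).
    have := mdD (1 - x * p ^+ n) (x * p ^+ n); rewrite subrK md1 mdM mdX; lra.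
  have := ler_pM (_ : 0 <= 1 - \sum_(i < n) md x * md p ^+ i) (_ : 0 <= 1 - md x * md p ^+ n) IH t1.
  move=> /(_ _ _)/le_trans; set S := \sum_(i < n) _ in s0 s1 s2 IH *; set t := md x * _ in t0 t1 s2 *.
  move=> H; apply: (le_trans _ (H _ _ _ (lexx _))); [|lra|lra].
  by have : 0 <= S * t by [apply: mulr_ge0]; lra.
apply: le_trans h; rewrite lerD2l lerN2 -mulr_sumr ler_wpM2l ?md_ge0 //.
by apply: geom_sum_le; rewrite ?md_ge0.
Qed.

(** Finitely many nonzero factors are split off until the remaining argument is so small that
    [qpoch_ge] keeps the tail products above 1 / 2. *)
Lemma qpoch_oo_neq0 x p : md p < 1 -> (forall k, x * p ^+ k != 1) ->
  qpoch_oo x p != 0.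
Proof.
move=> p1 h.
have p1' : 0 < 1 - md p by rewrite subr_gt0.
have e0 : 0 < (1 - md p) / 2 by rewrite divr_gt0.
have [K hK] := tendsZ x (tends_expr p1) e0.
have := hK K (leqnn _); rewrite mulr0 subr0 => hx.
rewrite (qpoch_oo_shift x K p1) mulf_neq0 ?qpoch_neq0 //.
rewrite -md_gt0; apply: (@lt_le_trans _ _ (1 / 2)); first by lra.
set y := x * p ^+ K.
have low n : 1 / 2 <= md (qpoch y p n).
  apply: le_trans (qpoch_ge y n p1).
  have : md y / (1 - md p) <= 1 / 2 by rewrite ler_pdivrMr //; rewrite -/y in hx; lra.
  lra.
have [//|lt] := leP (1 / 2) (md (qpoch_oo y p)).
have e1 : 0 < 1 / 2 - md (qpoch_oo y p) by rewrite subr_gt0.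
have [N /(_ N (leqnn _)) hN] := qpoch_cvg y p1 e1.
have := mdD (qpoch y p N - qpoch_oo y p) (qpoch_oo y p); rewrite subrK.
have := low N; lra.
Qed.

Lemma qpochV_cvg x p : md p < 1 -> (forall k, x * p ^+ k != 1) ->
  tends (fun n => (qpoch x p n)^-1) (qpoch_oo x p)^-1.
Proof. by move=> p1 h; apply: tendsV (qpoch_cvg _ p1) (qpoch_oo_neq0 p1 h). Qed.

Lemma qpochV_bounded x p : md p < 1 -> (forall k, x * p ^+ k != 1) ->
  exists B : R, 0 < B /\ forall n, md (qpoch x p n)^-1 <= B.
Proof. by move=> p1 h; apply: tends_bounded (qpochV_cvg p1 h). Qed.

Lemma md_lt1_neq1 x : md x < 1 -> x != 1.
Proof. by apply: contraTneq => ->; rewrite md1 ltxx. Qed.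

Lemma md_expr_lt1 p n : md p < 1 -> (0 < n)%N -> md (p ^+ n) < 1.
Proof. by move=> p1 n0; rewrite mdX exprn_ilt1 ?md_ge0 // -lt0n. Qed.

Lemma qpp_neq1 p : md p < 1 -> forall k, p * p ^+ k != 1.
Proof. by move=> p1 k; rewrite -exprS md_lt1_neq1 // md_expr_lt1. Qed.

Lemma qpoch_oo_recl x p : md p < 1 ->
  qpoch_oo x p = (1 - x) * qpoch_oo (x * p) p.
Proof.
by move=> p1; rewrite (qpoch_oo_shift x 1 p1) qpochS qpoch0 expr0 mulr1 mul1r.
Qed.

Lemma qpoch_mulN x p n : qpoch x p n * qpoch (- x) p n = qpoch (x ^+ 2) (p ^+ 2) n.
Proof.
rewrite /qpoch -big_split /=; apply: eq_bigr => i _.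
by rewrite -exprM mulnC exprM; ring.
Qed.

Lemma qpoch_oo_mulN x p : md p < 1 ->
  qpoch_oo x p * qpoch_oo (- x) p = qpoch_oo (x ^+ 2) (p ^+ 2).
Proof.
move=> p1; apply: tends_unique (tendsM (qpoch_cvg x p1) (qpoch_cvg (- x) p1)) _.
have p2 : md (p ^+ 2) < 1 by apply: md_expr_lt1.
by apply: tends_ext (qpoch_cvg (x ^+ 2) p2) => n; rewrite qpoch_mulN.
Qed.

Lemma qpoch_multisection x p k n :
  qpoch x p (k * n) = \prod_(i < k) qpoch (x * p ^+ i) (p ^+ k) n.
Proof.
elim: n => [|n IH].
  by rewrite muln0 qpoch0 big1 // => i _; rewrite qpoch0.
rewrite mulnS addnC qpochD IH.
under [in RHS]eq_bigr => i _ do rewrite qpochS.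
rewrite big_split /=; congr (_ * _); apply: eq_bigr => i _.
by rewrite -exprM -!mulrA -!exprD addnC.
Qed.

Lemma qpoch_oo_multisection x p k : md p < 1 -> (0 < k)%N ->
  qpoch_oo x p = \prod_(i < k) qpoch_oo (x * p ^+ i) (p ^+ k).
Proof.
move=> p1 k0.
have pk : md (p ^+ k) < 1 by apply: md_expr_lt1.
have hk n : (n <= k * n)%N by rewrite leq_pmull.
apply: tends_unique (tends_sub hk (qpoch_cvg x p1)) _.
rewrite /index_enum; apply: tends_ext (tends_prod _ (fun i => qpoch_cvg (x * p ^+ (i : 'I_k)) pk)) => n.
by rewrite qpoch_multisection.
Qed.

End QPoch.

(** * Bailey's lemma *)

(* 1 / (p; p)_k, with the usual convention that it vanishes for k < 0. *)
Definition ip (R : realType) (p : R[i]) (k : int) : R[i] :=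
  if k is Posz n then (qpoch p p n)^-1 else 0.

Section Bailey.
Context {R : realType} (p : R[i]).
Hypotheses (p0 : p != 0) (p1 : md p < 1).

Lemma qpp_neq0 n : qpoch p p n != 0.
Proof. by apply: qpoch_neq0 => k _; apply: qpp_neq1. Qed.

Lemma one_sub_expr_neq0 n : 1 - p ^+ n.+1 != 0.
Proof. by rewrite subr_eq0 eq_sym md_lt1_neq1 // md_expr_lt1. Qed.

Lemma one_sub_pexpr_neq0 n : 1 - p * p ^+ n != 0.
Proof. by rewrite -exprS one_sub_expr_neq0. Qed.

(** At k = 0 the factor 1 - p^0 vanishes, which matches the value 0 at negative arguments. No
    boundary cases are therefore needed in the telescoping arguments. *)
Lemma ip_rec k : (1 - p ^ k) * ip p k = ip p (k - 1).
Proof.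
case: k => [[|n]|n]; [by rewrite subrr mul0r| |by rewrite /= mulr0].
rewrite (_ : Posz n.+1 - 1 = Posz n); last by lia.
rewrite /= qpochS -exprS invfM mulrCA -exprnP divff ?mulr1 //.
exact: one_sub_expr_neq0.
Qed.

Lemma ip_bounded : exists B : R, 0 < B /\ forall k, md (ip p k) <= B.
Proof.
have [B [B0 hB]] := qpochV_bounded p1 (qpp_neq1 p1).
by exists B; split=> // -[n|n] //=; rewrite md0 ltW.
Qed.

Lemma ip_cvg c : tends (fun n : nat => ip p (n%:Z + c)) (qpoch_oo p p)^-1.
Proof.
move=> e /(qpochV_cvg p1 (qpp_neq1 p1))[N hN].
exists (N + `|c|)%N => n hn.
have -> : n%:Z + c = Posz (absz (n%:Z + c)%R) by lia.
by apply: hN; lia.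
Qed.

Lemma binS2 n : 'C(n.+1, 2) = ('C(n, 2) + n)%N.
Proof. by rewrite binS bin1 addnC. Qed.

(* The normalisation b^k (b^-1; p)_k (up to sign) makes sense at b = 0 as well. *)
Definition wprod (b : R[i]) k := \prod_(i < k) (p ^+ i - b).

Lemma wprodSl b k : wprod b k.+1 = (1 - b) * (p ^+ k * wprod (b / p) k).
Proof.
rewrite /wprod big_ord_recl expr0; congr (_ * _).
elim: k => [|k IH]; first by rewrite !big_ord0 mulr1.
rewrite !big_ord_recr /= IH /bump /= !exprS; field.
by [].
Qed.

Lemma wprodD b r k :
  wprod b (r + k) = wprod b r * (p ^+ (r * k) * wprod (b / p ^+ r) k).
Proof.
elim: k => [|k IH]; first by rewrite addn0 muln0 /wprod big_ord0 !mulr1.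
rewrite addnS /wprod !big_ord_recr /= -/(wprod b (r + k)) IH mulnS !exprD /wprod.
by field; rewrite expf_neq0.
Qed.

(** Induction on N. Writing 1 - p^(N+1) as (1 - p^(N+1-k)) + p^(N+1-k) (1 - p^k) cancels one factor
    of (p;p)_(N+1-k) or of (p;p)_k. The first part is the sum for N with the same parameters; the
    second, after k is shifted by one, is the sum with (c p, b / p), which keeps the product b c. *)
Lemma q_chu_vandermonde N c b : (forall k, c * p ^+ k != 1) ->
  \sum_(k < N.+1) p ^+ 'C(k, 2) * c ^+ k * wprod b k
     / (qpoch p p k * qpoch p p (N - k) * qpoch c p k)
  = qpoch (b * c) p N / (qpoch p p N * qpoch c p N).
Proof.
elim: N c b => [|N IH] c b hc.
  by rewrite big_ord_recl big_ord0 /wprod big_ord0 !qpoch0 expr0 !mul1r addr0.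
have c1 : 1 - c != 0 by rewrite subr_eq0 eq_sym -[c]mulr1 (hc 0%N).
have qc n : qpoch c p n != 0 by apply: qpoch_neq0 => k _.
have hcp k : c * p * p ^+ k != 1 by rewrite -mulrA -exprS.
have qcp n : qpoch (c * p) p n != 0 by apply: qpoch_neq0 => k _.
apply: (mulfI (one_sub_expr_neq0 N)); rewrite mulr_sumr.
pose t k := p ^+ 'C(k, 2) * c ^+ k * wprod b k
     / (qpoch p p k * qpoch p p (N.+1 - k) * qpoch c p k).
have -> : \sum_(k < N.+2) (1 - p ^+ N.+1) * t k =
   \sum_(k < N.+2) (1 - p ^+ (N.+1 - k)) * t k
   + \sum_(k < N.+2) p ^+ (N.+1 - k) * (1 - p ^+ k) * t k.
  rewrite -big_split /=; apply: eq_bigr => k _.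
  have kN : (k <= N.+1)%N by rewrite -ltnS.
  by rewrite -[in X in (1 - p ^+ X) * _](subnK kN) exprD; ring.
rewrite big_ord_recr /= subnn expr0 subrr mul0r addr0.
rewrite [X in _ + X]big_ord_recl expr0 subrr mulr0 mul0r add0r.
have -> : \sum_(k < N.+1) (1 - p ^+ (N.+1 - k)) * t k =
  qpoch (b * c) p N / (qpoch p p N * qpoch c p N).
  rewrite -(IH c b hc); apply: eq_bigr => k _.
  have kN : (k <= N)%N by rewrite -ltnS.
  rewrite /t subSn // qpochS -exprS; field.
  by rewrite !qpp_neq0 qc one_sub_expr_neq0.
have -> : \sum_(k < N.+1) p ^+ (N.+1 - lift ord0 k) * (1 - p ^+ lift ord0 k) * t (lift ord0 k) =
  p ^+ N * c * (1 - b) / (1 - c) *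
  (qpoch (b / p * (c * p)) p N / (qpoch p p N * qpoch (c * p) p N)).
  rewrite -(IH (c * p) (b / p) hcp) mulr_sumr; apply: eq_bigr => k _.
  have kN : (k <= N)%N by rewrite -ltnS.
  rewrite /= /bump /= add1n subSS /t subSS binS2 qpochS -!exprS qpochSl wprodSl.
  rewrite -[in p ^+ N](subnK kN) !exprD exprMn !exprS. field.
  by rewrite !qpp_neq0 qcp c1 ?one_sub_expr_neq0 ?one_sub_pexpr_neq0.
have -> : b / p * (c * p) = b * c by field.
rewrite [qpoch (b * c) p N.+1]qpochS [qpoch p p N.+1]qpochS -exprS.
have e1 : qpoch c p N.+1 = (1 - c) * qpoch (c * p) p N by rewrite qpochSl.
have e2 : qpoch c p N.+1 = qpoch c p N * (1 - c * p ^+ N) by rewrite qpochS.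
have -> : qpoch c p N = (1 - c) * qpoch (c * p) p N / (1 - c * p ^+ N).
  by rewrite -e1 e2 mulfK // subr_eq0 eq_sym hc.
rewrite e1; field.
by rewrite !qpp_neq0 qcp c1 ?one_sub_expr_neq0 ?one_sub_pexpr_neq0 subr_eq0 eq_sym hc.
Qed.

(** The sequence delta_n of the Bailey lemma relative to a = p, with b = 1/rho_1 and rho_2 sent to
    infinity. *)
Definition bdelta (b : R[i]) n := p ^+ ('C(n, 2) + 2 * n) * wprod b n.

Lemma binD2 r k : 'C(r + k, 2) = ('C(r, 2) + 'C(k, 2) + r * k)%N.
Proof.
elim: k => [|k IH]; first by rewrite addn0 muln0 !addn0.
by rewrite addnS !binS2 IH mulnS; lia.
Qed.

Lemma ip_neg m n : (m < n)%N -> ip p (m%:Z - n%:Z) = 0.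
Proof.
move=> mn; have -> : m%:Z - n%:Z = Negz (n - m).-1 by lia.
by [].
Qed.

(** Terms with n < r vanish; with n = r + k the sum is [q_chu_vandermonde] at c = p^(2r+2) and b /
    p^r. *)
Lemma bailey_conjugate N r b : (r <= N)%N ->
  \sum_(n < N.+1) bdelta b n * ip p (N%:Z - n%:Z) * ip p (n%:Z - r%:Z)
      * ip p (n%:Z + r%:Z + 1)
  = bdelta b r * qpoch (b * p ^+ (r + 2)) p (N - r) * ip p (N%:Z - r%:Z)
      * ip p (N%:Z + r%:Z + 1).
Proof.
move=> /subnK; move: (N - r)%N => M <-{N}.
have c1 k : p ^+ (2 * r + 2) * p ^+ k != 1.
  by rewrite -exprD md_lt1_neq1 // md_expr_lt1 // addn2.
have qc k : qpoch (p ^+ (2 * r + 2)) p k != 0.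
  by apply: qpoch_neq0 => j _.
rewrite (addnC M r) -addnS big_split_ord /= [X in X + _]big1 ?add0r; last first.
  by move=> i _; rewrite [ip p (_ - r%:Z)]ip_neg ?mulr0 ?mul0r.
have := q_chu_vandermonde M (b / p ^+ r) c1.
have -> : b / p ^+ r * p ^+ (2 * r + 2) = b * p ^+ (r + 2).
  by rewrite mul2n -addnn -addnA exprD; field; rewrite expf_neq0.
move=> h.
have E k : qpoch p p (r + k + r + 1) =
    qpoch p p (2 * r + 1) * qpoch (p ^+ (2 * r + 2)) p k.
  have -> : (r + k + r + 1 = 2 * r + 1 + k)%N by lia.
  by rewrite qpochD -exprS addn1 addn2.
rewrite E (_ : (r + M)%:Z - r%:Z = Posz M) /=; last by lia.
transitivity (bdelta b r / qpoch p p (2 * r + 1) *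
  \sum_(k < M.+1) p ^+ 'C(k, 2) * (p ^+ (2 * r + 2)) ^+ k * wprod (b / p ^+ r) k
      / (qpoch p p k * qpoch p p (M - k) * qpoch (p ^+ (2 * r + 2)) p k)).
  rewrite mulr_sumr; apply: eq_bigr => k _.
  have kM : (k <= M)%N by rewrite -ltnS.
  rewrite E (_ : (r + M)%:Z - (r + k)%:Z = Posz (M - k)) /=; last by lia.
  rewrite (_ : (r + k)%:Z - r%:Z = Posz k) /=; last by lia.
  rewrite /bdelta wprodD binD2 -exprM.
  have -> : ('C(r, 2) + 'C(k, 2) + r * k + 2 * (r + k) =
     ('C(r, 2) + 2 * r) + 'C(k, 2) + r * k + 2 * k)%N by lia.
  have -> : ((2 * r + 2) * k = r * k + r * k + 2 * k)%N by lia.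
  move: (qc k); set Q := qpoch (p ^+ _) p k => Q0.
  by rewrite !exprD; field; rewrite !qpp_neq0 Q0.
rewrite h; move: (qc M); set Q := qpoch (p ^+ (2 * r + 2)) p M => Q0.
by field; rewrite !qpp_neq0 Q0.
Qed.

(** A bound depending only on M, needed because the argument b p^(k+2) varies with the summation
    index. *)
Lemma qpoch_bounded_unif (x : R[i]) M n : md x <= M ->
  md (qpoch x p n) <= expR (M / (1 - md p)).
Proof.
move=> xM.
have h : md (qpoch x p n) <= expR (\sum_(i < n) md x * md p ^+ i).
  elim: n => [|n IH]; first by rewrite qpoch0 md1 big_ord0 expR0.
  rewrite qpochS mdM big_ord_recr /= expRD.
  apply: ler_pM; rewrite ?md_ge0 //.
  apply: le_trans (mdD _ _) _; rewrite mdN md1 mdM mdX; exact: expR_ge1Dx.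
apply: le_trans h _; rewrite ler_expR -mulr_sumr.
have p1' : 0 < (1 - md p)^-1 by rewrite invr_gt0 subr_gt0.
apply: le_trans (ler_wpM2r (ltW p1') xM); rewrite ler_wpM2l ?md_ge0 //.
by apply: geom_sum_le; rewrite ?md_ge0.
Qed.

(* A Bailey pair relative to a = p, with (p; p)_(n+r+1) in place of
   (p^2; p)_(n+r): beta is divided by 1 - p. *)
Definition bailey_pair (alpha beta : nat -> R[i]) := forall n,
  beta n = \sum_(k < n.+1) alpha k * ip p (n%:Z - k%:Z) * ip p (n%:Z + k%:Z + 1).

(** Inserting the definition of beta and exchanging the sums leaves [bailey_conjugate] as the inner
    sum; the missing terms k > n are zeros of [ip]. *)
Lemma bailey_finite alpha beta b N : bailey_pair alpha beta ->
  \sum_(n < N.+1) bdelta b n * beta n * ip p (N%:Z - n%:Z) =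
  \sum_(k < N.+1) alpha k * bdelta b k * (qpoch (b * p ^+ (k + 2)) p (N - k)
      * ip p (N%:Z - k%:Z) * ip p (N%:Z + k%:Z + 1)).
Proof.
move=> hb.
transitivity (\sum_(n < N.+1) \sum_(k < N.+1) alpha k * (bdelta b n * ip p (N%:Z - n%:Z) * ip p (n%:Z - k%:Z)
      * ip p (n%:Z + k%:Z + 1))).
  apply: eq_bigr => n _; rewrite hb.
  pose F k := alpha k * (bdelta b n * ip p (N%:Z - n%:Z) * ip p (n%:Z - k%:Z)
      * ip p (n%:Z + k%:Z + 1)).
  rewrite mulr_sumr mulr_suml -(big_mkord xpredT F).
  rewrite (big_cat_nat (n := n.+1)) //.
  rewrite [X in _ = _ + X]big_nat_cond [X in _ = _ + X]big1 ?addr0; last first.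
    by move=> k /andP[/andP[nk _] _]; rewrite /F [ip p (_ - k%:Z)]ip_neg // mulr0 mul0r mulr0.
  by rewrite big_mkord; apply: eq_bigr => k _; rewrite /F; ring.
rewrite exchange_big; apply: eq_bigr => k _.
rewrite -mulr_sumr bailey_conjugate; first by ring.
by rewrite -ltnS.
Qed.

Lemma tends_subn (u : nat -> R[i]) l k : tends u l -> tends (fun n => u (n - k)%N) l.
Proof.
by move=> h e /h[N hN]; exists (N + k)%N => n Nn; apply: hN; rewrite leq_subRL; lia.
Qed.

Lemma qpp_oo_neq0 : qpoch_oo p p != 0.
Proof. by apply: qpoch_oo_neq0 => //; apply: qpp_neq1. Qed.

(** Both sides of [bailey_finite] converge by [tannery_nat]. The left one acquires one factor
    1/(p;p)_oo and the right one two, of which one cancels. *)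
Lemma bailey_limit alpha beta b (C r : R) : bailey_pair alpha beta ->
  0 <= r -> r < 1 ->
  (forall n, md (bdelta b n * beta n) <= C * r ^+ n) ->
  (forall n, md (alpha n * bdelta b n) <= C * r ^+ n) ->
  csum (fun n => bdelta b n * beta n) = (qpoch_oo p p)^-1 *
    csum (fun k => alpha k * bdelta b k * qpoch_oo (b * p ^+ (k + 2)) p).
Proof.
move=> hb r0 r1 h1 h2.
have [B [B0 hB]] := ip_bounded.
pose D := expR (md b / (1 - md p)).
have D0 : 0 < D by apply: expR_gt0.
have C0 : 0 <= C by have := h1 0%N; rewrite mulr1; apply: le_trans; apply: md_ge0.
have L := @tannery_nat _ (fun N n => bdelta b n * beta n * ip p (N%:Z - n%:Z))
  (fun n => bdelta b n * beta n * (qpoch_oo p p)^-1) (C * B) r r0 r1.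
have hL1 n k : (k <= n)%N -> md (bdelta b k * beta k * ip p (n%:Z - k%:Z)) <= C * B * r ^+ k.
  by move=> _; rewrite mdM [leRHS]mulrAC; apply: ler_pM (md_ge0 _) (md_ge0 _) (h1 k) (hB _).
have hL2 k : tends (fun n => bdelta b k * beta k * ip p (n%:Z - k%:Z))
   (bdelta b k * beta k * (qpoch_oo p p)^-1) by apply: tendsZ; apply: ip_cvg.
have {hL1 hL2}L := L hL1 hL2.
have M := @tannery_nat _ (fun N k => alpha k * bdelta b k * (qpoch (b * p ^+ (k + 2)) p (N - k)
      * ip p (N%:Z - k%:Z) * ip p (N%:Z + k%:Z + 1)))
  (fun k => alpha k * bdelta b k * (qpoch_oo (b * p ^+ (k + 2)) p * (qpoch_oo p p)^-1 * (qpoch_oo p p)^-1))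
  (C * (D * B * B)) r r0 r1.
have hM1 n k : (k <= n)%N -> md (alpha k * bdelta b k * (qpoch (b * p ^+ (k + 2)) p (n - k)
      * ip p (n%:Z - k%:Z) * ip p (n%:Z + k%:Z + 1))) <= C * (D * B * B) * r ^+ k.
  move=> _; rewrite mdM [leRHS]mulrAC; apply: ler_pM (md_ge0 _) (md_ge0 _) (h2 k) _.
  rewrite mdM; apply: ler_pM (md_ge0 _) (md_ge0 _) _ (hB _).
  rewrite mdM; apply: ler_pM (md_ge0 _) (md_ge0 _) _ (hB _).
  apply: qpoch_bounded_unif; rewrite mdM mdX ler_piMr ?md_ge0 //.
  by rewrite exprn_ile1 ?md_ge0 // ltW.
have hM2 k : tends (fun n => alpha k * bdelta b k * (qpoch (b * p ^+ (k + 2)) p (n - k)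
      * ip p (n%:Z - k%:Z) * ip p (n%:Z + k%:Z + 1)))
  (alpha k * bdelta b k * (qpoch_oo (b * p ^+ (k + 2)) p * (qpoch_oo p p)^-1 * (qpoch_oo p p)^-1)).
  apply/tendsZ/tendsM; last first.
    by apply: tends_ext (ip_cvg (k%:Z + 1)) => n; rewrite addrA.
  apply: tendsM; last exact: ip_cvg.
  by apply: tends_subn; apply: qpoch_cvg.
have {hM1 hM2}M := M hM1 hM2.
have E : csum (fun n => bdelta b n * beta n * (qpoch_oo p p)^-1) = 
  csum (fun k => alpha k * bdelta b k * (qpoch_oo (b * p ^+ (k + 2)) p * (qpoch_oo p p)^-1 * (qpoch_oo p p)^-1)).
  apply: tends_unique L (tends_ext _ M) => N; by rewrite (bailey_finite b N hb).
have s1 : abs_summable (fun n => bdelta b n * beta n) by apply: abs_summable_nat h1.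
have s2 : abs_summable (fun k => alpha k * bdelta b k * qpoch_oo (b * p ^+ (k + 2)) p).
  apply: (@abs_summable_nat _ _ (C * D) r) => // n.
  rewrite mdM [leRHS]mulrAC; apply: ler_pM (md_ge0 _) (md_ge0 _) (h2 n) _.
  apply: tends_md_le (qpoch_cvg _ p1) _ => m.
  apply: qpoch_bounded_unif; rewrite mdM mdX ler_piMr ?md_ge0 //.
  by rewrite exprn_ile1 ?md_ge0 // ltW.
have P0 := qpp_oo_neq0.
apply: (mulfI (invr_neq0 P0)).
rewrite !csum_usum // -usumZ // mulrA -usumZ //.
rewrite !csum_usum in E; first last.
- by apply: eq_abs_summable (abs_summableZ (qpoch_oo p p)^-1 s1) => n; rewrite mulrC.
- apply: eq_abs_summable (abs_summableZ ((qpoch_oo p p)^-1 * (qpoch_oo p p)^-1) s2) => n.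
  by ring.
transitivity (usum (fun n => bdelta b n * beta n * (qpoch_oo p p)^-1)).
  by apply: eq_usum => n; rewrite mulrC.
by rewrite E; apply: eq_usum => n; ring.
Qed.

End Bailey.

(** * The three Bailey pairs *)

Section BaileyPairs.
Context {R : realType}.

Lemma bin2_double n : (2 * 'C(n.+1, 2) = n * n.+1)%N.
Proof. by elim: n => // n IH; rewrite binS2 mulnDr IH; lia. Qed.

Lemma symsumS n (u : int -> R[i]) :
  symsum n.+1 u = symsum n u + u (- n.+1%:Z) + u n.+1%:Z.
Proof.
rewrite /symsum doubleS big_ord_recr big_ord_recl /=.
rewrite (_ : n.*2.+2%:Z - n.+1%:Z = n.+1%:Z); last by lia.
rewrite (_ : 0%Z - n.+1%:Z = - n.+1%:Z); last by lia.
rewrite [u (- _) + _]addrC; congr (_ + _ + _); apply: eq_bigr => i _.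
by congr u; rewrite /bump /=; lia.
Qed.

Lemma symsum0 (u : int -> R[i]) : symsum 0 u = u 0.
Proof. by rewrite /symsum big_ord_recl big_ord0 addr0; congr u. Qed.

Lemma abel_sum (s h : nat -> R[i]) n :
  \sum_(r < n.+1) s r * (h r - h r.+1) =
  s 0%N * h 0%N + \sum_(r < n) (s r.+1 - s r) * h r.+1 - s n * h n.+1.
Proof.
elim: n => [|n IH]; first by rewrite big_ord_recl !big_ord0; ring.
by rewrite big_ord_recr IH /= [in RHS]big_ord_recr /=; ring.
Qed.

Section Base.
Variable p : R[i].
Hypotheses (p0 : p != 0) (p1 : md p < 1).

Lemma ip_recl N k : ip p (N%:Z - k%:Z - 1) = (1 - p ^+ N / p ^+ k) * ip p (N%:Z - k%:Z).
Proof. by rewrite -ip_rec // expfzDr // exprnN. Qed.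

Lemma ip_recr N k :
  ip p (N%:Z + k%:Z) = (1 - p ^+ N * p ^+ k * p) * ip p (N%:Z + k%:Z + 1).
Proof.
have := ip_rec p0 p1 (N%:Z + k%:Z + 1).
by rewrite addrK => <-; rewrite !expfzDr // expr1z.
Qed.

(** A closed form for the partial sums makes the induction on m possible; at m = N it contains [ip]
    at -1 and vanishes. *)
Lemma alternating_binomial_partial N m : (0 < N)%N ->
  ip p N%:Z * ip p N%:Z + \sum_(0 <= r < m) (-1) ^+ r.+1 * p ^+ 'C(r.+1, 2)
     * (1 + p ^+ r.+1) * (ip p (N%:Z - r.+1%:Z) * ip p (N%:Z + r.+1%:Z))
  = (-1) ^+ m * p ^+ 'C(m.+1, 2) * (ip p (N%:Z - m%:Z - 1) * ip p (N%:Z + m%:Z))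
     / (1 - p ^+ N).
Proof.
case: N => // n _; set N := n.+1; elim: m => [|m IH].
  rewrite big_geq // ip_recl subr0 !addr0 expr0 divr1 !mul1r; field.
  exact: one_sub_expr_neq0.
rewrite big_nat_recr // addrA IH.
have e1 : N%:Z - m.+1%:Z = N%:Z - m%:Z - 1 by lia.
have e2 : N%:Z + m.+1%:Z = N%:Z + m%:Z + 1 by lia.
rewrite [ip p (N%:Z - m.+1%:Z - 1)]ip_recl e2 [ip p (N%:Z + m%:Z)]ip_recr e1.
rewrite [in RHS]binS2 !exprD !exprS.
field.
by rewrite p0 expf_neq0 // one_sub_pexpr_neq0.
Qed.

(** After multiplication by (p;p)_2N this is the sum over all r of (-1)^r p^(r(r-1)/2) times the
    q-binomial coefficient of 2N over N + r, with r and -r paired. It is proportional to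
    (p^(-N);p)_2N = 0. *)
Lemma alternating_binomial N : (0 < N)%N ->
  ip p N%:Z * ip p N%:Z + \sum_(r < N) (-1) ^+ r.+1 * p ^+ 'C(r.+1, 2)
     * (1 + p ^+ r.+1) * (ip p (N%:Z - r.+1%:Z) * ip p (N%:Z + r.+1%:Z)) = 0.
Proof.
move=> N0; have := alternating_binomial_partial N N0; rewrite big_mkord => ->.
have -> : N%:Z - N%:Z - 1 = N%:Z - N.+1%:Z by lia.
by rewrite ip_neg // mul0r mulr0 mul0r.
Qed.

(* The defining sum obeys the recursion lam n * beta n.+1 = beta n because the
   difference telescopes when s = 1; in general s enters by Abel summation. *)
Lemma bailey_pair_rec (A s beta lam : nat -> R[i]) (h : nat -> nat -> R[i]) :
  (forall n, lam n != 0) ->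
  beta 0%N = A 0%N * s 0%N * ip p 0 * ip p 1 ->
  (forall n, lam n * beta n.+1 = beta n) ->
  (forall n k, A k * (lam n * (ip p (n.+1%:Z - k%:Z) * ip p (n.+1%:Z + k%:Z + 1))
     - ip p (n.+1%:Z - k%:Z - 1) * ip p (n.+1%:Z + k%:Z)) = h n k - h n k.+1) ->
  (forall n, h n n.+2 = 0) ->
  (forall n, s 0%N * h n 0%N + \sum_(r < n.+1) (s r.+1 - s r) * h n r.+1 = 0) ->
  bailey_pair p (fun k => A k * s k) beta.
Proof.
move=> lam0 hb0 hb hA hh hs; elim=> [|n IH].
  by rewrite big_ord_recl big_ord0 addr0 subrr add0r hb0.
apply: (mulfI (lam0 n)); rewrite hb IH mulr_sumr.
have H := abel_sum s (h n) n.+1; rewrite hs hh mulr0 subr0 in H.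
apply/eqP; rewrite -subr_eq0 -oppr_eq0 opprB; apply/eqP.
rewrite -[RHS]H.
have -> : \sum_(k < n.+1) A k * s k * ip p (n%:Z - k%:Z) * ip p (n%:Z + k%:Z + 1)
  = \sum_(k < n.+2) A k * s k * ip p (n%:Z - k%:Z) * ip p (n%:Z + k%:Z + 1).
  by rewrite [RHS]big_ord_recr /= ip_neg // mulr0 mul0r addr0.
rewrite -sumrB; apply: eq_bigr => k _; rewrite -hA.
have -> : n%:Z - k%:Z = n.+1%:Z - k%:Z - 1 by lia.
have -> : n%:Z + k%:Z + 1 = n.+1%:Z + k%:Z by lia.
by ring.
Qed.

End Base.

Variable q : R[i].
Hypotheses (q0 : q != 0) (q1 : md q < 1).

Lemma one_add_neq0 n : 1 + q ^+ n.+1 != 0.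
Proof.
by rewrite -[q ^+ _]opprK subr_eq0 eq_sym md_lt1_neq1 // mdN md_expr_lt1.
Qed.

Lemma one_add_neq01 : 1 + q != 0.
Proof. exact: (one_add_neq0 0). Qed.

Lemma qpoch_Nq_neq0 n : qpoch (- q) q n != 0.
Proof.
apply: qpoch_neq0 => k _; rewrite mulNr -exprS.
by rewrite md_lt1_neq1 // mdN md_expr_lt1.
Qed.

Lemma sqr_neq0 : q ^+ 2 != 0. Proof. by rewrite expf_neq0. Qed.
Lemma md_sqr_lt1 : md (q ^+ 2) < 1. Proof. exact: md_expr_lt1. Qed.

(** [lam] is the quotient of consecutive beta, and [h] is the telescoping certificate for A_k = (1 -
    q^(2k+1)) q^(2k^2+k). *)
Lemma bailey_pair_even : bailey_pair (q ^+ 2)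
  (fun k => (1 - q ^+ (2 * k + 1)) * q ^+ (2 * k * k + k)
     * symsum k (fun j => (-1) ^ j * q ^ (- j ^+ 2)))
  (fun n => (qpoch (- q) q (2 * n + 1))^-1).
Proof.
have p0 := sqr_neq0; have p1 := md_sqr_lt1.
apply: (bailey_pair_rec p0 p1
  (lam := fun n => (1 + q ^+ (2 * n.+1)) * (1 + q ^+ (2 * n.+1 + 1)))
  (h := fun n k => q ^+ (2 * n.+1) * (q ^+ (2 * k * k) / q ^+ k * (1 + q ^+ (2 * k)))
     * (ip (q ^+ 2) (n.+1%:Z - k%:Z) * ip (q ^+ 2) (n.+1%:Z + k%:Z)))).
- by move=> n; rewrite mulf_neq0 // ?addn1 one_add_neq0.
- rewrite symsum0 /= /qpoch !big_ord_recr !big_ord0 /= expr0 !mulr1 !mul1r.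
  rewrite divr1 opprK expr1; field.
  by rewrite one_add_neq01 one_sub_expr_neq0.
- move=> n; have -> : (2 * n.+1 + 1 = (2 * n + 1).+2)%N by lia.
  have -> : (2 * n.+1 = (2 * n + 1).+1)%N by lia.
  rewrite !qpochS !mulNr !opprK -!exprS; field.
  by rewrite qpoch_Nq_neq0 !one_add_neq0.
- move=> n k.
  have e2 : n.+1%:Z - k.+1%:Z = n.+1%:Z - k%:Z - 1 by lia.
  have e3 : n.+1%:Z + k.+1%:Z = n.+1%:Z + k%:Z + 1 by lia.
  rewrite e2 e3 (ip_recl p0 p1 n.+1 k) (ip_recr p0 p1 n.+1 k).
  move: (ip _ _) (ip _ _) => a c.
  have -> : q ^+ 2 ^+ n.+1 = (q ^+ n.+1) ^+ 2 by rewrite -!exprM mulnC.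
  have -> : q ^+ 2 ^+ k = (q ^+ k) ^+ 2 by rewrite -!exprM mulnC.
  have -> : q ^+ (2 * k.+1 * k.+1) = q ^+ (2 * k * k) * (q ^+ k) ^+ 4 * q ^+ 2.
    by rewrite -!exprM -!exprD; congr (_ ^+ _); lia.
  have E m : q ^+ (2 * m) = (q ^+ m) ^+ 2 by rewrite -exprM mulnC.
  rewrite !exprD !expr1 !E [q ^+ k.+1]exprS.
  by field; rewrite q0 expf_neq0.
- by move=> n; rewrite ip_neg // mul0r mulr0.
(* The inner sum grows by 2 (-1)^(r+1) q^(-(r+1)^2), which turns q^(2(r+1)^2-(r+1)) in [h] into
   p^C(r+1,2) with p = q^2. *)
- move=> n; have Z := alternating_binomial p0 p1 (ltn0Sn n).
  transitivity (2 * q ^+ (2 * n.+1) * 0); last by rewrite mulr0.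
  rewrite -[in RHS]Z [RHS]mulrDr; congr (_ + _).
    by rewrite symsum0 !muln0 expr0 subr0 expr0z expr0n oppr0 expr0z; field.
  rewrite mulr_sumr; apply: eq_bigr => r _.
  rewrite symsumS sqrrN.
  have -> : (-1) ^ (- r.+1%:Z) = (-1) ^+ r.+1 :> R[i].
    by rewrite -exprnN -signr_odd; case: odd; rewrite ?expr0 ?expr1 ?invr1 ?invrN1.
  have -> : (r.+1%:Z ^+ 2) = ((r.+1 * r.+1)%N)%:Z by lia.
  rewrite -exprnN -!exprnP.
  have -> : q ^+ (2 * r.+1 * r.+1) = q ^+ (r.+1 * r.+1) * (q ^+ 2 ^+ 'C(r.+1, 2) * q ^+ r.+1).
    by rewrite -exprM bin2_double -!exprD; congr (_ ^+ _); lia.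
  have -> : q ^+ (2 * r.+1) = q ^+ 2 ^+ r.+1 by rewrite exprM.
  field.
  by rewrite !expf_neq0.
Qed.
End BaileyPairs.

Section MoreBaileyPairs.
Context {R : realType}.
Lemma bin2_sqr n : (2 * 'C(n, 2) + n = n * n)%N.
Proof. by case: n => // n; rewrite bin2_double; lia. Qed.

Lemma triangular_pos n : ((n%:Z * (n%:Z + 1)) %/ 2)%Z = 'C(n.+1, 2)%:Z.
Proof. by have := bin2_double n; lia. Qed.

Lemma triangular_neg n : ((- n%:Z * (- n%:Z + 1)) %/ 2)%Z = 'C(n, 2)%:Z.
Proof. by have := bin2_sqr n; lia. Qed.

Lemma wprodE p b n : b != 0 -> wprod p b n = (- b) ^+ n * qpoch b^-1 p n :> R[i].
Proof.
move=> b0; elim: n => [|n IH]; first by rewrite /wprod big_ord0 qpoch0 mulr1.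
rewrite /wprod big_ord_recr /= -/(wprod p b n) IH qpochS exprS; field.
by [].
Qed.

Lemma wprod_zero p n : wprod p 0 n = p ^+ 'C(n, 2) :> R[i].
Proof.
elim: n => [|n IH]; first by rewrite /wprod big_ord0.
by rewrite /wprod big_ord_recr /= -/(wprod p 0 n) IH subr0 binS2 exprD.
Qed.

Lemma md_symsum_le n (u : int -> R[i]) (M : R) :
  (forall j, (`|j| <= n)%N -> md (u j) <= M) -> md (symsum n u) <= (n.*2.+1)%:R * M.
Proof.
move=> h; apply: le_trans (md_sum _ _ _) _.
apply: (@le_trans _ _ (\sum_(k < n.*2.+1) M)).
  by apply: ler_sum => k _; apply: h; have := ltn_ord k; lia.
by rewrite sumr_const card_ord mulr_natl.
Qed.

(** One spare factor r^n pays for the 2n + 1 terms of a symmetric sum. *)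
Lemma linear_geom_le (r : R) n : 0 <= r -> r < 1 ->
  (n.*2.+1)%:R * r ^+ n <= 2 / (1 - r).
Proof.
move=> r0 r1.
have h : (n.+1)%:R * r ^+ n <= (1 - r)^-1.
  apply: le_trans (geom_sum_le n.+1 r0 r1); rewrite mulr_natl -[X in _ *+ X]card_ord -sumr_const.
  apply: ler_sum => k _; apply: ler_wiXn2l => //; first exact: ltW.
  by rewrite -ltnS.
apply: (@le_trans _ _ (2 * ((n.+1)%:R * r ^+ n))); last by rewrite ler_pM2l.
rewrite mulrA -natrM ler_wpM2r ?exprn_ge0 // ler_nat; lia.
Qed.

Lemma symsumZ n c (u : int -> R[i]) : c * symsum n u = symsum n (fun j => c * u j).
Proof. by rewrite /symsum mulr_sumr. Qed.

Lemma eq_symsum n (u v : int -> R[i]) : u =1 v -> symsum n u = symsum n v.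
Proof. by move=> uv; rewrite /symsum; apply: eq_bigr. Qed.

Lemma md_sign (n : int) : md ((-1) ^ n : R[i]) = 1.
Proof. by rewrite mdXz mdN md1 exp1rz. Qed.

Lemma md_signn n : md ((-1) ^+ n : R[i]) = 1.
Proof. by rewrite mdX mdN md1 expr1n. Qed.

(** Summability is asked of the scaled family, since that is the one the Bailey lemma supplies. *)
Lemma csumZ c (u : nat -> R[i]) : c != 0 ->
  abs_summable (fun n => c * u n) -> csum (fun n => c * u n) = c * csum u.
Proof.
move=> c0 h; have hu : abs_summable u.
  by apply: eq_abs_summable (abs_summableZ c^-1 h) => n; rewrite mulrA mulVf ?mul1r.
by rewrite !csum_usum // usumZ.
Qed.

Variable q : R[i].
Hypotheses (q0 : q != 0) (q1 : md q < 1).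

(** The inner sum grows by q^(-C(r+2,2)) + q^(-C(r+1,2)). Multiplied by q^((r+1)^2) this is
    q^C(r+1,2) (1 + q^(r+1)), so [alternating_binomial] closes the recursion with base q. *)
Lemma bailey_pair_triangular : bailey_pair q
  (fun k => (-1) ^+ k * q ^+ (k * k + k)
     * symsum k (fun j => q ^ (- ((j * (j + 1)) %/ 2)%Z)))
  (fun n => (qpoch q (q ^+ 2) n.+1)^-1).
Proof.
apply: (bailey_pair_rec q0 q1
  (lam := fun n => 1 - q ^+ (2 * n.+1).+1)
  (h := fun n k => q ^+ n.+1 * ((-1) ^+ k * q ^+ (k * k))
     * (ip q (n.+1%:Z - k%:Z) * ip q (n.+1%:Z + k%:Z)))).
- by move=> n; rewrite one_sub_expr_neq0.
- rewrite symsum0 /= /qpoch !big_ord_recr !big_ord0 /= expr0 !mulr1 !mul1r.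
  by rewrite invr1 mul1r.
- move=> n; rewrite [qpoch _ _ n.+2]qpochS -exprM -exprS invfM mulrCA divff ?mulr1 //.
  exact: one_sub_expr_neq0.
- move=> n k.
  have e2 : n.+1%:Z - k.+1%:Z = n.+1%:Z - k%:Z - 1 by lia.
  have e3 : n.+1%:Z + k.+1%:Z = n.+1%:Z + k%:Z + 1 by lia.
  rewrite e2 e3 (ip_recl q0 q1 n.+1 k) (ip_recr q0 q1 n.+1 k).
  move: (ip _ _) (ip _ _) => a c.
  have E m : q ^+ (2 * m) = (q ^+ m) ^+ 2 by rewrite -exprM mulnC.
  have -> : q ^+ (k.+1 * k.+1) = q ^+ (k * k) * (q ^+ k) ^+ 2 * q.
    by rewrite -E -exprD -exprSr; congr (_ ^+ _); lia.
  rewrite [_ ^+ (2 * n.+1).+1]exprS E exprD [(-1) ^+ k.+1]exprS.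
  by field; rewrite expf_neq0.
- by move=> n; rewrite ip_neg // mul0r mulr0.
- move=> n; have Z := alternating_binomial q0 q1 (ltn0Sn n).
  transitivity (q ^+ n.+1 * 0); last by rewrite mulr0.
  rewrite -[in RHS]Z [RHS]mulrDr; congr (_ + _).
    by rewrite symsum0 subr0 muln0 !expr0 mul0r div0z oppr0 expr0z; ring.
  rewrite mulr_sumr; apply: eq_bigr => r _.
  rewrite symsumS triangular_pos triangular_neg -!exprnN [in 'C(r.+2, 2)]binS2.
  have -> : q ^+ (r.+1 * r.+1) = q ^+ 'C(r.+1, 2) * q ^+ 'C(r.+1, 2) * q ^+ r.+1.
    by rewrite -!exprD -bin2_sqr; congr (_ ^+ _); lia.
  by rewrite exprD; field; rewrite !expf_neq0.
Qed.

(** There is no inner sum: with s = 1 the recursion is plain telescoping, and the certificate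
    vanishes at k = 0 through its factor 1 - q^k. *)
Lemma bailey_pair_watson : bailey_pair q
  (fun k => (-1) ^+ k * q ^+ 'C(k.+1, 2) * ((1 - q ^+ (2 * k).+1) / (1 + q ^+ (2 * k).+1)))
  (fun n => (qpoch (- q) (q ^+ 2) n.+1)^-1).
Proof.
suff : bailey_pair q
  (fun k => ((-1) ^+ k * q ^+ 'C(k.+1, 2) * ((1 - q ^+ (2 * k).+1) / (1 + q ^+ (2 * k).+1))) * 1)
  (fun n => (qpoch (- q) (q ^+ 2) n.+1)^-1).
  by move=> h n; rewrite h; apply: eq_bigr => k _; rewrite mulr1.
apply: (bailey_pair_rec q0 q1 (s := fun=> 1)
  (lam := fun n => 1 + q ^+ (2 * n.+1).+1)
  (h := fun n k => q ^+ n.+1 * ((-1) ^+ k * q ^+ 'C(k, 2) * (1 - q ^+ k) / (1 - q ^+ n.+1))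
     * (ip q (n.+1%:Z - k%:Z) * ip q (n.+1%:Z + k%:Z)))).
- by move=> n; rewrite one_add_neq0.
- rewrite /= /qpoch !big_ord_recr !big_ord0 /= !expr0 !mulr1 !mul1r !expr1 opprK.
  have h1 : 1 - q != 0 by exact: (one_sub_expr_neq0 q1 0).
  by field; rewrite h1 one_add_neq01.
- move=> n; rewrite [qpoch _ _ n.+2]qpochS -exprM mulNr opprK -exprS invfM mulrCA divff ?mulr1 //.
  exact: one_add_neq0.
- move=> n k.
  have e2 : n.+1%:Z - k.+1%:Z = n.+1%:Z - k%:Z - 1 by lia.
  have e3 : n.+1%:Z + k.+1%:Z = n.+1%:Z + k%:Z + 1 by lia.
  rewrite e2 e3 (ip_recl q0 q1 n.+1 k) (ip_recr q0 q1 n.+1 k).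
  move: (ip _ _) (ip _ _) => a c.
  have E m : q ^+ (2 * m) = (q ^+ m) ^+ 2 by rewrite -exprM mulnC.
  have := one_sub_expr_neq0 q1 n; have := one_add_neq0 q1 (2 * k).
  rewrite binS2 exprD ![_ ^+ (2 * _).+1]exprS !E [(-1) ^+ k.+1]exprS [q ^+ k.+1]exprS.
  move: (q ^+ n.+1) => X h1 h2.
  by field; rewrite h1 h2 expf_neq0.
- by move=> n; rewrite ip_neg // mul0r mulr0.
- move=> n; rewrite big1 => [|r _]; last by rewrite subrr mul0r.
  by rewrite subrr mulr0 mul0r mulr0 mul0r mulr0 addr0.
Qed.

Lemma md_expr_le1 n : md (q ^+ n) <= 1.
Proof. by rewrite mdX exprn_ile1 ?md_ge0 // ltW. Qed.

Lemma md_expr_le m n : (m <= n)%N -> md (q ^+ n) <= md q ^+ m.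
Proof. by move=> mn; rewrite mdX ler_wiXn2l ?md_ge0 // ltW. Qed.

Lemma md_symsum_expr_le n (c : nat) (u : int -> R[i]) :
  (forall j, (`|j| <= n)%N -> exists2 m : nat, (c + n <= m)%N & md (u j) = md q ^+ m) ->
  md (symsum n u) <= 2 / (1 - md q) * md q ^+ c.
Proof.
move=> h.
apply: le_trans (md_symsum_le (M := md q ^+ (n + c)) _) _.
  move=> j /h[m hm ->]; apply: ler_wiXn2l; rewrite ?md_ge0 ?(ltW q1) //; lia.
rewrite exprD mulrA ler_wpM2r ?exprn_ge0 ?md_ge0 //.
by apply: linear_geom_le; rewrite ?md_ge0.
Qed.

End MoreBaileyPairs.

(** * The q-hypergeometric sums *)

Section Eulerian.
Context {R : realType}.

(** Bounded alpha and beta are enough, because delta alone supplies geometric decay. *)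
Lemma bailey_limit_bounded (p b : R[i]) (alpha beta : nat -> R[i]) (A B D r : R) :
  p != 0 -> md p < 1 -> bailey_pair p alpha beta -> 0 <= r -> r < 1 ->
  (forall n, md (alpha n) <= A) -> (forall n, md (beta n) <= B) ->
  (forall n, md (bdelta p b n) <= D * r ^+ n) ->
  [/\ abs_summable (fun n => bdelta p b n * beta n),
    abs_summable (fun k => alpha k * bdelta p b k * qpoch_oo (b * p ^+ (k + 2)) p) &
    csum (fun n => bdelta p b n * beta n) = (qpoch_oo p p)^-1 *
      csum (fun k => alpha k * bdelta p b k * qpoch_oo (b * p ^+ (k + 2)) p)].
Proof.
move=> p0 p1 hb r0 r1 hA hB hD.
have D0 : 0 <= D by have := hD 0%N; rewrite mulr1; apply: le_trans; apply: md_ge0.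
have A0 : 0 <= A by apply: le_trans (md_ge0 _) (hA 0%N).
have B0 : 0 <= B by apply: le_trans (md_ge0 _) (hB 0%N).
have h1 n : md (bdelta p b n * beta n) <= D * B * r ^+ n.
  by rewrite mdM [leRHS]mulrAC; apply: ler_pM; rewrite ?md_ge0.
have h2 n : md (alpha n * bdelta p b n) <= D * A * r ^+ n.
  by rewrite mdM mulrC [leRHS]mulrAC; apply: ler_pM; rewrite ?md_ge0.
pose C := D * B + D * A.
have h1' n : md (bdelta p b n * beta n) <= C * r ^+ n.
  by apply: le_trans (h1 n) _; rewrite ler_wpM2r ?exprn_ge0 // lerDl mulr_ge0.
have h2' n : md (alpha n * bdelta p b n) <= C * r ^+ n.
  by apply: le_trans (h2 n) _; rewrite ler_wpM2r ?exprn_ge0 // lerDr mulr_ge0.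
split; last exact: bailey_limit hb r0 r1 h1' h2'.
  exact: abs_summable_nat h1.
pose E := expR (md b / (1 - md p)).
apply: (@abs_summable_nat _ _ (C * E) r) => // n.
rewrite mdM [leRHS]mulrAC; apply: ler_pM (md_ge0 _) (md_ge0 _) (h2' n) _.
apply: tends_md_le (qpoch_cvg _ p1) _ => m.
apply: qpoch_bounded_unif => //; rewrite mdM mdX ler_piMr ?md_ge0 //.
by rewrite exprn_ile1 ?md_ge0 // ltW.
Qed.

Variable q : R[i].
Hypotheses (q0 : q != 0) (q1 : md q < 1).

Lemma md_exprz (e : int) : 0 <= e -> md (q ^ e) = md q ^+ `|e|%N.
Proof. by case: e => // n _; rewrite mdXz. Qed.

Lemma md_1subX n : md (1 - q ^+ n) <= 2.
Proof.
apply: le_trans (mdD _ _) _; rewrite mdN md1.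
by have := md_expr_le1 q1 n; lra.
Qed.

Definition signed_sum k := symsum k (fun j => (-1) ^ j * q ^ (- j ^+ 2)).

(** The negative powers are absorbed since 2k^2 + k - j^2 >= k for |j| <= k, and one power q^k then
    beats the number of terms. *)
Lemma alpha_even_bounded k :
  md ((1 - q ^+ (2 * k + 1)) * q ^+ (2 * k * k + k) * signed_sum k)
  <= 2 * (2 / (1 - md q)).
Proof.
rewrite -mulrA mdM; apply: ler_pM; rewrite ?md_ge0 ?md_1subX //.
rewrite symsumZ -[2 / _]mulr1 -(expr0 (md q)); apply: md_symsum_expr_le => // j hj.
exists `|(2 * k * k + k)%N%:Z - j ^+ 2|%N; first by nia.
rewrite mulrCA mdM md_sign mul1r exprnP -expfzDr // md_exprz //; nia.
Qed.

Lemma qpoch_Nq_neq1 k : - q * q ^+ k != 1.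
Proof. by rewrite mulNr -exprS md_lt1_neq1 // mdN md_expr_lt1. Qed.

Lemma bailey_even b (D r : R) : 0 <= r -> r < 1 ->
  (forall n, md (bdelta (q ^+ 2) b n) <= D * r ^+ n) ->
  [/\ abs_summable (fun n => bdelta (q ^+ 2) b n / qpoch (- q) q (2 * n + 1)),
    abs_summable (fun k => (1 - q ^+ (2 * k + 1)) * q ^+ (2 * k * k + k) * signed_sum k
      * bdelta (q ^+ 2) b k * qpoch_oo (b * q ^+ 2 ^+ (k + 2)) (q ^+ 2)) &
    csum (fun n => bdelta (q ^+ 2) b n / qpoch (- q) q (2 * n + 1)) =
    (qpoch_oo (q ^+ 2) (q ^+ 2))^-1 *
      csum (fun k => (1 - q ^+ (2 * k + 1)) * q ^+ (2 * k * k + k) * signed_sum k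
      * bdelta (q ^+ 2) b k * qpoch_oo (b * q ^+ 2 ^+ (k + 2)) (q ^+ 2))].
Proof.
move=> r0 r1 hD.
have [B [B0 hB]] := qpochV_bounded q1 qpoch_Nq_neq1.
apply: (bailey_limit_bounded (sqr_neq0 q0) (md_sqr_lt1 q1) (bailey_pair_even q0 q1) r0 r1
  alpha_even_bounded (fun n => hB _) hD).
Qed.

Lemma bdelta_inv (c : R[i]) n : c != 0 -> bdelta (q ^+ 2) c^-1 n =
  (-1) ^+ n * q ^+ (n * n + 3 * n) / c ^+ n * qpoch c (q ^+ 2) n.
Proof.
move=> c0; rewrite /bdelta wprodE ?invr_neq0 // invrK -exprM.
have -> : (2 * ('C(n, 2) + 2 * n) = n * n + 3 * n)%N by have := bin2_sqr n; lia.
by rewrite [(- c^-1) ^+ n]exprNn exprVn; ring.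
Qed.

Lemma md_monomial_le (m n : nat) (c : R[i]) (D : R) : (n <= m)%N -> md c <= D ->
  md (q ^+ m * c) <= D * md q ^+ n.
Proof.
move=> nm cD; rewrite mdM mulrC; apply: ler_pM; rewrite ?md_ge0 //.
exact: md_expr_le.
Qed.

Lemma identity_i : csum (fun n =>
       (-1) ^+ n * q ^+ (n.+1 ^ 2) * qpoch q (q ^+ 2) n
         / qpoch (- q) q (2 * n + 1))
     = q * (qpoch_oo q (q ^+ 2) / qpoch_oo (q ^+ 2) (q ^+ 2))
         * csum (fun n => symsum n (fun j =>
             (-1) ^ (n%:Z + j)
               * q ^ (3 * n%:Z ^+ 2 + 3 * n%:Z - j ^+ 2))).
Proof.
have p1 := md_sqr_lt1 q1.
have dE n : bdelta (q ^+ 2) q^-1 n = (-1) ^+ n * (q ^+ (n * n + 2 * n) * qpoch q (q ^+ 2) n).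
  rewrite bdelta_inv // (_ : n * n + 3 * n = n * n + 2 * n + n)%N; last by lia.
  by rewrite exprD; field; rewrite expf_neq0.
have [B [B0 hB]] := qpoch_bounded q p1.
have [||n|s1 s2 E] := @bailey_even q^-1 B (md q); rewrite ?md_ge0 //.
  by rewrite dE mdM md_signn mul1r; apply: md_monomial_le => //; lia.
transitivity (q * csum (fun n => bdelta (q ^+ 2) q^-1 n / qpoch (- q) q (2 * n + 1))).
  rewrite -csumZ //; last exact: abs_summableZ.
  apply: eq_csum => n; rewrite dE (_ : n.+1 ^ 2 = (n * n + 2 * n).+1)%N; last by lia.
  by rewrite exprS; ring.
have hP : qpoch_oo q (q ^+ 2) != 0.
  apply: qpoch_oo_neq0 => // k; rewrite -exprM -exprS md_lt1_neq1 //.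
  exact: md_expr_lt1.
pose g k := symsum k (fun j => (-1) ^ (k%:Z + j) * q ^ (3 * k%:Z ^+ 2 + 3 * k%:Z - j ^+ 2)).
have F k : (1 - q ^+ (2 * k + 1)) * q ^+ (2 * k * k + k) * signed_sum k
      * bdelta (q ^+ 2) q^-1 k * qpoch_oo (q^-1 * q ^+ 2 ^+ (k + 2)) (q ^+ 2) =
      qpoch_oo q (q ^+ 2) * g k.
  (* The factor 1 - q^(2k+1) of alpha is the last factor of (q;q^2)_(k+1). It completes the infinite
     product, which is why (i) has no such factor while (ii) and (iii) do. *)
  rewrite dE (qpoch_oo_shift q k.+1 p1) qpochS.
  have -> : q^-1 * q ^+ 2 ^+ (k + 2) = q * q ^+ 2 ^+ k.+1.
    rewrite -!exprM (_ : 2 * (k + 2) = (2 * k.+1).+2)%N; last by lia.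
    by rewrite !exprS; field.
  have -> : q * q ^+ 2 ^+ k = q ^+ (2 * k + 1) by rewrite -exprM addn1 exprS.
  have -> : g k = (-1) ^+ k * q ^+ (3 * k * k + 3 * k) * signed_sum k.
    rewrite /g /signed_sum symsumZ; apply: eq_symsum => j.
    rewrite expfzDr ?oppr_eq0 ?oner_neq0 // -exprnP.
    have -> : 3 * k%:Z ^+ 2 + 3 * k%:Z - j ^+ 2 = (3 * k * k + 3 * k)%N%:Z + (- j ^+ 2) by lia.
    by rewrite [q ^ (_ + _)]expfzDr // -exprnP; ring.
  have -> : (3 * k * k + 3 * k = (2 * k * k + k) + (k * k + 2 * k))%N by lia.
  by rewrite [q ^+ (2 * k * k + k + _)]exprD; ring.
rewrite E (eq_csum F) csumZ //; first by ring.
by apply: eq_abs_summable F _.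
Qed.

Lemma identity_ii_a : csum (fun n =>
          (-1) ^+ n * q ^+ (n * (n + 1)) * qpoch (q ^+ 2) (q ^+ 2) n
            / qpoch (- q) q (2 * n + 1))
        = csum (fun n => symsum n (fun j =>
            (-1) ^ (n%:Z + j) * (1 - q ^+ (2 * n + 1))
              * q ^ (3 * n%:Z ^+ 2 + 2 * n%:Z - j ^+ 2))).
Proof.
have p0 := sqr_neq0 q0; have p1 := md_sqr_lt1 q1.
have dE n : bdelta (q ^+ 2) (q ^+ 2)^-1 n = (-1) ^+ n * (q ^+ (n * n + n) * qpoch (q ^+ 2) (q ^+ 2) n).
  rewrite bdelta_inv // (_ : n * n + 3 * n = n * n + n + 2 * n)%N; last by lia.
  by rewrite exprD exprM; field; rewrite expf_neq0.
have [B [B0 hB]] := qpoch_bounded (q ^+ 2) p1.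
have [||n|s1 s2 E] := @bailey_even (q ^+ 2)^-1 B (md q); rewrite ?md_ge0 //.
  by rewrite dE mdM md_signn mul1r; apply: md_monomial_le => //; lia.
transitivity (csum (fun n => bdelta (q ^+ 2) (q ^+ 2)^-1 n / qpoch (- q) q (2 * n + 1))).
  apply: eq_csum => n; rewrite dE (_ : n * (n + 1) = n * n + n)%N; last by lia.
  by ring.
have hP : qpoch_oo (q ^+ 2) (q ^+ 2) != 0 by apply: qpp_oo_neq0.
pose g k := symsum k (fun j => (-1) ^ (k%:Z + j) * (1 - q ^+ (2 * k + 1)) * q ^ (3 * k%:Z ^+ 2 + 2 * k%:Z - j ^+ 2)).
have F k : (1 - q ^+ (2 * k + 1)) * q ^+ (2 * k * k + k) * signed_sum k
      * bdelta (q ^+ 2) (q ^+ 2)^-1 k * qpoch_oo ((q ^+ 2)^-1 * q ^+ 2 ^+ (k + 2)) (q ^+ 2) =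
      qpoch_oo (q ^+ 2) (q ^+ 2) * g k.
  (* Here delta and the tail complete (q^2;q^2)_oo, which cancels the prefactor of the Bailey
     lemma. *)
  rewrite dE (qpoch_oo_shift (q ^+ 2) k p1).
  have -> : (q ^+ 2)^-1 * q ^+ 2 ^+ (k + 2) = q ^+ 2 * q ^+ 2 ^+ k.
    by rewrite addn2 !exprS; field.
  have -> : g k = (-1) ^+ k * (1 - q ^+ (2 * k + 1)) * q ^+ (3 * k * k + 2 * k) * signed_sum k.
    rewrite /g /signed_sum symsumZ; apply: eq_symsum => j.
    rewrite expfzDr ?oppr_eq0 ?oner_neq0 // -exprnP.
    have -> : 3 * k%:Z ^+ 2 + 2 * k%:Z - j ^+ 2 = (3 * k * k + 2 * k)%N%:Z + (- j ^+ 2) by lia.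
    by rewrite [q ^ (_ + _)]expfzDr // -exprnP; ring.
  have -> : (3 * k * k + 2 * k = (2 * k * k + k) + (k * k + k))%N by lia.
  by rewrite [q ^+ (2 * k * k + k + _)]exprD; ring.
rewrite E (eq_csum F) csumZ //; last by apply: eq_abs_summable F _.
by rewrite mulKf.
Qed.

Lemma identity_iii_a : csum (fun n => q ^+ (n * (n + 1)) / qpoch (- q) (q ^+ 2) n.+1)
        = qpoch_oo (- q ^+ 2) (q ^+ 2) / qpoch_oo (q ^+ 2) (q ^+ 2)
          * csum (fun n =>
              (1 - q ^+ (2 * n + 1)) * q ^+ (3 * n ^ 2 + 2 * n)
                * symsum n (fun j => (-1) ^ j * q ^ (- j ^+ 2))).
Proof.
have p0 := sqr_neq0 q0; have p1 := md_sqr_lt1 q1.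
have c0 : - q ^+ 2 != 0 by rewrite oppr_eq0.
have dE n : bdelta (q ^+ 2) (- q ^+ 2)^-1 n = q ^+ (n * n + n) * qpoch (- q ^+ 2) (q ^+ 2) n.
  rewrite bdelta_inv // (_ : n * n + 3 * n = n * n + n + 2 * n)%N; last by lia.
  rewrite exprD exprM [(- q ^+ 2) ^+ n]exprNn; field.
  by rewrite signr_eq0 expf_neq0.
have [B [B0 hB]] := qpoch_bounded (- q ^+ 2) p1.
have [||n|s1 s2 E] := @bailey_even (- q ^+ 2)^-1 B (md q); rewrite ?md_ge0 //.
  by rewrite dE; apply: md_monomial_le => //; lia.
(* The even-exponent half of this product is the factor (-q^2;q^2)_n of delta; its cancellation
   leaves the series of (iii). *)
have split_qpoch n : qpoch (- q) q (2 * n + 1) = qpoch (- q) (q ^+ 2) n.+1 * qpoch (- q ^+ 2) (q ^+ 2) n.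
  elim: n => [|n IH]; first by rewrite !qpochS !qpoch0; ring.
  rewrite (_ : 2 * n.+1 + 1 = (2 * n + 1).+2)%N; last by lia.
  rewrite !qpochS in IH *; rewrite IH -!exprM.
  by rewrite (_ : 2 * n + 1 = (2 * n).+1)%N ?addn1 // mulnS !exprS; ring.
have qodd k : - q * q ^+ 2 ^+ k != 1 by rewrite -exprM qpoch_Nq_neq1.
have qeven k : - q ^+ 2 * q ^+ 2 ^+ k != 1.
  by rewrite mulNr -exprS md_lt1_neq1 // mdN md_expr_lt1.
transitivity (csum (fun n => bdelta (q ^+ 2) (- q ^+ 2)^-1 n / qpoch (- q) q (2 * n + 1))).
  apply: eq_csum => n; rewrite dE (_ : n * (n + 1) = n * n + n)%N; last by lia.
  rewrite split_qpoch.
  have h1 : qpoch (- q) (q ^+ 2) n.+1 != 0 by apply: qpoch_neq0 => k _.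
  have h2 : qpoch (- q ^+ 2) (q ^+ 2) n != 0 by apply: qpoch_neq0 => k _.
  by move: h1 h2; move: (qpoch _ _ _) (qpoch _ _ _) => X Y h1 h2; field; rewrite h1 h2.
have hP : qpoch_oo (- q ^+ 2) (q ^+ 2) != 0 by apply: qpoch_oo_neq0.
pose g k := (1 - q ^+ (2 * k + 1)) * q ^+ (3 * k ^ 2 + 2 * k) * symsum k (fun j => (-1) ^ j * q ^ (- j ^+ 2)).
have F k : (1 - q ^+ (2 * k + 1)) * q ^+ (2 * k * k + k) * signed_sum k
      * bdelta (q ^+ 2) (- q ^+ 2)^-1 k * qpoch_oo ((- q ^+ 2)^-1 * q ^+ 2 ^+ (k + 2)) (q ^+ 2) =
      qpoch_oo (- q ^+ 2) (q ^+ 2) * g k.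
  rewrite dE (qpoch_oo_shift (- q ^+ 2) k p1).
  have -> : (- q ^+ 2)^-1 * q ^+ 2 ^+ (k + 2) = - q ^+ 2 * q ^+ 2 ^+ k.
    by rewrite addn2 !exprS; field.
  rewrite /g (_ : 3 * k ^ 2 + 2 * k = (2 * k * k + k) + (k * k + k))%N; last by lia.
  by rewrite [q ^+ (2 * k * k + k + _)]exprD /signed_sum; ring.
rewrite E (eq_csum F) csumZ //; last by apply: eq_abs_summable F _.
by rewrite mulrA [_^-1 * _]mulrC.
Qed.

Lemma bdelta_zero n : bdelta q 0 n = q ^+ (n * n + n).
Proof.
rewrite /bdelta wprod_zero -exprD; congr (_ ^+ _).
by have := bin2_sqr n; lia.
Qed.

Lemma qpoch_oo_zero (p : R[i]) : qpoch_oo 0 p = 1.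
Proof.
apply: limn_tends; apply: tends_ext (tends_cst 1) => n.
by rewrite /qpoch big1 // => i _; rewrite mul0r subr0.
Qed.

Lemma md_bdelta_zero n : md (bdelta q 0 n) <= 1 * md q ^+ n.
Proof. by rewrite bdelta_zero -[_ ^+ _]mulr1; apply: md_monomial_le; rewrite ?md1 //; lia. Qed.

Lemma identity_iv : csum (fun n => q ^+ (n * (n + 1)) / qpoch q (q ^+ 2) n.+1)
      = (qpoch_oo q q)^-1
        * csum (fun n => symsum n (fun j =>
            (-1) ^+ n
              * q ^ (2 * n%:Z ^+ 2 + 2 * n%:Z - ((j * (j + 1)) %/ 2)%Z))).
Proof.
have p1 := md_sqr_lt1 q1.
have [B [B0 hB]] : exists B : R, 0 < B /\ forall n, md (qpoch q (q ^+ 2) n)^-1 <= B.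
  apply: qpochV_bounded => // k; rewrite -exprM -exprS md_lt1_neq1 //.
  exact: md_expr_lt1.
have hA k : md ((-1) ^+ k * q ^+ (k * k + k) * symsum k (fun j => q ^ (- ((j * (j + 1)) %/ 2)%Z))) <= 2 / (1 - md q).
  rewrite mdM mdM md_signn mul1r -mdM symsumZ -[2 / _]mulr1 -(expr0 (md q)).
  apply: md_symsum_expr_le => // j hj.
  have h : (0 <= (j * (j + 1)) %/ 2 /\ 2 * ((j * (j + 1)) %/ 2)%Z <= j * (j + 1))%Z by nia.
  exists `|(k * k + k)%N%:Z - ((j * (j + 1)) %/ 2)%Z|%N; first by nia.
  by rewrite exprnP -expfzDr // md_exprz //; nia.
have [_ _ E] := bailey_limit_bounded q0 q1 (bailey_pair_triangular q0 q1) (md_ge0 q) q1 hA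
  (fun n => hB n.+1) md_bdelta_zero.
transitivity (csum (fun n => bdelta q 0 n * (qpoch q (q ^+ 2) n.+1)^-1)).
  by apply: eq_csum => n; rewrite bdelta_zero (_ : n * (n + 1) = n * n + n)%N //; lia.
rewrite E; congr (_ * _); apply: eq_csum => k.
rewrite mul0r qpoch_oo_zero mulr1 bdelta_zero mulrAC symsumZ; apply: eq_symsum => j.
have -> : 2 * k%:Z ^+ 2 + 2 * k%:Z - ((j * (j + 1)) %/ 2)%Z
  = (k * k + k)%N%:Z + (k * k + k)%N%:Z + (- ((j * (j + 1)) %/ 2)%Z) by lia.
by rewrite 2?[q ^ (_ + _)]expfzDr // -!exprnP; ring.
Qed.

(** The base is a parameter because both q and q^3 are used. *)
Definition watson_alpha (x : R[i]) k :=
  (-1) ^+ k * x ^+ 'C(k.+1, 2) * ((1 - x ^+ (2 * k).+1) / (1 + x ^+ (2 * k).+1)).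

Lemma md_watson_alpha_le k : md (watson_alpha q k) <= 2 / (1 - md q) * md q ^+ k.
Proof.
have h0 : 0 < 1 - md q by rewrite subr_gt0.
rewrite /watson_alpha -mulrA mulrCA.
apply: md_monomial_le; first by have := bin2_double k; nia.
rewrite mdM md_signn mul1r mdM; apply: ler_pM; rewrite ?md_ge0 ?md_1subX //.
rewrite mdV lef_pV2 ?posrE //; last by rewrite md_gt0 one_add_neq0.
have := mdD (1 + q ^+ (2 * k).+1) (- q ^+ (2 * k).+1); rewrite addrK md1 mdN.
have := @md_expr_le _ _ q1 1 (2 * k).+1 isT; rewrite expr1; lra.
Qed.

Lemma qodd_neq1 k : - q * q ^+ 2 ^+ k != 1.
Proof. by rewrite -exprM qpoch_Nq_neq1. Qed.

Lemma nu_watson :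
  abs_summable (fun k => q ^+ (k * k + k) * watson_alpha q k) /\
  csum (fun n => q ^+ (n * (n + 1)) / qpoch (- q) (q ^+ 2) n.+1)
  = (qpoch_oo q q)^-1 * csum (fun k => q ^+ (k * k + k) * watson_alpha q k).
Proof.
have p1 := md_sqr_lt1 q1.
have [B [B0 hB]] := qpochV_bounded p1 qodd_neq1.
have hA k : md (watson_alpha q k) <= 2 / (1 - md q).
  apply: le_trans (md_watson_alpha_le k) _; rewrite ler_piMr ?divr_ge0 ?subr_ge0 ?(ltW q1) //.
  by rewrite exprn_ile1 ?md_ge0 // ltW.
have [_ s2 E] := bailey_limit_bounded q0 q1 (bailey_pair_watson q0 q1) (md_ge0 q) q1 hA
  (fun n => hB n.+1) md_bdelta_zero.
have F k : watson_alpha q k * bdelta q 0 k * qpoch_oo (0 * q ^+ (k + 2)) q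
   = q ^+ (k * k + k) * watson_alpha q k.
  by rewrite mul0r qpoch_oo_zero mulr1 bdelta_zero mulrC.
split; first by apply: eq_abs_summable F _.
transitivity (csum (fun n => bdelta q 0 n * (qpoch (- q) (q ^+ 2) n.+1)^-1)).
  by apply: eq_csum => n; rewrite bdelta_zero (_ : n * (n + 1) = n * n + n)%N //; lia.
by rewrite E; congr (_ * _); apply: eq_csum => k; rewrite -F.
Qed.

Lemma watson_alpha_summable : abs_summable (watson_alpha q).
Proof. exact: abs_summable_nat (md_ge0 q) q1 md_watson_alpha_le. Qed.

(** The limit n -> oo of the defining relation of the Bailey pair itself: beta_n tends to
    1/(-q;q^2)_oo and the two [ip] factors to 1/(q;q)_oo. *)
Lemma watson_alpha_sum :
  csum (watson_alpha q) = qpoch_oo q q ^+ 2 / qpoch_oo (- q) (q ^+ 2).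
Proof.
have p1 := md_sqr_lt1 q1; have P0 := qpp_oo_neq0 q1.
have [B [B0 hB]] := ip_bounded q1.
have h1 n k : (k <= n)%N -> md (watson_alpha q k * ip q (n%:Z - k%:Z) * ip q (n%:Z + k%:Z + 1))
   <= (2 / (1 - md q) * (B * B)) * md q ^+ k.
  move=> _; rewrite -mulrA mdM [leRHS]mulrAC.
  apply: ler_pM (md_ge0 _) (md_ge0 _) (md_watson_alpha_le k) _.
  by rewrite mdM; apply: ler_pM; rewrite ?md_ge0.
have h2 k : tends (fun n => watson_alpha q k * ip q (n%:Z - k%:Z) * ip q (n%:Z + k%:Z + 1))
   (watson_alpha q k * (qpoch_oo q q)^-1 * (qpoch_oo q q)^-1).
  apply: tendsM; first by apply: tendsZ; apply: ip_cvg.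
  by apply: tends_ext (ip_cvg q0 q1 (k%:Z + 1)) => n; rewrite addrA.
have L := tannery_nat (md_ge0 q) q1 h1 h2.
have M := tends_sub (f := S) (fun n => leqnSn n) (qpochV_cvg p1 qodd_neq1).
have E : (qpoch_oo (- q) (q ^+ 2))^-1 = csum (fun k => watson_alpha q k * (qpoch_oo q q)^-1 * (qpoch_oo q q)^-1).
  by apply: tends_unique M _; apply: tends_ext L => n; rewrite (bailey_pair_watson q0 q1).
rewrite E; apply: (mulfI (x := (qpoch_oo q q)^-1 ^+ 2)); first by rewrite expf_neq0 ?invr_eq0.
rewrite -[LHS]csumZ ?expf_neq0 ?invr_eq0 //; last first.
  exact: abs_summableZ watson_alpha_summable.
rewrite mulrA -exprMn mulVf // expr1n mul1r; apply: eq_csum => k.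
by rewrite expr2 mulrC mulrA.
Qed.

End Eulerian.

(** * Hecke-type double sums *)

Section Hecke.
Context {R : realType}.

Lemma usumZ_inv (I : choiceType) c (u : I -> R[i]) : c != 0 ->
  abs_summable (fun n => c * u n) -> usum (fun n => c * u n) = c * usum u.
Proof.
move=> c0 h; have hu : abs_summable u.
  by apply: eq_abs_summable (abs_summableZ c^-1 h) => n; rewrite mulrA mulVf ?mul1r.
by rewrite usumZ.
Qed.

(** Exactness of the division. Exponent identities with [bin2] are checked after doubling, where
    they become polynomial. *)
Lemma bin2z_double (r : int) : 2 * Defs.bin2 r = r * (r - 1).
Proof.
have [k [->|->]] : exists k, r = 2 * k \/ r = 2 * k + 1 by exists (r %/ 2)%Z; lia.
  by rewrite /Defs.bin2 -mulrA mulKz.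
rewrite /Defs.bin2 addrK (_ : (2 * k + 1) * (2 * k) = 2 * ((2 * k + 1) * k)); last by ring.
by rewrite mulKz.
Qed.

Lemma sgrz (r : int) : 0 <= r -> sg r = 1. Proof. by rewrite /sg => ->. Qed.
Lemma sgrz_neg (r : int) : r < 0 -> sg r = -1.
Proof. by rewrite /sg ltNge => /negbTE ->. Qed.

Lemma signz_sqr (n : int) : (-1) ^ (n + n) = 1 :> R[i].
Proof. by rewrite exprzDr ?unitrN1 // -expfzMl mulrNN mulr1 exp1rz. Qed.

Lemma signzD (m n : int) : (-1) ^ (m + n) = (-1) ^ m * (-1) ^ n :> R[i].
Proof. by rewrite expfzDr // oppr_eq0 oner_neq0. Qed.

Lemma signz_subr (m n : int) : (-1) ^ (m - n) = (-1) ^ (m + n) :> R[i].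
Proof.
have -> : m + n = m - n + (n + n) by lia.
by rewrite [RHS]signzD signz_sqr mulr1.
Qed.

Lemma exprNz (x : R[i]) (n : int) : (- x) ^ n = (-1) ^ n * x ^ n.
Proof. by rewrite -(mulN1r x) expfzMl. Qed.

(* The image of the two quadrants sg r = sg s under (r, s) |-> (r + s, r - s),
   and also under (r, s) |-> (r + s + 1, r - s), see coneE1 and coneE2. *)
Definition cone (n j : int) : bool :=
  if 0 <= n then (`|j| <= n)%R else (`|j| <= - n - 1)%R.

Lemma coneE1 (r s : int) : cone (r + s) (r - s) = (sg r == sg s).
Proof.
by rewrite /cone /sg; case: (lerP 0 r); case: (lerP 0 s); case: ifP; lia.
Qed.

Lemma coneE2 (r s : int) : cone (r + s + 1) (r - s) = (sg r == sg s).
Proof.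
by rewrite /cone /sg; case: (lerP 0 r); case: (lerP 0 s); case: ifP; lia.
Qed.

Variable q : R[i].
Hypotheses (q0 : q != 0) (q1 : md q < 1).

Definition cone_term (c : int -> int -> R[i]) (x : int * int) : R[i] :=
  if cone x.1 x.2 then c x.1 x.2 * q ^ (3 * x.1 ^+ 2 + 2 * x.1 - x.2 ^+ 2) else 0.

(** The form is indefinite, but on the cone j^2 is at most n^2 or (n+1)^2, which leaves growth in
    both variables; this gives summability. *)
Lemma cone_exponent n j : cone n j ->
  (`|n| + `|j|)%N%:Z <= 3 * n ^+ 2 + 2 * n - j ^+ 2.
Proof.
rewrite /cone; case: ifP => n0 h.
  have : j ^+ 2 <= n ^+ 2 by nia.
  nia.
have : j ^+ 2 <= (- n - 1) ^+ 2 by nia.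
nia.
Qed.

Lemma md_exprz_le (e : int) (m : nat) : m%:Z <= e -> md (q ^ e) <= md q ^+ m.
Proof. by case: e => // e me; rewrite -exprnP; apply: md_expr_le. Qed.

Lemma cone_term_summable c : (forall n j, md (c n j) <= 1) ->
  abs_summable (cone_term c).
Proof.
move=> hc; apply: (@abs_summable_int2 _ _ 1 (md q)); rewrite ?md_ge0 // => n j.
rewrite /cone_term /=; case: ifP => [/cone_exponent h|_]; last first.
  by rewrite md0 mul1r exprn_ge0 ?md_ge0.
by rewrite mdM; apply: ler_pM; rewrite ?md_ge0 // md_exprz_le.
Qed.

(** The rows n and -n-1 of the cone have the same range |j| <= n, and their exponents differ by 2n +
    1. This is the origin of the factor 1 - q^(2n+1), as the coefficients used have opposite signs
    on the two rows. *)
Lemma cone_term_csum c : (forall n j, md (c n j) <= 1) ->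
  usum (cone_term c) = csum (fun n => symsum n (fun j =>
     c n%:Z j * q ^ (3 * n%:Z ^+ 2 + 2 * n%:Z - j ^+ 2)
     + c (- n.+1%:Z) j * q ^ (3 * n%:Z ^+ 2 + 4 * n%:Z + 1 - j ^+ 2))).
Proof.
move=> hc; have hs := cone_term_summable hc.
rewrite fubini // usum_int_nat; last exact: fubini_abs_summable.
have h1 : abs_summable (fun n : nat => usum (fun j => cone_term c (n%:Z, j))).
  apply: (abs_summable_inj (f := Posz) (u := fun n : int => usum (fun j => cone_term c (n, j)))).
    by move=> x y [].
  exact: fubini_abs_summable.
have h2 : abs_summable (fun n : nat => usum (fun j => cone_term c (- n.+1%:Z, j))).
  apply: (abs_summable_inj (f := fun n : nat => - n.+1%:Z) (u := fun n : int => usum (fun j => cone_term c (n, j)))).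
    by move=> x y; lia.
  exact: fubini_abs_summable.
rewrite -usumD // -csum_usum; last exact: abs_summableD.
apply: eq_csum => n.
rewrite !(@usum_symsum _ _ n); first last.
- by move=> j hj; rewrite /cone_term /= /cone; case: ifP => //; lia.
- by move=> j hj; rewrite /cone_term /= /cone; case: ifP => //; lia.
rewrite /symsum -big_split /=; apply: eq_bigr => k _.
have hk := ltn_ord k.
have c1 : cone n%:Z (k%:Z - n%:Z) by rewrite /cone /=; lia.
have c2 : cone (- n.+1%:Z) (k%:Z - n%:Z) by rewrite /cone /=; lia.
by rewrite /cone_term /fst /snd c1 c2; congr (_ + _ * q ^ _); nia.
Qed.

Lemma hecke_exponent1 (r s : int) :
  (q ^+ 4) ^ r * (q ^+ 4) ^ s * (q ^+ 4) ^ (1 * Defs.bin2 r + 2 * r * s + 1 * Defs.bin2 s)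
  = q ^ (3 * (r + s) ^+ 2 + 2 * (r + s) - (r - s) ^+ 2).
Proof.
rewrite !(exprnP q) !exprz_exp -!expfzDr //; congr (_ ^ _).
by have := bin2z_double r; have := bin2z_double s; nia.
Qed.

Lemma hecke_exponent2 (r s : int) :
  q ^+ 5 * ((q ^+ 10) ^ r * (q ^+ 10) ^ s * (q ^+ 4) ^ (1 * Defs.bin2 r + 2 * r * s + 1 * Defs.bin2 s))
  = q ^ (3 * (r + s + 1) ^+ 2 + 2 * (r + s + 1) - (r - s) ^+ 2).
Proof.
rewrite !(exprnP q) !exprz_exp -!expfzDr //; congr (_ ^ _).
by have := bin2z_double r; have := bin2z_double s; nia.
Qed.

Lemma cone_term_lattice c : (forall n j, md (c n j) <= 1) ->
  usum (cone_term c) = usum (fun x : int * int => cone_term c (x.1 + x.2, x.1 - x.2))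
    + usum (fun x : int * int => cone_term c (x.1 + x.2 + 1, x.1 - x.2)).
Proof. by move=> hc; apply: usum_lattice; apply: cone_term_summable. Qed.

Lemma cone_term_lattice_summable c : (forall n j, md (c n j) <= 1) ->
  abs_summable (fun x : int * int => cone_term c (x.1 + x.2 + 1, x.1 - x.2)).
Proof.
move=> hc; apply: (abs_summable_inj (f := fun x : int * int => (x.1 + x.2 + 1, x.1 - x.2))).
  by move=> [a b] [c' d] [] h1 h2; congr (_, _); lia.
exact: cone_term_summable.
Qed.

Lemma md_sg (r : int) : md ((sg r)%:~R : R[i]) = 1.
Proof. by rewrite /sg; case: ifP; rewrite ?mulrN1z ?mdN md1. Qed.

(** On both parity classes the row index n has the sign of r, so [sg n] becomes the sign in f. *)
Lemma hecke_f_cone :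
  usum (cone_term (fun n j => (sg n)%:~R * (-1) ^ j))
  = hecke_f 1 2 1 (q ^+ 4) (q ^+ 4) (q ^+ 4)
    + q ^+ 5 * hecke_f 1 2 1 (q ^+ 10) (q ^+ 10) (q ^+ 4).
Proof.
have hc n j : md ((sg n)%:~R * (-1) ^ j : R[i]) <= 1 by rewrite mdM md_sg md_sign mulr1.
have E1 x : cone_term (fun n j => (sg n)%:~R * (-1) ^ j) (x.1 + x.2, x.1 - x.2) =
  (let: (r, s) := x in if sg r == sg s then
      (sg r)%:~R * (-1) ^ (r + s) * (q ^+ 4) ^ r * (q ^+ 4) ^ s
        * (q ^+ 4) ^ (1 * Defs.bin2 r + 2 * r * s + 1 * Defs.bin2 s) else 0).
  case: x => r s; rewrite /cone_term /= coneE1; case: ifP => // h.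
  rewrite -hecke_exponent1 signz_subr.
  have -> : sg (r + s) = sg r by move: h; rewrite /sg; do 3 case: ifP; lia.
  by rewrite !mulrA.
have E2 x : cone_term (fun n j => (sg n)%:~R * (-1) ^ j) (x.1 + x.2 + 1, x.1 - x.2) =
  q ^+ 5 * (let: (r, s) := x in if sg r == sg s then
      (sg r)%:~R * (-1) ^ (r + s) * (q ^+ 10) ^ r * (q ^+ 10) ^ s
        * (q ^+ 4) ^ (1 * Defs.bin2 r + 2 * r * s + 1 * Defs.bin2 s) else 0).
  case: x => r s; rewrite /cone_term /= coneE2; case: ifP => h; last by rewrite mulr0.
  rewrite -hecke_exponent2 signz_subr.
  have -> : sg (r + s + 1) = sg r by move: h; rewrite /sg; do 3 case: ifP; lia.
  by ring.
rewrite cone_term_lattice // (eq_usum E1) (eq_usum E2) usumZ_inv ?expf_neq0 //.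
by apply: eq_abs_summable E2 _; apply: cone_term_lattice_summable.
Qed.

(** The sign (-1)^(n+j) is constant on each parity class, 1 on the even and -1 on the odd one. The
    constant equals (-1)^(r+s) (-1)^r (-1)^s up to that sign, hence the negated arguments and the
    minus sign before q^5. *)
Lemma hecke_fbar_cone :
  usum (cone_term (fun n j => (-1) ^ (n + j)))
  = hecke_fbar 1 2 1 (- q ^+ 4) (- q ^+ 4) (q ^+ 4)
    - q ^+ 5 * hecke_fbar 1 2 1 (- q ^+ 10) (- q ^+ 10) (q ^+ 4).
Proof.
have hc n j : md ((-1) ^ (n + j) : R[i]) <= 1 by rewrite md_sign.
have sgn3 (r s : int) : (-1) ^ (r + s) * ((-1) ^ r * (-1) ^ s) = 1 :> R[i].
  by rewrite -signzD -signzD signz_sqr.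
have E1 x : cone_term (fun n j => (-1) ^ (n + j)) (x.1 + x.2, x.1 - x.2) =
  (let: (r, s) := x in if sg r == sg s then
      (-1) ^ (r + s) * (- q ^+ 4) ^ r * (- q ^+ 4) ^ s
        * (q ^+ 4) ^ (1 * Defs.bin2 r + 2 * r * s + 1 * Defs.bin2 s) else 0).
  case: x => r s; rewrite /cone_term /= coneE1; case: ifP => // h.
  rewrite -hecke_exponent1.
  have -> : r + s + (r - s) = r + r by lia.
  rewrite signz_sqr (exprNz (q ^+ 4) r) (exprNz (q ^+ 4) s).
  rewrite mul1r -[LHS]mul1r -[X in X * _](sgn3 r s); ring.
have E2 x : cone_term (fun n j => (-1) ^ (n + j)) (x.1 + x.2 + 1, x.1 - x.2) =
  - q ^+ 5 * (let: (r, s) := x in if sg r == sg s then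
      (-1) ^ (r + s) * (- q ^+ 10) ^ r * (- q ^+ 10) ^ s
        * (q ^+ 4) ^ (1 * Defs.bin2 r + 2 * r * s + 1 * Defs.bin2 s) else 0).
  case: x => r s; rewrite /cone_term /= coneE2; case: ifP => h; last by rewrite mulr0.
  rewrite -hecke_exponent2.
  have -> : r + s + 1 + (r - s) = r + r + 1 by lia.
  rewrite signzD signz_sqr expr1z mul1r (exprNz (q ^+ 10) r) (exprNz (q ^+ 10) s).
  rewrite -[LHS]mul1r -[X in X * _](sgn3 r s); ring.
rewrite cone_term_lattice // (eq_usum E1) (eq_usum E2) usumZ_inv ?oppr_eq0 ?expf_neq0 //.
  by rewrite mulNr.
by apply: eq_abs_summable E2 _; apply: cone_term_lattice_summable.
Qed.

Lemma identity_ii_b : csum (fun n => symsum n (fun j =>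
            (-1) ^ (n%:Z + j) * (1 - q ^+ (2 * n + 1))
              * q ^ (3 * n%:Z ^+ 2 + 2 * n%:Z - j ^+ 2)))
        = hecke_fbar 1 2 1 (- q ^+ 4) (- q ^+ 4) (q ^+ 4)
          - q ^+ 5 * hecke_fbar 1 2 1 (- q ^+ 10) (- q ^+ 10) (q ^+ 4).
Proof.
rewrite -hecke_fbar_cone cone_term_csum => [|n j]; last by rewrite md_sign.
apply: eq_csum => n; apply: eq_symsum => j.
have -> : (-1) ^ (n%:Z + j) = - (-1) ^ (- n.+1%:Z + j) :> R[i].
  have -> : n%:Z + j = (- n.+1%:Z + j) + (n%:Z + n%:Z) + 1 by lia.
  by rewrite signzD [X in X * _]signzD signz_sqr expr1z mulr1 mulrN1.
have -> : 3 * n%:Z ^+ 2 + 4 * n%:Z + 1 - j ^+ 2 = (3 * n%:Z ^+ 2 + 2 * n%:Z - j ^+ 2) + (2 * n + 1)%N%:Z by lia.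
rewrite [q ^ (_ + (2 * n + 1)%N%:Z)]expfzDr // -exprnP.
by ring.
Qed.

Lemma identity_iii_b : csum (fun n =>
              (1 - q ^+ (2 * n + 1)) * q ^+ (3 * n ^ 2 + 2 * n)
                * symsum n (fun j => (-1) ^ j * q ^ (- j ^+ 2)))
   = hecke_f 1 2 1 (q ^+ 4) (q ^+ 4) (q ^+ 4)
    + q ^+ 5 * hecke_f 1 2 1 (q ^+ 10) (q ^+ 10) (q ^+ 4).
Proof.
rewrite -hecke_f_cone cone_term_csum => [|n j]; last by rewrite mdM md_sg md_sign mulr1.
apply: eq_csum => n; rewrite symsumZ; apply: eq_symsum => j.
rewrite sgrz // sgrz_neg; last by lia.
have -> : 3 * n%:Z ^+ 2 + 4 * n%:Z + 1 - j ^+ 2 = (3 * n ^ 2 + 2 * n)%N%:Z + (- j ^+ 2) + (2 * n + 1)%N%:Z by lia.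
have -> : 3 * n%:Z ^+ 2 + 2 * n%:Z - j ^+ 2 = (3 * n ^ 2 + 2 * n)%N%:Z + (- j ^+ 2) by lia.
rewrite !expfzDr // -!exprnP mulrN1z mulr1z; ring.
Qed.

End Hecke.

(** * The form of (ii) with a square root of q *)

Section HeckeHalf.
Context {R : realType}.
Variable h : R[i].
Hypotheses (h0 : h != 0) (h1 : md h < 1).
Let q := h ^+ 2.

Definition half_term (x : int * int) : R[i] := let: (r, s) := x in
  if sg r == sg s then
      (-1) ^ (r + s) * (h ^+ 3) ^ r * (- h ^+ 3) ^ s
        * (h ^+ 2) ^ (1 * Defs.bin2 r + 2 * r * s + 1 * Defs.bin2 s)
    else 0.

Lemma half_termE r s : half_term (r, s) = if sg r == sg s then
  (-1) ^ r * h ^ (r ^+ 2 + s ^+ 2 + 4 * r * s + 2 * r + 2 * s) else 0.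
Proof.
rewrite /half_term; case: ifP => // _.
rewrite (exprNz (h ^+ 3) s) !(exprnP h) !exprz_exp.
transitivity ((-1) ^ (r + s) * (-1) ^ s * (h ^ (3 * r) * h ^ (3 * s) * h ^ (2 * (1 * Defs.bin2 r + 2 * r * s + 1 * Defs.bin2 s)))).
  by ring.
rewrite -signzD -addrA signzD signz_sqr mulr1; congr (_ * _).
rewrite -[_ * _ * _]mulrA -!(expfzDr _ _ h0); congr (_ ^ _).
by have := bin2z_double r; have := bin2z_double s; nia.
Qed.

Lemma half_term_summable : abs_summable half_term.
Proof.
apply: (@abs_summable_int2 _ _ 1 (md h)); rewrite ?md_ge0 // => r s.
rewrite half_termE; case: ifP => [|_]; last first.
  by rewrite md0 mul1r exprn_ge0 ?md_ge0.
rewrite mdM md_sign !mul1r => rs; apply: md_exprz_le => //.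
move: rs; rewrite /sg; case: (lerP 0 r); case: (lerP 0 s) => //.
  by move=> s0 r0 _; nia.
move=> s0 r0 _.
have [a ->] : exists a : nat, r = - a.+1%:Z by exists `|r|.-1; lia.
have [b ->] : exists a : nat, s = - a.+1%:Z by exists `|s|.-1; lia.
by nia.
Qed.

(** The lattice substitution is now applied on the side of the square root: its even class
    reproduces the cone sum in q = h^2, and its odd class sums to 0. *)
Lemma identity_ii_c :
  hecke_fbar 1 2 1 (- q ^+ 4) (- q ^+ 4) (q ^+ 4)
          - q ^+ 5 * hecke_fbar 1 2 1 (- q ^+ 10) (- q ^+ 10) (q ^+ 4)
        = hecke_fbar 1 2 1 (h ^+ 3) (- h ^+ 3) q.
Proof.
have q0 : q != 0 by rewrite expf_neq0.
have q1 : md q < 1 by apply: md_expr_lt1.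
rewrite -hecke_fbar_cone // -[RHS]/(usum half_term) (usum_lattice half_term_summable).
rewrite [X in _ = _ + X](_ : _ = 0) ?addr0.
  apply: eq_usum => -[n j]; rewrite half_termE /cone_term /=.
  rewrite (_ : cone n j = (sg (n + j) == sg (n - j))); last first.
    by rewrite /cone /sg; do 3 case: ifP; lia.
  case: ifP => // _; rewrite /q exprnP exprz_exp; congr (_ * _ ^ _); nia.
(* On the odd class [f] exchanges r and s. The exponent is symmetric, while the sign (-1)^r is
   reversed because r - s is odd, so the sum equals its own negative. *)
pose f (x : int * int) : int * int := (x.1, - x.2 - 1).
have fK : cancel f f by move=> [a b]; rewrite /f /=; congr (_, _); lia.
set u := fun x => _.
have hu : abs_summable u.
  apply: (abs_summable_inj (f := fun x : int * int => (x.1 + x.2 + 1, x.1 - x.2))).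
    by move=> [a b] [c d] [] e1 e2; congr (_, _); lia.
  exact: half_term_summable.
have E : usum u = - usum u.
  rewrite {1}(usum_reindex fK fK hu) -mulN1r -usumZ //; apply: eq_usum => -[n j].
  change (half_term (n + (- j - 1) + 1, n - (- j - 1)) = -1 * half_term (n + j + 1, n - j)).
  rewrite !half_termE eq_sym.
  rewrite (_ : n + (- j - 1) + 1 = n - j); last by lia.
  rewrite (_ : n - (- j - 1) = n + j + 1); last by lia.
  case: ifP => // _; last by rewrite mulr0.
  rewrite mulrA; congr (_ * _ ^ _); last by lia.
  have -> : n + j + 1 = (n - j) + (j + j) + 1 by lia.
  by rewrite (signzD (n - j + (j + j)) 1) (signzD (n - j) (j + j)) signz_sqr expr1z; ring.
have /eqP : 2 * usum u = 0 by rewrite mulr_natl mulr2n {2}E subrr.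
by rewrite mulf_eq0 pnatr_eq0 => /eqP.
Qed.

End HeckeHalf.

(** * Theta functions *)

Section Theta.
Context {R : realType}.

(** Proved by the same splitting of 1 - p^(N+1) as [q_chu_vandermonde]. *)
Lemma gauss_binomial (p x : R[i]) N : md p < 1 ->
  \sum_(k < N.+1) (-1) ^+ k * p ^+ 'C(k, 2) * x ^+ k / (qpoch p p k * qpoch p p (N - k))
  = qpoch x p N / qpoch p p N.
Proof.
move=> p1; have qp n := qpp_neq0 p1 n.
elim: N => [|N IH]; first by rewrite big_ord_recl big_ord0 !qpoch0 !expr0 !mul1r addr0.
apply: (mulfI (one_sub_expr_neq0 p1 N)); rewrite mulr_sumr.
pose t k := (-1) ^+ k * p ^+ 'C(k, 2) * x ^+ k / (qpoch p p k * qpoch p p (N.+1 - k)).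
have -> : \sum_(k < N.+2) (1 - p ^+ N.+1) * t k =
   \sum_(k < N.+2) (1 - p ^+ (N.+1 - k)) * t k
   + \sum_(k < N.+2) p ^+ (N.+1 - k) * (1 - p ^+ k) * t k.
  rewrite -big_split /=; apply: eq_bigr => k _.
  have kN : (k <= N.+1)%N by rewrite -ltnS.
  by rewrite -[in X in (1 - p ^+ X) * _](subnK kN) exprD; ring.
rewrite big_ord_recr /= subnn expr0 subrr mul0r addr0.
rewrite [X in _ + X]big_ord_recl expr0 subrr mulr0 mul0r add0r.
have -> : \sum_(k < N.+1) (1 - p ^+ (N.+1 - k)) * t k = qpoch x p N / qpoch p p N.
  rewrite -IH; apply: eq_bigr => k _.
  have kN : (k <= N)%N by rewrite -ltnS.
  rewrite /t subSn // qpochS -exprS; field.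
  by rewrite !qp one_sub_expr_neq0.
have -> : \sum_(k < N.+1) p ^+ (N.+1 - lift ord0 k) * (1 - p ^+ lift ord0 k) * t (lift ord0 k) =
  - x * p ^+ N * (qpoch x p N / qpoch p p N).
  rewrite -IH mulr_sumr; apply: eq_bigr => k _.
  have kN : (k <= N)%N by rewrite -ltnS.
  rewrite /= /bump /= add1n subSS /t subSS binS2 qpochS -!exprS.
  rewrite -[in p ^+ N](subnK kN) !exprD !exprS; field.
  by rewrite !qp one_sub_pexpr_neq0.
rewrite !qpochS -exprS; field.
by rewrite qp one_sub_expr_neq0.
Qed.

Lemma qpoch_rev (p x : R[i]) M : p != 0 -> x != 0 ->
  qpoch (x / p ^+ M) p M = (- x) ^+ M / p ^+ 'C(M.+1, 2) * qpoch (p / x) p M.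
Proof.
move=> p0 x0; elim: M => [|M IH]; first by rewrite !qpoch0 expr0 divr1 mulr1.
rewrite qpochSl (_ : x / p ^+ M.+1 * p = x / p ^+ M); last first.
  by rewrite exprS; field; rewrite p0 expf_neq0.
rewrite IH qpochS [in RHS]binS2 exprD !exprS; field.
by rewrite p0 x0 !expf_neq0.
Qed.

Definition theta_term (x p : R[i]) (n : int) := (-1) ^ n * p ^ Defs.bin2 n * x ^ n.

(* Symmetric truncation, so that the finite triple product has the binomial
   weights (p; p)_2N / ((p; p)_(N-n) (p; p)_(N+n)), dominated uniformly in N. *)
Definition theta_fin (x p : R[i]) N := qpoch x p N * qpoch (p / x) p N.

(** The q-binomial theorem of order 2N at x / p^N, with the summation index recentred by N. *)
Lemma theta_fin_sum (p x : R[i]) N : p != 0 -> md p < 1 -> x != 0 ->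
  theta_fin x p N = symsum N (fun n => theta_term x p n *
     (qpoch p p (2 * N) * ip p (N%:Z - n) * ip p (N%:Z + n))).
Proof.
move=> p0 p1 x0; have qp n := qpp_neq0 p1 n.
have := gauss_binomial (x / p ^+ N) (2 * N) p1.
have -> : qpoch (x / p ^+ N) p (2 * N) = qpoch (x / p ^+ N) p N * qpoch x p N.
  by rewrite mul2n -addnn qpochD divfK ?expf_neq0.
rewrite qpoch_rev // => H.
have -> : theta_fin x p N = (- x) ^- N * p ^+ 'C(N.+1, 2) * qpoch p p (2 * N) *
    ((- x) ^+ N / p ^+ 'C(N.+1, 2) * qpoch (p / x) p N * qpoch x p N / qpoch p p (2 * N)).
  by rewrite /theta_fin; field; rewrite qp !expf_neq0 ?oppr_eq0.
rewrite -H /symsum -mul2n mulr_sumr; apply: eq_bigr => k _.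
have kN : (k <= 2 * N)%N by rewrite -ltnS.
rewrite (_ : N%:Z - (k%:Z - N%:Z) = Posz (2 * N - k)) /=; last by lia.
rewrite (_ : N%:Z + (k%:Z - N%:Z) = Posz k) /=; last by lia.
rewrite /theta_term !expfzDr ?oppr_eq0 ?oner_neq0 // -!exprnN -!exprnP.
rewrite (_ : Defs.bin2 (k%:Z - N%:Z) = 'C(k, 2)%:Z + 'C(N.+1, 2)%:Z - (N * k)%N%:Z); last first.
  have := bin2z_double (k%:Z - N%:Z); have := bin2_sqr k; have := bin2_double N; nia.
rewrite !expfzDr // -!exprnN -!exprnP exprM [(- x) ^+ N]exprNn exprMn exprVn.
by field; rewrite !qp !expf_neq0 ?oppr_eq0 ?oner_neq0 // signr_eq0.
Qed.

(** The quadratic exponent dominates x^n in both directions: K is chosen so that |p|^K compensates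
    both |x| and 1/|x|. *)
Lemma theta_term_bound (p x : R[i]) : p != 0 -> md p < 1 -> x != 0 ->
  exists C : R, forall n, md (theta_term x p n) <= C * md p ^+ `|n|%N.
Proof.
move=> p0 p1 x0; set s := md p.
have s0 : 0 < s by rewrite md_gt0.
have s0' : s != 0 by rewrite gt_eqF.
have t0 : 0 < md x by rewrite md_gt0.
have [K hK1 hK2] : exists2 K : nat, md x * s ^+ K <= 1 & (md x)^-1 * s ^+ K <= 1.
  have [N1 h1] := tendsZ x (tends_expr p1) ltr01.
  have [N2 h2] := tendsZ x^-1 (tends_expr p1) ltr01.
  exists (maxn N1 N2).
    by have := h1 _ (leq_maxl N1 N2); rewrite mulr0 subr0 mdM mdX; apply: ltW.
  by have := h2 _ (leq_maxr N1 N2); rewrite mulr0 subr0 mdM mdX mdV; apply: ltW.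
have hx n : md x ^ n * s ^+ (K * `|n|) <= 1.
  case: n => n; rewrite ?NegzE ?abszN absz_nat -?exprnN -?exprnP exprM.
    by rewrite -exprMn exprn_ile1 // mulr_ge0 ?exprn_ge0 ?md_ge0.
  by rewrite -exprVn -exprMn exprn_ile1 // mulr_ge0 ?exprn_ge0 ?md_ge0 // invr_ge0 md_ge0.
(* The constant comes from n(n-1)/2 + (K+2)^2 >= (K+1)|n|: K|n| powers pay for x^n and the remaining
   |n| give the decay. *)
exists (s ^- ((K + 2) * (K + 2))) => n.
rewrite /theta_term -mulrA mdM md_sign mul1r mdM !mdXz.
rewrite mulrC -[leLHS]mulr1 -[X in _ * X](@divff _ (s ^+ (K * `|n|))) ?expf_neq0 //.
have -> : md x ^ n * md p ^ Defs.bin2 n * (s ^+ (K * `|n|) / s ^+ (K * `|n|)) =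
   (md x ^ n * s ^+ (K * `|n|)) * (md p ^ Defs.bin2 n / s ^+ (K * `|n|)) by ring.
apply: (@le_trans _ _ (1 * (md p ^ Defs.bin2 n / s ^+ (K * `|n|)))).
  by rewrite ler_wpM2r // divr_ge0 ?exprn_ge0 ?exprz_ge0 ?md_ge0.
rewrite mul1r ler_pdivrMr ?exprn_gt0 // -/s [leRHS]mulrAC -mulrA -exprD mulrC.
rewrite ler_pdivlMr ?exprn_gt0 //.
have e0 : 0 <= Defs.bin2 n + ((K + 2) * (K + 2))%N%:Z - (K * `|n| + `|n|)%N%:Z.
  by have := bin2z_double n; nia.
rewrite exprnP -expfzDr //.
have -> : Defs.bin2 n + ((K + 2) * (K + 2))%N%:Z = (K * `|n| + `|n|)%N%:Z +
   (absz (Defs.bin2 n + ((K + 2) * (K + 2))%N%:Z - (K * `|n| + `|n|)%N%:Z)%R)%:Z by lia.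
rewrite expfzDr // -!exprnP; apply: ler_piMr; first by rewrite exprn_ge0 // ltW.
by rewrite exprn_ile1 // ltW.
Qed.

Lemma theta_term_summable (p x : R[i]) : p != 0 -> md p < 1 -> x != 0 ->
  abs_summable (theta_term x p).
Proof.
move=> p0 p1 x0; have [C hC] := theta_term_bound p0 p1 x0.
by apply: (abs_summable_int (md_ge0 p) p1 hC).
Qed.

Lemma theta_fin_cvg (p x : R[i]) : md p < 1 ->
  tends (theta_fin x p) (qpoch_oo x p * qpoch_oo (p / x) p).
Proof. by move=> p1; apply: tendsM; apply: qpoch_cvg. Qed.

(** Limit of [theta_fin_sum]: each weight tends to 1/(p;p)_oo, and the weights are bounded uniformly
    in N and n. *)
Lemma jacobi_triple (p x : R[i]) : p != 0 -> md p < 1 -> x != 0 ->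
  theta x p = usum (theta_term x p).
Proof.
move=> p0 p1 x0; have P0 := qpp_oo_neq0 p1.
have [C hC] := theta_term_bound p0 p1 x0.
have [B [B0 hB]] := ip_bounded p1.
have [D [D0 hD]] := qpoch_bounded p p1.
have h1 n k : (`|k| <= n)%N -> md (theta_term x p k *
     (qpoch p p (2 * n) * ip p (n%:Z - k) * ip p (n%:Z + k))) <= C * (D * B * B) * md p ^+ `|k|%N.
  move=> _; rewrite mdM [leRHS]mulrAC; apply: ler_pM (md_ge0 _) (md_ge0 _) (hC k) _.
  rewrite mdM; apply: ler_pM (md_ge0 _) (md_ge0 _) _ (hB _).
  by rewrite mdM; apply: ler_pM (md_ge0 _) (md_ge0 _) (hD _) (hB _).
have h2 k : tends (fun n => theta_term x p k *
     (qpoch p p (2 * n) * ip p (n%:Z - k) * ip p (n%:Z + k)))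
   (theta_term x p k * (qpoch_oo p p * (qpoch_oo p p)^-1 * (qpoch_oo p p)^-1)).
  apply/tendsZ/tendsM; last exact: ip_cvg.
  apply: tendsM; last exact: ip_cvg.
  by apply: (tends_sub (f := fun n => (2 * n)%N)) (qpoch_cvg p p1) => n; rewrite leq_pmull.
have [_ L] := tannery_int (md_ge0 p) p1 h1 h2.
have M := theta_fin_cvg x p1.
have E : qpoch_oo x p * qpoch_oo (p / x) p = usum (fun k => theta_term x p k * (qpoch_oo p p * (qpoch_oo p p)^-1 * (qpoch_oo p p)^-1)).
  by apply: tends_unique M _; apply: tends_ext L => n; rewrite theta_fin_sum.
rewrite /theta E divff // mul1r mulrC -usumZ; first by apply: eq_usum => k; field.
by apply: eq_abs_summable (abs_summableZ (qpoch_oo p p)^-1 (theta_term_summable p0 p1 x0)) => k; rewrite mulrC.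
Qed.

Lemma usum_mul (I J : choiceType) (u : I -> R[i]) (v : J -> R[i]) :
  abs_summable u -> abs_summable v ->
  usum u * usum v = usum (fun x : I * J => u x.1 * v x.2).
Proof.
move=> hu hv; rewrite fubini; last exact: abs_summable_pair.
rewrite mulrC -usumZ //; apply: eq_usum => i /=; by rewrite usumZ // mulrC.
Qed.

Lemma theta_reflect (x p : R[i]) : p != 0 -> x != 0 -> theta (p / x) p = theta x p.
Proof.
move=> p0 x0; rewrite /theta (_ : p / (p / x) = x); last by field; rewrite p0 x0.
by rewrite [qpoch_oo (p / x) p * _]mulrC.
Qed.

(** Even and odd terms of the triple product series. *)
Lemma theta_dissect (x p : R[i]) : p != 0 -> md p < 1 -> x != 0 ->
  theta x p = theta (- (p * x ^+ 2)) (p ^+ 4) - x * theta (- (p ^+ 3 * x ^+ 2)) (p ^+ 4).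
Proof.
move=> p0 p1 x0.
have p41 : md (p ^+ 4) < 1 by apply: md_expr_lt1.
have p40 : p ^+ 4 != 0 by rewrite expf_neq0.
have y1 : - (p * x ^+ 2) != 0 by rewrite oppr_eq0 mulf_neq0 // expf_neq0.
have y2 : - (p ^+ 3 * x ^+ 2) != 0 by rewrite oppr_eq0 mulf_neq0 // expf_neq0.
rewrite !jacobi_triple // usum_int_parity; last exact: theta_term_summable.
rewrite -[- (x * _)]mulNr -usumZ; last exact: theta_term_summable.
congr (_ + _); apply: eq_usum => n; rewrite /theta_term.
  rewrite (exprNz (p * x ^+ 2)) (expfzMl p (x ^+ 2)) !(exprnP p) !(exprnP x) !exprz_exp.
  rewrite (_ : Defs.bin2 (2 * n) = 4 * Defs.bin2 n + 1 * n); last first.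
    by have := bin2z_double n; have := bin2z_double (2 * n); nia.
  rewrite (expfzDr (4 * Defs.bin2 n) (1 * n) p0) mul1r (_ : 2 * n = n + n); last by lia.
  by rewrite (signzD n n) (expfzDr n n x0); ring.
rewrite (exprNz (p ^+ 3 * x ^+ 2)) (expfzMl (p ^+ 3) (x ^+ 2)) !(exprnP p) !(exprnP x) !exprz_exp.
rewrite (_ : Defs.bin2 (2 * n + 1) = 4 * Defs.bin2 n + 3 * n); last first.
  by have := bin2z_double n; have := bin2z_double (2 * n + 1); nia.
rewrite (expfzDr (4 * Defs.bin2 n) (3 * n) p0) (_ : 2 * n = n + n); last by lia.
rewrite (signzD (n + n) 1) (signzD n n) (expfzDr (n + n) 1 x0) (expfzDr n n x0).
by rewrite !expr1z; ring.
Qed.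

Lemma theta_mul_series (a b p : R[i]) : p != 0 -> md p < 1 -> a != 0 -> b != 0 ->
  abs_summable (fun x : int * int => theta_term a p x.1 * theta_term b p x.2) /\
  theta a p * theta b p = usum (fun x : int * int => theta_term a p x.1 * theta_term b p x.2).
Proof.
move=> p0 p1 a0 b0.
have sa := theta_term_summable p0 p1 a0; have sb := theta_term_summable p0 p1 b0.
split; first exact: abs_summable_pair.
by rewrite (jacobi_triple p0 p1 a0) (jacobi_triple p0 p1 b0) (usum_mul sa sb).
Qed.

(** In the product series the exponents separate on each parity class of the index lattice, for
    instance C(s+t,2) + C(s-t,2) = 2 C(s,2) + 2 C(t,2) + t. *)
Lemma theta_mul (a b p : R[i]) : p != 0 -> md p < 1 -> a != 0 -> b != 0 ->
  theta a p * theta b p =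
    theta (- (a * b)) (p ^+ 2) * theta (- (p * a / b)) (p ^+ 2)
    - a * (theta (- (p * a * b)) (p ^+ 2) * theta (- (p ^+ 2 * a / b)) (p ^+ 2)).
Proof.
move=> p0 p1 a0 b0.
have p21 : md (p ^+ 2) < 1 by apply: md_expr_lt1.
have p20 : p ^+ 2 != 0 by rewrite expf_neq0.
have y1 : - (a * b) != 0 by rewrite oppr_eq0 mulf_neq0.
have y2 : - (p * a / b) != 0 by rewrite oppr_eq0 !mulf_neq0 ?invr_eq0.
have y3 : - (p * a * b) != 0 by rewrite oppr_eq0 !mulf_neq0.
have y4 : - (p ^+ 2 * a / b) != 0 by rewrite oppr_eq0 !mulf_neq0 ?invr_eq0 ?expf_neq0.
have [s0 ->] := theta_mul_series p0 p1 a0 b0.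
have [s1 ->] := theta_mul_series p20 p21 y1 y2.
have [s2 ->] := theta_mul_series p20 p21 y3 y4.
rewrite (usum_lattice s0) -[- (a * usum _)]mulNr -(usumZ (- a) s2).
have aD m n : a ^ (m + n) = a ^ m * a ^ n by rewrite expfzDr.
have pD m n : p ^ (m + n) = p ^ m * p ^ n by rewrite expfzDr.
have bB m n : b ^ (m - n) = b ^ m * b^-1 ^ n by rewrite expfzDr // exprz_inv.
congr (_ + _); apply: eq_usum => -[s t]; rewrite /theta_term /fst /snd.
  rewrite (exprNz (a * b)) (exprNz (p * a / b)) (expfzMl a b) (expfzMl (p * a) b^-1) (expfzMl p a).
  rewrite (exprnP p) (exprz_exp p 2 (Defs.bin2 s)) (exprz_exp p 2 (Defs.bin2 t)).
  rewrite (signz_subr s t) (signzD s t) (aD s t) (bB s t).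
  transitivity ((p ^ Defs.bin2 (s + t) * p ^ Defs.bin2 (s - t)) * ((-1) ^ s * (-1) ^ t * ((-1) ^ s * (-1) ^ t)) * (a ^ s * a ^ t * (b ^ s * b^-1 ^ t))).
    by ring.
  rewrite -pD (_ : Defs.bin2 (s + t) + Defs.bin2 (s - t) = 2 * Defs.bin2 s + 2 * Defs.bin2 t + t); last first.
    by have := bin2z_double (s + t); have := bin2z_double (s - t); have := bin2z_double s; have := bin2z_double t; nia.
  by rewrite (pD (2 * Defs.bin2 s + 2 * Defs.bin2 t) t) (pD (2 * Defs.bin2 s) (2 * Defs.bin2 t)); ring.
rewrite (exprNz (p * a * b)) (exprNz (p ^+ 2 * a / b)) (expfzMl (p * a) b) (expfzMl (p ^+ 2 * a) b^-1) (expfzMl p a) (expfzMl (p ^+ 2) a).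
rewrite (exprnP p) (exprz_exp p 2 (Defs.bin2 s)) (exprz_exp p 2 (Defs.bin2 t)) (exprz_exp p 2 t).
rewrite (signz_subr s t) (signzD (s + t) 1) (signzD s t) (aD (s + t) 1) (aD s t) (bB s t) !expr1z.
transitivity (- a * ((p ^ Defs.bin2 (s + t + 1) * p ^ Defs.bin2 (s - t)) * ((-1) ^ s * (-1) ^ t * ((-1) ^ s * (-1) ^ t)) * (a ^ s * a ^ t * (b ^ s * b^-1 ^ t)))).
  by ring.
rewrite -pD (_ : Defs.bin2 (s + t + 1) + Defs.bin2 (s - t) = 2 * Defs.bin2 s + s + 2 * Defs.bin2 t + 2 * t); last first.
  by have := bin2z_double (s + t + 1); have := bin2z_double (s - t); have := bin2z_double s; have := bin2z_double t; nia.
rewrite (pD (2 * Defs.bin2 s + s + 2 * Defs.bin2 t) (2 * t)) (pD (2 * Defs.bin2 s + s) (2 * Defs.bin2 t)) (pD (2 * Defs.bin2 s) s).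
by ring.
Qed.
End Theta.

(** * Change of z in Appell-Lerch sums *)

Section PartialFractions.

Lemma size_linear_prod (F : fieldType) (I : finType) (S : pred I) (a : I -> F) :
  (size (\prod_(i | S i) (1 - a i *: 'X) : {poly F})%R <= #|S|.+1)%N.
Proof.
pose f i : {poly F} := (1 - a i *: 'X)%R.
apply: leq_trans (size_poly_prod_leq S f) _.
have h : (\sum_(i | S i) size (f i) <= \sum_(i | S i) 2)%N.
  apply: leq_sum => i _; apply: leq_trans (size_polyD _ _) _.
  rewrite size_polyN size_polyC oner_eq0 /= geq_max /=.
  by apply: leq_trans (size_scale_leq _ _) _; rewrite size_polyX.
by rewrite sum_nat_const in h; move: h; rewrite muln2 -addnn; lia.
Qed.

(** Lagrange interpolation: P minus the proposed combination vanishes at the #|I| distinct points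
    1/a_i and has smaller degree. *)
Lemma partial_fractions (F : fieldType) (I : finType) (a : I -> F) (P : {poly F}) x :
  injective a -> (forall i, a i != 0) -> (size P <= #|I|)%N ->
  (forall i, 1 - x * a i != 0) ->
  P.[x] / \prod_i (1 - x * a i) =
  \sum_i P.[(a i)^-1] / \prod_(j | j != i) (1 - a j / a i) / (1 - x * a i).
Proof.
move=> ainj a0 sP hx.
pose D i : {poly F} := \prod_(j | j != i) (1 - a j *: 'X).
have DE i y : (D i).[y] = \prod_(j | j != i) (1 - y * a j).
  rewrite /D horner_prod; apply: eq_bigr => j _.
  by rewrite !hornerE mulrC.
have D0 i : \prod_(j | j != i) (1 - a j / a i) != 0.
  apply/prodf_neq0 => j ji; rewrite subr_eq0 eq_sym; apply: contra ji => /eqP e.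
  by apply/eqP/ainj; rewrite -[LHS](divfK (a0 i)) e mul1r.
pose c i := P.[(a i)^-1] / \prod_(j | j != i) (1 - a j / a i).
pose Q := P - \sum_i c i *: D i.
have Q0 : Q = 0.
  apply: (@roots_geq_poly_eq0 _ _ [seq (a i)^-1 | i <- enum I]).
  - apply/allP => y /mapP[i _ ->]; apply/rootP; rewrite /Q !hornerE horner_sum.
    rewrite (bigD1 i) //= big1 ?addr0 => [|k ki]; last first.
      rewrite hornerZ DE (bigD1 i) /=; last by rewrite eq_sym.
      by rewrite mulVf // subrr mul0r mulr0.
    have e : \prod_(j | j != i) (1 - (a i)^-1 * a j) = \prod_(j | j != i) (1 - a j / a i).
      by apply: eq_bigr => j _; rewrite mulrC.
    by rewrite hornerZ DE /c e divfK // subrr.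
  - by rewrite map_inj_uniq ?enum_uniq // => i j /invr_inj/ainj.
  - rewrite size_map -cardE; apply: leq_trans (size_polyD _ _) _.
    rewrite geq_max sP size_polyN; apply: leq_trans (size_sum _ _ _) _.
    apply/bigmax_leqP => i _; apply: leq_trans (size_scale_leq _ _) _.
    apply: leq_trans (size_linear_prod _ _) _.
    by have := cardC1 i; have : (0 < #|I|)%N by [apply/card_gt0P; exists i]; rewrite /= => h1 h2; rewrite (eq_card (B := predC1 i)) // h2 prednK.
have -> : P = \sum_i c i *: D i by apply/eqP; rewrite -subr_eq0 -/Q Q0.
have X0 : \prod_i (1 - x * a i) != 0 by apply/prodf_neq0 => i _.
rewrite horner_sum mulr_suml; apply: eq_bigr => i _.
have -> : \sum_k c k *: D k = P by apply/esym/eqP; rewrite -subr_eq0 -/Q Q0.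
rewrite -/(c i) hornerZ DE -mulrA; congr (_ * _).
rewrite [X in _ / X](bigD1 i) //= invfM mulrCA divff ?mulr1 //.
by apply/prodf_neq0 => j _.
Qed.

End PartialFractions.

(** * Residues of truncated theta quotients *)

Section ThetaPartialFractions.
Context {R : realType}.

Lemma theta_fin_qpoch (p u : R[i]) N : p != 0 -> u != 0 ->
  qpoch (u / p ^+ N) p (2 * N) = (- u) ^+ N / p ^+ 'C(N.+1, 2) * theta_fin u p N.
Proof.
move=> p0 u0; have -> : qpoch (u / p ^+ N) p (2 * N) = qpoch (u / p ^+ N) p N * qpoch u p N.
  by rewrite mul2n -addnn qpochD divfK ?expf_neq0.
by rewrite qpoch_rev // /theta_fin; ring.
Qed.

Lemma qpoch_back (p y : R[i]) M k : p != 0 -> y != 0 -> (k <= M)%N ->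
  qpoch (y / p ^+ k) p M = (- y) ^+ k / p ^+ 'C(k.+1, 2) * (qpoch (p / y) p k * qpoch y p (M - k)).
Proof.
move=> p0 y0 kM; rewrite -{1}(subnKC kM) qpochD divfK ?expf_neq0 // qpoch_rev //.
by rewrite !mulrA.
Qed.

Lemma prod_except (F : nat -> R[i]) k m :
  \prod_(l < k + 1 + m | (l : nat) != k) F l =
  (\prod_(l < k) F l) * \prod_(l < m) F (k + 1 + l)%N.
Proof.
elim: m => [|m IH].
  rewrite addn0 addn1 big_ord0 mulr1 big_mkcond big_ord_recr /= eqxx mulr1.
  by apply: eq_bigr => l _; rewrite ltn_eqF.
rewrite addnS big_mkcond big_ord_recr /= -big_mkcond /= IH [in RHS]big_ord_recr /= mulrA.
by congr (_ * _); rewrite ifT // neq_ltn; apply/orP; right; lia.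
Qed.

Lemma prod_other_powers (p : R[i]) M k : p != 0 -> (k < M)%N ->
  \prod_(l < M | (l : nat) != k) (1 - p ^+ l / p ^+ k) =
  (-1) ^+ k / p ^+ 'C(k.+1, 2) * (qpoch p p k * qpoch p p (M - 1 - k)).
Proof.
move=> p0 kM; have [m ->] : exists m, M = (k + 1 + m)%N by exists (M - k - 1)%N; lia.
rewrite (prod_except (fun l => 1 - p ^+ l / p ^+ k)).
have -> : \prod_(l < k) (1 - p ^+ l / p ^+ k) = qpoch (1 / p ^+ k) p k.
  by apply: eq_bigr => l _; rewrite mul1r mulrC.
have -> : \prod_(l < m) (1 - p ^+ (k + 1 + l) / p ^+ k) = qpoch p p m.
  by apply: eq_bigr => l _; rewrite !exprD expr1; congr (1 - _); field; rewrite expf_neq0.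
rewrite qpoch_rev ?oner_neq0 // divr1 (_ : k + 1 + m - 1 - k = m)%N; last by lia.
by rewrite !mulrA.
Qed.

(* The coefficient of 1 / (1 - x z p^n) in the partial fraction expansion in x of
   theta_fin (x z z') / (theta_fin (x z) theta_fin (x z')). *)
Definition residue (z z' p : R[i]) N (n : int) :=
  theta_term (z * p) p n *
  (qpoch (p / z') p (absz (N%:Z + n)) * qpoch z' p (absz (N%:Z - n))
   * ip p (N%:Z - n - 1) * ip p (N%:Z + n)
   / (qpoch (p * z / z') p (absz (N%:Z + n)) * qpoch (z' / z) p (absz (N%:Z - n)))).

Variable p : R[i].
Hypotheses (p0 : p != 0) (p1 : md p < 1).

Lemma exprz_neq1 (n : int) : n != 0 -> p ^ n != 1.
Proof.
case: n => n n0; rewrite ?NegzE -?exprnN -?exprnP; last rewrite invr_eq1.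
  by rewrite md_lt1_neq1 // md_expr_lt1 // lt0n.
by rewrite md_lt1_neq1 // md_expr_lt1.
Qed.

Lemma exprz_inj : injective (fun n : int => p ^ n).
Proof.
move=> m n /= e; apply/eqP; rewrite -subr_eq0; apply/negPn/negP => /exprz_neq1.
by rewrite expfzDr // -invr_expz e divff ?eqxx // expfz_neq0.
Qed.

(** For x z this keeps the denominators 1 - x z p^n nonzero; for z' / z it keeps the poles attached
    to z and to z' distinct. *)
Definition generic (z : R[i]) := forall n : int, z != p ^ n.

Lemma generic_qpoch z n : generic z -> qpoch z p n != 0.
Proof.
move=> gz; apply: qpoch_neq0 => k _; apply/eqP => e.
have := gz (- k%:Z); rewrite -exprnN -[_ ^- k]mul1r -e mulfK ?eqxx //.
by rewrite expf_neq0.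
Qed.

Lemma generic_neq1 z n : generic z -> 1 - z * p ^ n != 0.
Proof.
move=> gz; rewrite subr_eq0 eq_sym; apply/eqP => e.
by have := gz (- n); rewrite -invr_expz -[_^-1]mul1r -e mulfK ?eqxx // expfz_neq0.
Qed.

Lemma genericV z : generic z -> generic z^-1.
Proof. by move=> gz n; rewrite -[p ^ n]invrK (inj_eq invr_inj) invr_expz. Qed.

Lemma genericM z k : generic z -> generic (z * p ^ k).
Proof.
move=> gz n; apply/eqP => e; have := gz (n - k).
by rewrite expfzDr // -invr_expz -e mulfK ?eqxx // expfz_neq0.
Qed.

(** Identifies the coefficient produced by [partial_fractions] at the pole x = 1/c with [residue],
    the pole number k in [0, 2N) corresponding to n = k - N. *)
Lemma residueE (x z z' c : R[i]) N k : z != 0 -> z' != 0 -> (k < 2 * N)%N ->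
  generic (z' / z) -> generic (x * z) -> c = z / p ^+ N * p ^+ k ->
  (- c^-1) ^+ N / p ^+ 'C(N.+1, 2) * qpoch (z' / p ^+ k) p (2 * N) /
   (\prod_(l < 2 * N | (l : nat) != k) (1 - p ^+ l / p ^+ k) * qpoch (z' / z / p ^+ k) p (2 * N))
   / (1 - x * c)
  = residue z z' p N (k%:Z - N%:Z) / (1 - x * z * p ^ (k%:Z - N%:Z)).
Proof.
move=> z0 z'0 kN g1 g2 ->; have qp n := qpp_neq0 p1 n.
have r0 : z' / z != 0 by rewrite mulf_neq0 ?invr_eq0.
rewrite prod_other_powers // !qpoch_back //; try exact: ltnW.
rewrite expfzDr // -exprnN -exprnP.
have -> : x * (z / p ^+ N * p ^+ k) = x * z * (p ^+ k / p ^+ N) by ring.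
congr (_ / _); rewrite /residue.
rewrite (_ : N%:Z + (k%:Z - N%:Z) = k%:Z); last by lia.
rewrite (_ : N%:Z - (k%:Z - N%:Z) = (2 * N - k)%N%:Z); last by lia.
rewrite (_ : (2 * N - k)%N%:Z - 1 = (2 * N - 1 - k)%N%:Z); last by lia.
rewrite !absz_nat /ip /theta_term.
rewrite (_ : Defs.bin2 (k%:Z - N%:Z) = 'C(k.+1, 2)%:Z + 'C(N.+1, 2)%:Z - (N * k)%N%:Z - k%:Z); last first.
  by have := bin2z_double (k%:Z - N%:Z); have := bin2_double k; have := bin2_double N; nia.
have -> : p / (z' / z) = p * z / z' by field; rewrite z0 z'0.
have n1 : qpoch (p * z / z') p k != 0.
  apply: generic_qpoch; have := genericM 1 (genericV g1); rewrite expr1z invf_div.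
  by rewrite (_ : z / z' * p = p * z / z') //; field.
have n2 : qpoch (z' / z) p (2 * N - k) != 0 by apply: generic_qpoch.
rewrite signz_subr signzD -!exprnP (expfzDr _ _ (_ : z * p != 0)) ?mulf_neq0 //.
rewrite !(expfzDr _ _ p0) -!exprnN -!exprnP.
have e : p ^+ N ^+ N = p ^+ 'C(N.+1, 2) * p ^+ 'C(N.+1, 2) / p ^+ N.
  rewrite -exprM -exprD; have -> : ('C(N.+1, 2) + 'C(N.+1, 2) = N * N + N)%N.
    by have := bin2_double N; nia.
  by rewrite exprD; field; rewrite expf_neq0.
have -> : (- (z / p ^+ N * p ^+ k)^-1) ^+ N = (-1) ^+ N / z ^+ N * p ^+ N ^+ N / p ^+ (N * k).
  rewrite (exprNn (z / p ^+ N * p ^+ k)^-1) exprVn !exprMn exprVn mulnC exprM.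
  move: (expf_neq0 N z0) (expf_neq0 N (expf_neq0 N p0)) (expf_neq0 N (expf_neq0 k p0)).
  by move: (z ^+ N) (_ ^+ N ^+ N) (_ ^+ k ^+ N) ((-1) ^+ N) => A B C D h1 h2 h3; field; rewrite h1 h2 h3.
rewrite e (exprNn z' k) (exprNn (z' / z) k) !exprMn exprVn.
move: n1 n2; move: (qpoch (p * z / z') p k) (qpoch (z' / z) p (2 * N - k)) => A B n1 n2.
have hs : (-1) ^+ k = ((-1) ^+ k)^-1 :> R[i].
  by rewrite -signr_odd; case: odd; rewrite ?expr0 ?expr1 ?invr1 ?invrN1.
rewrite [in RHS]hs; field.
by rewrite !qp n1 n2 !expf_neq0 ?oppr_eq0 ?oner_neq0.
Qed.

End ThetaPartialFractions.

Section ChangeOfZ.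
Context {R : realType}.
Variable p : R[i].
Hypotheses (p0 : p != 0) (p1 : md p < 1).

Lemma big_bool_pair (T : Type) (idx : T) (op : Monoid.com_law idx) (I : finType)
    (F : bool * I -> T) :
  \big[op/idx]_j F j = op (\big[op/idx]_l F (true, l)) (\big[op/idx]_l F (false, l)).
Proof.
transitivity (\big[op/idx]_b \big[op/idx]_l F (b, l)); last by rewrite big_bool.
by rewrite pair_bigA; apply: eq_bigr => -[].
Qed.

Lemma prod_bool_except (I : finType) (F : bool * I -> R[i]) e k :
  \prod_(j | j != (e, k)) F j = (\prod_(l | l != k) F (e, l)) * \prod_l F (~~ e, l).
Proof.
rewrite big_mkcond big_bool_pair /= [in RHS]big_mkcond /=.
case: e; [|rewrite mulrC]; by congr (_ * _); apply: eq_bigr => l _; rewrite xpair_eqE.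
Qed.

(** In x this is a rational function with 4N simple poles, 2N for each of z0 and z1; the boolean in
    the index selects the family. *)
Lemma theta_fin_partial_fractions (x z0 z1 : R[i]) N : x != 0 -> z0 != 0 -> z1 != 0 ->
  generic p (z1 / z0) -> generic p (x * z0) -> generic p (x * z1) -> (0 < N)%N ->
  theta_fin (x * z0 * z1) p N / (theta_fin (x * z0) p N * theta_fin (x * z1) p N) =
  symsum N (fun n => residue z0 z1 p N n / (1 - x * z0 * p ^ n)) +
  symsum N (fun n => residue z1 z0 p N n / (1 - x * z1 * p ^ n)).
Proof.
move=> x0 z00 z10 g gx0 gx1 N0.
pose w (e : bool) := if e then z1 else z0.
have w0 e : w e != 0 by case: e.
have gw e : generic p (x * w e) by case: e.
have gr e : generic p (w (~~ e) / w e).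
  by case: e => //=; have := genericV g; rewrite invf_div.
pose a (i : bool * 'I_(2 * N)) := w i.1 / p ^+ N * p ^+ i.2.
have pN : p ^+ N != 0 by rewrite expf_neq0.
have a0 i : a i != 0 by rewrite /a !mulf_neq0 ?invr_eq0 ?expf_neq0.
have ainj : injective a.
  move=> [e k] [f l]; rewrite /a /= => H.
  have {}H : w e * p ^+ k = w f * p ^+ l.
    have K u m : u * p ^+ m = (u / p ^+ N * p ^+ m) * p ^+ N by field.
    by rewrite (K (w e)) H -K.
  have [ef|nef] := eqVneq e f.
    rewrite ef in H *; have {}H := mulfI (w0 f) H.
    congr (_, _); apply/val_inj => /=.
    by have := @exprz_inj _ p p0 p1 k%:Z l%:Z; rewrite /= -!exprnP => /(_ H) [].
  exfalso; have fe : f = ~~ e by move: nef; clear; case: e; case: f.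
  rewrite fe in H; have := gr e (k%:Z - l%:Z).
  rewrite expfzDr // -exprnN -exprnP; case/eqP.
  have -> : w (~~ e) = w e * p ^+ k / p ^+ l by rewrite H mulfK ?expf_neq0.
  by field; rewrite w0 expf_neq0.
(* Each truncated theta is a shifted [qpoch] up to a monomial. The denominator has two such
   monomials and the numerator one; [c] and ['X^N] make up for the difference. *)
pose c : R[i] := (-1) ^+ N / p ^+ 'C(N.+1, 2).
pose P : {poly R[i]} := c *: ('X^N * \prod_(l < 2 * N) (1 - (z0 * z1 / p ^+ N * p ^+ l) *: 'X)).
have PE y : P.[y] = (- y) ^+ N / p ^+ 'C(N.+1, 2) * qpoch (y * z0 * z1 / p ^+ N) p (2 * N).
  rewrite /P hornerZ hornerM hornerXn horner_prod /c (exprNn y).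
  have -> : \prod_(l < 2 * N) (1 - (z0 * z1 / p ^+ N * p ^+ l) *: 'X).[y] = qpoch (y * z0 * z1 / p ^+ N) p (2 * N).
    by apply: eq_bigr => l _; rewrite !hornerE; ring.
  by ring.
(* The numerator has degree at most N + 2N, below the number 4N of poles because N > 0. *)
have sP : (size P <= #|{: bool * 'I_(2 * N)}|)%N.
  rewrite card_prod card_bool card_ord.
  apply: leq_trans (size_scale_leq _ _) _; apply: leq_trans (size_polyMleq _ _) _.
  rewrite size_polyXn.
  have := size_linear_prod xpredT (fun l : 'I_(2 * N) => z0 * z1 / p ^+ N * p ^+ l).
  rewrite card_ord; set s := size _; lia.
have hx i : 1 - x * a i != 0.
  rewrite /a (_ : x * _ = x * w i.1 * p ^ ((i.2 : nat)%:Z - N%:Z)) ?generic_neq1 //.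
  by rewrite expfzDr // -exprnN -exprnP; ring.
have H := partial_fractions ainj a0 sP hx.
have E1 : \prod_i (1 - x * a i) = qpoch (x * z0 / p ^+ N) p (2 * N) * qpoch (x * z1 / p ^+ N) p (2 * N).
  rewrite big_bool_pair /= mulrC.
  by congr (_ * _); apply: eq_bigr => k _; rewrite /a /=; ring.
rewrite PE E1 !theta_fin_qpoch // ?mulf_neq0 // in H.
have L : (- x) ^+ N / p ^+ 'C(N.+1, 2) * ((- (x * z0 * z1)) ^+ N / p ^+ 'C(N.+1, 2) * theta_fin (x * z0 * z1) p N) /
   ((- (x * z0)) ^+ N / p ^+ 'C(N.+1, 2) * theta_fin (x * z0) p N *
    ((- (x * z1)) ^+ N / p ^+ 'C(N.+1, 2) * theta_fin (x * z1) p N)) =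
   theta_fin (x * z0 * z1) p N / (theta_fin (x * z0) p N * theta_fin (x * z1) p N).
  have -> : (- (x * z0 * z1)) ^+ N = (- (x * z0)) ^+ N * (- (x * z1)) ^+ N / (- x) ^+ N.
    by rewrite -exprMn -exprVn -exprMn; congr (_ ^+ _); field; rewrite ?oppr_eq0.
  have t0 (y : R[i]) : y != 0 -> generic p y -> theta_fin y p N != 0.
    move=> y0 gy; rewrite mulf_neq0 ?generic_qpoch //.
    by have := genericM p0 1 (genericV gy); rewrite expr1z mulrC.
  have T0 := t0 _ (mulf_neq0 x0 z00) gx0; have T1 := t0 _ (mulf_neq0 x0 z10) gx1.
  have q0 : (- x) ^+ N != 0 by rewrite expf_neq0 ?oppr_eq0.
  have q1 : (- (x * z0)) ^+ N != 0 by rewrite expf_neq0 ?oppr_eq0 ?mulf_neq0.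
  have q2 : (- (x * z1)) ^+ N != 0 by rewrite expf_neq0 ?oppr_eq0 ?mulf_neq0.
  have q3 : p ^+ 'C(N.+1, 2) != 0 by rewrite expf_neq0.
  move: T0 T1 q0 q1 q2 q3; move: (theta_fin (x * z0 * z1) p N) (theta_fin (x * z0) p N) (theta_fin (x * z1) p N).
  move: ((- x) ^+ N) ((- (x * z0)) ^+ N) ((- (x * z1)) ^+ N) (p ^+ _) => A B D E F G J h1 h2 h3 h4 h5 h6.
  by field; rewrite h1 h2 h3 h4 h5 h6.
have E2 e (k : 'I_(2 * N)) : P.[(a (e, k))^-1] / \prod_(j | j != (e, k)) (1 - a j / a (e, k)) / (1 - x * a (e, k)) =
   residue (w e) (w (~~ e)) p N ((k : nat)%:Z - N%:Z) / (1 - x * w e * p ^ ((k : nat)%:Z - N%:Z)).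
  rewrite -(residueE p0 p1 (w0 e) (w0 (~~ e)) (ltn_ord k) (gr e) (gw e) (erefl (a (e, k)))).
  have pk := expf_neq0 k p0.
  have zz : z0 * z1 = w e * w (~~ e) by rewrite /w; case: (e) => //=; rewrite mulrC.
  rewrite PE prod_bool_except /a; congr (_ * _ / (_ * _) / _).
  - congr qpoch; rewrite -(mulrA _ z0 z1) zz /=; field; by rewrite w0 pN pk.
  - by apply: eq_bigr => l _ /=; congr (1 - _); field; rewrite w0 pN pk.
  - by apply: eq_bigr => l _ /=; congr (1 - _); field; rewrite w0 pN pk.
(* A symmetric sum has 2N + 1 terms against 2N poles; the residue at n = N is 0 because it contains
   [ip] at -1. *)
have S (f : int -> R[i]) : f N%:Z = 0 -> symsum N f = \sum_(k < 2 * N) f ((k : nat)%:Z - N%:Z).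
  move=> f0; rewrite /symsum -mul2n big_ord_recr /= [X in _ + f X](_ : _ = N%:Z) ?f0 ?addr0 //.
  by lia.
have rN u v : residue u v p N N%:Z = 0.
  rewrite /residue (_ : N%:Z - N%:Z - 1 = - 1%:Z) /=; last by lia.
  by rewrite mulr0 !mul0r mulr0.
rewrite -L H big_bool_pair addrC !S ?rN ?mul0r //.
by congr (_ + _); apply: eq_bigr => k _; rewrite E2.
Qed.

End ChangeOfZ.

(** * The limit N -> oo and the change of z *)

Section ChangeOfZLimit.
Context {R : realType}.
Variable p : R[i].
Hypotheses (p0 : p != 0) (p1 : md p < 1).

(** For n -> +oo the denominator tends to 1; for n -> -oo one factors out y p^n, and the inverse
    even tends to 0. *)
Lemma inv_pole_bounded y : y != 0 -> generic p y ->
  exists B : R, forall n : int, md (1 - y * p ^ n)^-1 <= B.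
Proof.
move=> y0 gy.
have H u : exists B : R, 0 < B /\ forall n : nat, md (1 - u * p ^+ n)^-1 <= B.
  apply: (@tends_bounded _ _ 1^-1); apply: tendsV (oner_neq0 _).
  have := tendsD (tends_cst 1) (tendsZ (- u) (tends_expr p1)).
  by rewrite mulr0 addr0; apply: tends_ext => n; rewrite mulNr.
have [B1 [B10 h1]] := H y; have [B2 [B20 h2]] := H y^-1.
have my : 0 < md y^-1 by rewrite md_gt0 invr_eq0.
exists (B1 + md y^-1 * B2) => -[n|n].
  by apply: le_trans (h1 n) _; rewrite lerDl mulr_ge0 // ltW.
rewrite NegzE -exprnN.
have pn : p ^+ n.+1 != 0 by rewrite expf_neq0.
have g1 : 1 - y^-1 * p ^+ n.+1 != 0 by apply: (generic_neq1 p0 n.+1%:Z (genericV gy)).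
have g2 : y - p ^+ n.+1 != 0.
  by apply: contra g1; rewrite subr_eq0 => /eqP <-; rewrite mulVf // subrr.
have -> : (1 - y / p ^+ n.+1)^-1 = - (y^-1 * p ^+ n.+1 * (1 - y^-1 * p ^+ n.+1)^-1).
  by field; rewrite y0 pn g2 -opprB oppr_eq0 g2.
rewrite mdN mdM mdM -mulrA.
apply: (@le_trans _ _ (md y^-1 * (1 * B2))); last by rewrite mul1r lerDr ltW.
rewrite ler_pM2l //; apply: ler_pM; rewrite ?md_ge0 //.
exact: md_expr_le1.
Qed.

Lemma tends_qpoch_absz u c :
  tends (fun N => qpoch u p (absz (N%:Z + c))) (qpoch_oo u p).
Proof.
move=> e /(qpoch_cvg u p1)[N hN]; exists (N + `|c|)%N => n hn.
by apply: hN; lia.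
Qed.

Lemma generic_expr_neq1 u : generic p u -> forall k, u * p ^+ k != 1.
Proof.
by move=> gu k; have := generic_neq1 p0 k%:Z gu; rewrite subr_eq0 eq_sym.
Qed.

(** The limit of the second factor of [residue], which no longer depends on n. *)
Definition residue_oo (z z' : R[i]) :=
  qpoch_oo (p / z') p * qpoch_oo z' p * (qpoch_oo p p)^-1 * (qpoch_oo p p)^-1
   / (qpoch_oo (p * z / z') p * qpoch_oo (z' / z) p).

(** The sum in an Appell function with its index shifted by one, see [appell_sumE]; this is the form
    in which the partial fractions produce it. *)
Definition pole_sum x z := usum (fun n => theta_term (z * p) p n / (1 - x * z * p ^ n)).

Lemma residue_sum_cvg x z z' : x != 0 -> z != 0 -> z' != 0 ->
  generic p (z' / z) -> generic p (x * z) ->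
  abs_summable (fun n => theta_term (z * p) p n / (1 - x * z * p ^ n)) /\
  tends (fun N => symsum N (fun n => residue z z' p N n / (1 - x * z * p ^ n)))
    (residue_oo z z' * pole_sum x z).
Proof.
move=> x0 z0 z'0 g gx.
have zp0 : z * p != 0 by rewrite mulf_neq0.
have [C hC] := theta_term_bound p0 p1 zp0.
have [D hD] := inv_pole_bounded (mulf_neq0 x0 z0) gx.
have hCD n : md (theta_term (z * p) p n / (1 - x * z * p ^ n)) <= C * D * md p ^+ `|n|%N.
  by rewrite mdM [leRHS]mulrAC; apply: ler_pM; rewrite ?md_ge0.
have hs := abs_summable_int (md_ge0 p) p1 hCD.
split=> //.
have g' : generic p (p * z / z').
  have := genericM p0 1 (genericV g); rewrite expr1z invf_div.
  by rewrite (_ : z / z' * p = p * z / z') //; field.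
have [B1 [B10 h1]] := qpoch_bounded (p / z') p1.
have [B2 [B20 h2]] := qpoch_bounded z' p1.
have [B3 [B30 h3]] := ip_bounded p1.
have [B4 [B40 h4]] := qpochV_bounded p1 (generic_expr_neq1 g').
have [B5 [B50 h5]] := qpochV_bounded p1 (generic_expr_neq1 g).
have E N n : residue z z' p N n / (1 - x * z * p ^ n) =
   theta_term (z * p) p n / (1 - x * z * p ^ n) *
   (qpoch (p / z') p (absz (N%:Z + n)) * qpoch z' p (absz (N%:Z - n))
   * ip p (N%:Z - n - 1) * ip p (N%:Z + n)
   * ((qpoch (p * z / z') p (absz (N%:Z + n)))^-1 * (qpoch (z' / z) p (absz (N%:Z - n)))^-1)).
  by rewrite /residue invfM mulrAC.
have hb n k : (`|k| <= n)%N -> md (residue z z' p n k / (1 - x * z * p ^ k)) <=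
   C * D * (B1 * B2 * B3 * B3 * (B4 * B5)) * md p ^+ `|k|%N.
  move=> _; rewrite E mdM [leRHS]mulrAC; apply: ler_pM (md_ge0 _) (md_ge0 _) (hCD k) _.
  rewrite mdM; apply: ler_pM (md_ge0 _) (md_ge0 _) _ _; last first.
    by rewrite mdM; apply: ler_pM; rewrite ?md_ge0.
  rewrite mdM; apply: ler_pM (md_ge0 _) (md_ge0 _) _ (h3 _).
  rewrite mdM; apply: ler_pM (md_ge0 _) (md_ge0 _) _ (h3 _).
  by rewrite mdM; apply: ler_pM; rewrite ?md_ge0.
have ht k : tends (fun n => residue z z' p n k / (1 - x * z * p ^ k))
   (theta_term (z * p) p k / (1 - x * z * p ^ k) * residue_oo z z').
  apply: (@tends_ext _ _ _ _ (fun N => esym (E N k))); apply: tendsZ.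
  rewrite /residue_oo invfM; apply: tendsM; last first.
    apply: tendsM; apply: tendsV (tends_qpoch_absz _ _) _; apply: qpoch_oo_neq0 => //; exact: generic_expr_neq1.
  apply: tendsM; last exact: ip_cvg.
  apply: tendsM; last first.
    by apply: tends_ext (ip_cvg p0 p1 (- k - 1)) => n; rewrite addrA.
  by apply: tendsM; apply: tends_qpoch_absz.
have [_ L] := tannery_int (md_ge0 p) p1 hb ht.
rewrite /pole_sum -usumZ //.
by congr tends: L; apply: eq_usum => n; rewrite mulrC.
Qed.

Lemma theta_partial_fractions x z0 z1 : x != 0 -> z0 != 0 -> z1 != 0 ->
  generic p (z1 / z0) -> generic p (x * z0) -> generic p (x * z1) ->
  qpoch_oo (x * z0 * z1) p * qpoch_oo (p / (x * z0 * z1)) p /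
   (qpoch_oo (x * z0) p * qpoch_oo (p / (x * z0)) p *
    (qpoch_oo (x * z1) p * qpoch_oo (p / (x * z1)) p)) =
  residue_oo z0 z1 * pole_sum x z0 + residue_oo z1 z0 * pole_sum x z1.
Proof.
move=> x0 z00 z10 g g0 g1.
have g' : generic p (z0 / z1) by have := genericV g; rewrite invf_div.
have [_ L0] := residue_sum_cvg x0 z00 z10 g g0.
have [_ L1] := residue_sum_cvg x0 z10 z00 g' g1.
have gp y : generic p y -> generic p (p / y).
  by move=> gy; have := genericM p0 1 (genericV gy); rewrite expr1z mulrC.
have ne y : generic p y -> qpoch_oo y p * qpoch_oo (p / y) p != 0.
  by move=> gy; rewrite mulf_neq0 // qpoch_oo_neq0 // => k; apply: generic_expr_neq1 => //; apply: gp.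
have M := tendsM (theta_fin_cvg (x * z0 * z1) p1) (tendsV (tendsM (theta_fin_cvg (x * z0) p1) (theta_fin_cvg (x * z1) p1)) (mulf_neq0 (ne _ g0) (ne _ g1))).
apply: tends_unique M _.
apply: (@tends_eventually _ _ _ _ 1%N) (tendsD L0 L1) => N N0.
by rewrite theta_fin_partial_fractions.
Qed.

Lemma theta_inv y : y != 0 -> theta y^-1 p = - y^-1 * theta y p.
Proof.
move=> y0; rewrite /theta invrK (qpoch_oo_recl y^-1 p1) (qpoch_oo_recl y p1).
by rewrite [y^-1 * p]mulrC [p * y]mulrC; field.
Qed.

Definition appell_sum (x z : R[i]) := usum (fun r : int =>
    (-1) ^ r * p ^ Defs.bin2 r * z ^ r / (1 - p ^ (r - 1) * x * z)).

Lemma appell_sumE x z : z != 0 ->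
  abs_summable (fun n => theta_term (z * p) p n / (1 - x * z * p ^ n)) ->
  appell_sum x z = - z * pole_sum x z.
Proof.
move=> z0 hs; rewrite /pole_sum -usumZ // /appell_sum.
have hs' := abs_summableZ (- z) hs.
rewrite [RHS](usum_reindex (f := fun r : int => r - 1) (g := fun r : int => r + 1) (@addrNK _ 1) (@addrK _ 1) hs').
apply: eq_usum => r /=; rewrite /theta_term expfzMl (expfzDr r (-1) z0).
rewrite (_ : (-1) ^ r = - (-1) ^ (r - 1)); last by rewrite (signzD r (-1)) exprN1 invrN1 mulrN1 opprK.
rewrite (_ : Defs.bin2 r = Defs.bin2 (r - 1) + (r - 1)); last first.
  by have := bin2z_double r; have := bin2z_double (r - 1); nia.
rewrite (expfzDr (Defs.bin2 (r - 1)) _ p0) (_ : 1 - p ^ (r - 1) * x * z = 1 - x * z * p ^ (r - 1)); last by ring.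
have e : z ^ (-1) = z^-1 by [].
by rewrite e; move: (_^-1) => A; field.
Qed.

Lemma theta_neq0 y : generic p y -> theta y p != 0.
Proof.
move=> gy; have gpy := genericM p0 1 (genericV gy); rewrite expr1z mulrC in gpy.
exact: mulf_neq0 (mulf_neq0 (qpoch_oo_neq0 p1 (generic_expr_neq1 gy))
  (qpoch_oo_neq0 p1 (generic_expr_neq1 gpy))) (qpp_oo_neq0 p1).
Qed.

(** By the triple-product form of [residue_oo], the partial fraction expansion relates the two pole
    sums with coefficients j(z1) and j(z0) over a multiple of j(z1/z0); clearing that denominator
    gives the classical formula. *)
Lemma appell_change_z x z0 z1 : x != 0 -> z0 != 0 -> z1 != 0 ->
  generic p (z1 / z0) -> generic p (x * z0) -> generic p (x * z1) ->
  theta z0 p * appell_sum x z1 - theta z1 p * appell_sum x z0 =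
  z0 * qpoch_oo p p ^+ 3 * theta (z1 / z0) p * theta (x * z0 * z1) p /
    (theta (x * z0) p * theta (x * z1) p).
Proof.
move=> x0 z00 z10 g g0 g1.
have g' : generic p (z0 / z1) by have := genericV g; rewrite invf_div.
have [s0 _] := residue_sum_cvg x0 z00 z10 g g0.
have [s1 _] := residue_sum_cvg x0 z10 z00 g' g1.
have J0 := qpp_oo_neq0 p1.
have H := theta_partial_fractions x0 z00 z10 g g0 g1.
have r u v : generic p (v / u) -> u != 0 -> v != 0 ->
    residue_oo u v = theta v p / (qpoch_oo p p ^+ 2 * theta (v / u) p).
  move=> guv u0 v0; have := theta_neq0 guv; rewrite /theta /residue_oo.
  have -> : p / (v / u) = p * u / v by field; rewrite u0 v0.
  rewrite !mulf_eq0 !negb_or => /andP[/andP[h1 h2] h3].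
  by field; rewrite h1 h2 h3.
rewrite !r // in H.
have ti : theta (z0 / z1) p = - (z0 / z1) * theta (z1 / z0) p.
  by rewrite -[z0 / z1]invf_div theta_inv ?invf_div // mulf_neq0 ?invr_eq0.
have T := theta_neq0 g.
rewrite !appell_sumE //.
have L : theta (x * z0 * z1) p / (theta (x * z0) p * theta (x * z1) p) * qpoch_oo p p =
  qpoch_oo (x * z0 * z1) p * qpoch_oo (p / (x * z0 * z1)) p /
   (qpoch_oo (x * z0) p * qpoch_oo (p / (x * z0)) p *
    (qpoch_oo (x * z1) p * qpoch_oo (p / (x * z1)) p)).
  have := theta_neq0 g0; have := theta_neq0 g1; rewrite /theta.
  rewrite !mulf_eq0 !negb_or => /andP[/andP[h1 h2] h3] /andP[/andP[h4 h5] _].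
  by field; rewrite h1 h2 h3 h4 h5.
rewrite ti -L in H.
have -> : z0 * qpoch_oo p p ^+ 3 * theta (z1 / z0) p * theta (x * z0 * z1) p /
    (theta (x * z0) p * theta (x * z1) p) = z0 * qpoch_oo p p ^+ 2 * theta (z1 / z0) p *
    (theta (x * z0 * z1) p / (theta (x * z0) p * theta (x * z1) p) * qpoch_oo p p) by ring.
rewrite H; move: T J0; move: (theta _ _) (theta _ _) (theta _ _) (qpoch_oo p p) (pole_sum _ _) (pole_sum _ _) => a b c d e f T J0.
by field; rewrite T J0 z00 z10.
Qed.

End ChangeOfZLimit.

(* The hypotheses are the dissections of J_1 J_3 and of J_3^3 / J_1, the latter
   at q and at q^2. Multiplied by J_2 J_12^2 / J_6, the last one becomes
   J_6^2 J_12^2 = J_1 J_3 J_8 J_24 + q J_2 J_3^3 J_4 J_24^3 / (J_1 J_6 J_8 J_12). *)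
Lemma nu_theta_algebra (F : fieldType) (q j1 j2 j3 j4 j6 j8 j12 j24 : F) :
  q != 0 -> j1 != 0 -> j2 != 0 -> j3 != 0 -> j4 != 0 -> j6 != 0 -> j8 != 0 ->
  j12 != 0 -> j24 != 0 ->
  j1 * j3 = j2 * j8 ^+ 2 * j12 ^+ 4 / (j4 ^+ 2 * j6 * j24 ^+ 2)
            - q * j4 ^+ 4 * j6 * j24 ^+ 2 / (j2 * j8 ^+ 2 * j12 ^+ 2) ->
  j3 ^+ 3 / j1 = j4 ^+ 3 * j6 ^+ 2 / (j2 ^+ 2 * j12) + q * j12 ^+ 3 / j4 ->
  j6 ^+ 3 / j2 = j8 ^+ 3 * j12 ^+ 2 / (j4 ^+ 2 * j24) + q ^+ 2 * j24 ^+ 3 / j8 ->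
  j3 ^+ 3 * j12 / (j1 * j6 ^+ 2) - q^-1 * (j12 ^+ 4 * j6 * j8 / (j2 * j4 * j24 ^+ 3))
  = - q^-1 * (j1 * j3 * j8 ^+ 2 * j12 ^+ 2 / (j2 * j4 * j6 * j24 ^+ 2)).
Proof.
move=> q0 n1 n2 n3 n4 n6 n8 n12 n24 E1 E2 E3.
have T : j6 ^+ 2 * j12 ^+ 2 =
    j1 * j3 * (j8 * j24) + q * (j2 * j4 * j24 ^+ 3 / (j6 * j8 * j12)) * (j3 ^+ 3 / j1).
  have -> : j6 ^+ 2 * j12 ^+ 2 = j2 * j12 ^+ 2 / j6 * (j6 ^+ 3 / j2) by field; rewrite n2 n6.
  by rewrite E1 E2 E3; field; rewrite n2 n4 n6 n8 n12 n24.
have -> : j3 ^+ 3 * j12 / (j1 * j6 ^+ 2) = q^-1 * (j8 * j12 ^+ 2 / (j2 * j4 * j24 ^+ 3 * j6)) *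
   (q * (j2 * j4 * j24 ^+ 3 / (j6 * j8 * j12)) * (j3 ^+ 3 / j1)).
  by field; rewrite q0 n1 n2 n4 n6 n8 n12 n24.
have -> : q * (j2 * j4 * j24 ^+ 3 / (j6 * j8 * j12)) * (j3 ^+ 3 / j1) = j6 ^+ 2 * j12 ^+ 2 - j1 * j3 * (j8 * j24).
  by rewrite T; ring.
by field; rewrite q0 n2 n4 n6 n24.
Qed.

(** * Eta quotients *)

Section ThetaEvaluations.
Context {R : realType}.

Section EtaQuotients.
Variable u : R[i].
Hypotheses (u0 : u != 0) (u1 : md u < 1).

Lemma eta_neq0 k : (0 < k)%N -> Jk u k != 0.
Proof. by move=> k0; apply: qpp_oo_neq0; apply: md_expr_lt1. Qed.

Lemma qpoch_oo_sect2 x : qpoch_oo x u = qpoch_oo x (u ^+ 2) * qpoch_oo (x * u) (u ^+ 2).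
Proof. by rewrite (@qpoch_oo_multisection _ x u 2) // !big_ord_recr big_ord0 /= mul1r mulr1. Qed.

Lemma qpoch_oo_sect3 x : qpoch_oo x u =
  qpoch_oo x (u ^+ 3) * qpoch_oo (x * u) (u ^+ 3) * qpoch_oo (x * u ^+ 2) (u ^+ 3).
Proof. by rewrite (@qpoch_oo_multisection _ x u 3) // !big_ord_recr big_ord0 /= mul1r mulr1. Qed.

Lemma eta_odd : qpoch_oo u (u ^+ 2) = Jk u 1 / Jk u 2.
Proof.
by rewrite /Jk expr1 (qpoch_oo_sect2 u) -expr2 mulfK // (eta_neq0 (k := 2)).
Qed.

Lemma eta_neg : qpoch_oo (- u) u = Jk u 2 / Jk u 1.
Proof.
by rewrite /Jk expr1 -qpoch_oo_mulN // mulrC mulKf // -(expr1 u) (eta_neq0 (k := 1)).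
Qed.

End EtaQuotients.

(** Turns the eight eta factors into nonzero atoms, so that [field] sees a rational identity
    only. *)
Ltac eta_field q q1 :=
  move: (eta_neq0 q1 (ltn0Sn 0)) (eta_neq0 q1 (ltn0Sn 1)) (eta_neq0 q1 (ltn0Sn 2))
    (eta_neq0 q1 (ltn0Sn 3)) (eta_neq0 q1 (ltn0Sn 5)) (eta_neq0 q1 (ltn0Sn 7))
    (eta_neq0 q1 (ltn0Sn 11)) (eta_neq0 q1 (ltn0Sn 23));
  move: (Jk q 1) (Jk q 2) (Jk q 3) (Jk q 4) (Jk q 6) (Jk q 8) (Jk q 12) (Jk q 24);
  let h1 := fresh in let h2 := fresh in let h3 := fresh in let h4 := fresh in
  let h5 := fresh in let h6 := fresh in let h7 := fresh in let h8 := fresh in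
  move=> ? ? ? ? ? ? ? ? h1 h2 h3 h4 h5 h6 h7 h8;
  field; rewrite ?h1 ?h2 ?h3 ?h4 ?h5 ?h6 ?h7 ?h8.

Lemma JkM (u : R[i]) m n : Jk (u ^+ m) n = Jk u (m * n).
Proof. by rewrite /Jk -exprM. Qed.

(** From (u;u^2)_oo (-u;u^2)_oo = (u^2;u^4)_oo. *)
Lemma eta_neg_odd (u : R[i]) : u != 0 -> md u < 1 ->
  qpoch_oo (- u) (u ^+ 2) = Jk u 2 ^+ 2 / (Jk u 1 * Jk u 4).
Proof.
move=> u0 u1; have u2 : md (u ^+ 2) < 1 by apply: md_expr_lt1.
have := qpoch_oo_mulN u u2; rewrite (eta_odd u1) (eta_odd u2) !JkM.
have := eta_neq0 u1 (ltn0Sn 0); have := eta_neq0 u1 (ltn0Sn 1); have := eta_neq0 u1 (ltn0Sn 3).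
move: (Jk u 1) (Jk u _) (Jk u _) (qpoch_oo (- u) _) => a b c d n4 n2 n1 h.
have -> : d = b / a * (a / b * d) by field; rewrite n1 n2.
by rewrite h; field; rewrite n1 n4.
Qed.

Lemma eta_Npos (u : R[i]) : u != 0 -> md u < 1 ->
  qpoch_oo (- u) (- u) = Jk u 2 ^+ 3 / (Jk u 1 * Jk u 4).
Proof.
move=> u0 u1; have nu1 : md (- u) < 1 by rewrite mdN.
rewrite (qpoch_oo_sect2 nu1) sqrrN mulrNN -expr2 (eta_neg_odd u0 u1).
have -> : qpoch_oo (u ^+ 2) (u ^+ 2) = Jk u 2 by [].
have := eta_neq0 u1 (ltn0Sn 0); have := eta_neq0 u1 (ltn0Sn 3).
move: (Jk u 1) (Jk u 2) (Jk u 4) => a b c h1 h2.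
by field; rewrite h1 h2.
Qed.

(** Of the three classes modulo 3 in (c u;u)_oo, two form the theta function, as c^2 = 1 gives
    u^3/(c u) = c u^2; the third is divided out. *)
Lemma theta_base3 (u : R[i]) c : u != 0 -> md u < 1 -> c = 1 \/ c = -1 ->
  qpoch_oo (c * u ^+ 3) (u ^+ 3) != 0 ->
  theta (c * u) (u ^+ 3) = qpoch_oo (c * u) u / qpoch_oo (c * u ^+ 3) (u ^+ 3) * Jk u 3.
Proof.
move=> u0 u1 hc n0; rewrite (qpoch_oo_sect3 u1 (c * u)) /theta /Jk.
have -> : c * u * u ^+ 2 = c * u ^+ 3 by rewrite !exprS; ring.
have -> : u ^+ 3 / (c * u) = c * u * u.
  by case: hc => ->; rewrite !exprS; field.
by rewrite mulfK.
Qed.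

Lemma theta_base6 (u : R[i]) c : u != 0 -> md u < 1 -> c = 1 \/ c = -1 ->
  qpoch_oo (c * u ^+ 3) (u ^+ 6) != 0 ->
  theta (c * u) (u ^+ 6) = qpoch_oo (c * u) (u ^+ 2) / qpoch_oo (c * u ^+ 3) (u ^+ 6) * Jk u 6.
Proof.
move=> u0 u1 hc n0; have u2 : md (u ^+ 2) < 1 by apply: md_expr_lt1.
rewrite (qpoch_oo_sect3 u2 (c * u)) /theta /Jk -!exprM.
have -> : c * u * u ^+ 2 = c * u ^+ 3 by rewrite !exprS; ring.
have -> : u ^+ 6 / (c * u) = c * u * u ^+ (2 * 2).
  by case: hc => ->; rewrite !exprS; field.
by rewrite [X in X / _]mulrAC mulfK.
Qed.

Lemma theta_base4 (u : R[i]) c : u != 0 -> md u < 1 -> c = 1 \/ c = -1 ->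
  theta (c * u) (u ^+ 4) = qpoch_oo (c * u) (u ^+ 2) * Jk u 4.
Proof.
move=> u0 u1 hc; have u2 : md (u ^+ 2) < 1 by apply: md_expr_lt1.
rewrite (qpoch_oo_sect2 u2 (c * u)) /theta /Jk -!exprM.
by have -> : u ^+ 4 / (c * u) = c * u * u ^+ 2 by case: hc => ->; rewrite !exprS; field.
Qed.

Lemma theta_base2 (u : R[i]) c : u != 0 -> md u < 1 -> c = 1 \/ c = -1 ->
  theta (c * u) (u ^+ 2) = qpoch_oo (c * u) (u ^+ 2) ^+ 2 * Jk u 2.
Proof.
move=> u0 u1 hc; rewrite /theta /Jk.
have -> : u ^+ 2 / (c * u) = c * u by case: hc => ->; rewrite !exprS; field.
by rewrite expr2.
Qed.

Section PowerBase.
Variable q : R[i].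
Hypotheses (q0 : q != 0) (q1 : md q < 1).
Local Notation J k := (Jk q k).

Lemma eta_oddX k : (0 < k)%N -> qpoch_oo (q ^+ k) (q ^+ (2 * k)) = J k / J (2 * k).
Proof.
by move=> k0; rewrite mulnC exprM (eta_odd (md_expr_lt1 q1 k0)) !JkM muln1.
Qed.

Lemma eta_negX k : (0 < k)%N -> qpoch_oo (- q ^+ k) (q ^+ k) = J (2 * k) / J k.
Proof. by move=> k0; rewrite (eta_neg (md_expr_lt1 q1 k0)) !JkM muln1 mulnC. Qed.

Lemma eta_neg_oddX k : (0 < k)%N ->
  qpoch_oo (- q ^+ k) (q ^+ (2 * k)) = J (2 * k) ^+ 2 / (J k * J (4 * k)).
Proof.
move=> k0; rewrite mulnC exprM (eta_neg_odd (expf_neq0 k q0) (md_expr_lt1 q1 k0)) !JkM muln1.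
by rewrite (mulnC k 4%N).
Qed.

Let n3 : J 3 != 0. Proof. exact: eta_neq0. Qed.
Let n6 : J 6 != 0. Proof. exact: eta_neq0. Qed.
Let n12 : J 12 != 0. Proof. exact: eta_neq0. Qed.

Let o1 : qpoch_oo q (q ^+ 2) = J 1 / J 2 := eta_oddX (ltn0Sn 0).
Let o3 : qpoch_oo (q ^+ 3) (q ^+ 6) = J 3 / J 6 := eta_oddX (ltn0Sn 2).
Let e1 : qpoch_oo (- q) q = J 2 / J 1 := eta_negX (ltn0Sn 0).
Let e3 : qpoch_oo (- q ^+ 3) (q ^+ 3) = J 6 / J 3 := eta_negX (ltn0Sn 2).
Let d1 : qpoch_oo (- q) (q ^+ 2) = J 2 ^+ 2 / (J 1 * J 4) := eta_neg_oddX (ltn0Sn 0).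
Let d3 : qpoch_oo (- q ^+ 3) (q ^+ 6) = J 6 ^+ 2 / (J 3 * J 12) := eta_neg_oddX (ltn0Sn 2).

Lemma theta_base6_pos : theta q (q ^+ 6) = J 1 * J 6 ^+ 2 / (J 2 * J 3).
Proof.
have := @theta_base6 q 1 q0 q1 (or_introl erefl); rewrite !mul1r o1 o3 => ->.
  by eta_field q q1.
exact: (mulf_neq0 n3 (invr_neq0 n6)).
Qed.

Lemma theta_base6_neg : theta (- q) (q ^+ 6) = J 2 ^+ 2 * J 3 * J 12 / (J 1 * J 4 * J 6).
Proof.
have := @theta_base6 q (-1) q0 q1 (or_intror erefl); rewrite !mulN1r d1 d3 => ->.
  by eta_field q q1.
exact: (mulf_neq0 (expf_neq0 2 n6) (invr_neq0 (mulf_neq0 n3 n12))).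
Qed.

Lemma theta_base4_pos : theta q (q ^+ 4) = J 1 * J 4 / J 2.
Proof.
have := @theta_base4 q 1 q0 q1 (or_introl erefl); rewrite !mul1r o1 => ->.
by eta_field q q1.
Qed.

Lemma theta_base4_neg : theta (- q) (q ^+ 4) = J 2 ^+ 2 / J 1.
Proof.
have := @theta_base4 q (-1) q0 q1 (or_intror erefl); rewrite !mulN1r d1 => ->.
by eta_field q q1.
Qed.

Lemma theta_base3_pos : theta q (q ^+ 3) = J 1.
Proof.
have h : qpoch_oo (1 * q ^+ 3) (q ^+ 3) != 0 by rewrite mul1r n3.
have := @theta_base3 q 1 q0 q1 (or_introl erefl) h; rewrite !mul1r => ->.
have -> : J 1 = qpoch_oo q q by rewrite /Jk expr1.
exact: divfK n3 _.
Qed.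

Lemma theta_base3_neg : theta (- q) (q ^+ 3) = J 2 * J 3 ^+ 2 / (J 1 * J 6).
Proof.
have := @theta_base3 q (-1) q0 q1 (or_intror erefl); rewrite !mulN1r e1 e3 => ->.
  by eta_field q q1.
exact: (mulf_neq0 n6 (invr_neq0 n3)).
Qed.

Lemma theta_base2_pos : theta q (q ^+ 2) = J 1 ^+ 2 / J 2.
Proof.
have := @theta_base2 q 1 q0 q1 (or_introl erefl); rewrite !mul1r o1 => ->.
by eta_field q q1.
Qed.

Lemma theta_N1 : theta (- 1) q = 2 * J 2 ^+ 2 / J 1.
Proof.
rewrite /theta invrN1 mulrN1 (qpoch_oo_recl _ q1) mulN1r e1 -[qpoch_oo q q]/(J 1) opprK.
by eta_field q q1.
Qed.

Lemma eta_Nq_odd k : (0 < k)%N -> odd k -> Jk (- q) k = J (k * 2) ^+ 3 / (J k * J (k * 4)).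
Proof.
move=> k0 ok; have vE : (- q) ^+ k = - q ^+ k by rewrite exprNn -signr_odd ok expr1 mulN1r.
have e : Jk (- q) k = qpoch_oo (- q ^+ k) (- q ^+ k) by rewrite /Jk vE.
have := eta_Npos (expf_neq0 k q0) (md_expr_lt1 q1 k0); rewrite 3!JkM muln1.
exact: etrans.
Qed.

Lemma eta_Nq_even k : ~~ odd k -> Jk (- q) k = J k.
Proof. by move=> ok; rewrite /Jk exprNn -signr_odd (negbTE ok) expr0 mul1r. Qed.

End PowerBase.

Variable q : R[i].
Hypotheses (q0 : q != 0) (q1 : md q < 1).
Local Notation J k := (Jk q k).

Let qX0 k : q ^+ k != 0. Proof. by rewrite expf_neq0. Qed.
Let mdX_lt1 k : md (q ^+ k.+1) < 1. Proof. exact: md_expr_lt1. Qed.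

Lemma theta_q3_q6 : theta (q ^+ 3) (q ^+ 6) = J 3 ^+ 2 / J 6.
Proof. by have := theta_base2_pos (qX0 3) (mdX_lt1 2); rewrite -exprM !JkM. Qed.

Lemma theta_Nq4_q12 : theta (- q ^+ 4) (q ^+ 12) = J 8 * J 12 ^+ 2 / (J 4 * J 24).
Proof. by have := theta_base3_neg (qX0 4) (mdX_lt1 3); rewrite -exprM !JkM. Qed.

Lemma theta_q4_q12 : theta (q ^+ 4) (q ^+ 12) = J 4.
Proof. by have := theta_base3_pos (qX0 4) (mdX_lt1 3); rewrite -exprM !JkM. Qed.

Lemma theta_Nq2_q12 : theta (- q ^+ 2) (q ^+ 12) = J 4 ^+ 2 * J 6 * J 24 / (J 2 * J 8 * J 12).
Proof. by have := theta_base6_neg (qX0 2) (mdX_lt1 1); rewrite -exprM !JkM. Qed.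

Lemma theta_q2_q12 : theta (q ^+ 2) (q ^+ 12) = J 2 * J 12 ^+ 2 / (J 4 * J 6).
Proof. by have := theta_base6_pos (qX0 2) (mdX_lt1 1); rewrite -exprM !JkM. Qed.

Lemma theta_q3_q12 : theta (q ^+ 3) (q ^+ 12) = J 3 * J 12 / J 6.
Proof. by have := theta_base4_pos (qX0 3) (mdX_lt1 2); rewrite -exprM !JkM. Qed.

Lemma theta_Nq3_q12 : theta (- q ^+ 3) (q ^+ 12) = J 6 ^+ 2 / J 3.
Proof. by have := theta_base4_neg (qX0 3) (mdX_lt1 2); rewrite -exprM !JkM. Qed.

Lemma theta_N1_q12 : theta (- 1) (q ^+ 12) = 2 * J 24 ^+ 2 / J 12.
Proof. by have := theta_N1 (mdX_lt1 11); rewrite !JkM. Qed.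

(** [theta_base3_neg] with -q for q; only the eta factors of odd index change. *)
Lemma theta_q_Nq3 : theta q (- q ^+ 3) = J 1 * J 4 * J 6 ^+ 5 / (J 2 ^+ 2 * J 3 ^+ 2 * J 12 ^+ 2).
Proof.
have nq0 : - q != 0 by rewrite oppr_eq0.
have nq1 : md (- q) < 1 by rewrite mdN.
have := theta_base3_neg nq0 nq1; rewrite opprK.
have -> : (- q) ^+ 3 = - q ^+ 3 by rewrite !exprS; ring.
rewrite (eta_Nq_odd q0 q1 (ltn0Sn 0) isT) (eta_Nq_odd q0 q1 (ltn0Sn 2) isT).
rewrite (@eta_Nq_even q 2 isT) (@eta_Nq_even q 6 isT) => ->.
have [-> -> -> ->] : [/\ 1 * 2 = 2, 1 * 4 = 4, 3 * 2 = 6 & 3 * 4 = 12]%N by [].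
by eta_field q q1.
Qed.

(** [theta_mul] with a = q, b = q^3 and base q^6. This choice makes the two theta functions in each
    product on the right equal, so that squares of eta quotients appear. *)
Lemma eta_dissect_13 : J 1 * J 3 = J 2 * J 8 ^+ 2 * J 12 ^+ 4 / (J 4 ^+ 2 * J 6 * J 24 ^+ 2)
            - q * J 4 ^+ 4 * J 6 * J 24 ^+ 2 / (J 2 * J 8 ^+ 2 * J 12 ^+ 2).
Proof.
have := theta_mul (qX0 6) (mdX_lt1 5) q0 (qX0 3).
rewrite (theta_base6_pos q0 q1) theta_q3_q6 -exprM (_ : 6 * 2 = 12)%N //.
have -> : - (q * q ^+ 3) = - q ^+ 4 by rewrite -exprS.
have -> : - (q ^+ 6 * q / q ^+ 3) = - q ^+ 4 by field.
have -> : - (q ^+ 6 * q * q ^+ 3) = q ^+ 12 / (- q ^+ 2) by field.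
have -> : - (q ^+ 12 * q / q ^+ 3) = q ^+ 12 / (- q ^+ 2) by field.
rewrite theta_reflect ?oppr_eq0 ?qX0 // theta_Nq4_q12 theta_Nq2_q12 => h.
have e : J 1 * J 3 = J 2 / J 6 * (J 1 * J 6 ^+ 2 / (J 2 * J 3) * (J 3 ^+ 2 / J 6)).
  by eta_field q q1.
by apply: (etrans e); rewrite [X in _ * X]h; eta_field q q1.
Qed.

(** The same product as in [eta_dissect_13] with a = -q. *)
Lemma eta_dissect_31 : J 3 ^+ 3 / J 1 = J 4 ^+ 3 * J 6 ^+ 2 / (J 2 ^+ 2 * J 12) + q * J 12 ^+ 3 / J 4.
Proof.
have nq0 : - q != 0 by rewrite oppr_eq0.
have := theta_mul (qX0 6) (mdX_lt1 5) nq0 (qX0 3).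
rewrite (theta_base6_neg q0 q1) theta_q3_q6 -exprM (_ : 6 * 2 = 12)%N //.
have -> : - (- q * q ^+ 3) = q ^+ 4 by rewrite mulNr opprK -exprS.
have -> : - (q ^+ 6 * - q / q ^+ 3) = q ^+ 4 by field.
have -> : - (q ^+ 6 * - q * q ^+ 3) = q ^+ 12 / (q ^+ 2) by field.
have -> : - (q ^+ 12 * - q / q ^+ 3) = q ^+ 12 / (q ^+ 2) by field.
rewrite theta_reflect ?qX0 // theta_q4_q12 theta_q2_q12 => h.
have e : J 3 ^+ 3 / J 1 = J 4 * J 6 ^+ 2 / (J 2 ^+ 2 * J 12) *
   (J 2 ^+ 2 * J 3 * J 12 / (J 1 * J 4 * J 6) * (J 3 ^+ 2 / J 6)).
  by eta_field q q1.
by apply: (etrans e); rewrite [X in _ * X]h; eta_field q q1.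
Qed.

End ThetaEvaluations.

(** * The Appell function in (iii) *)

Section NuAppell.
Context {R : realType}.
Variable q : R[i].
Hypotheses (q0 : q != 0) (q1 : md q < 1).
Local Notation p := (q ^+ 12).
Local Notation J k := (Jk q k).

Let p0 : p != 0. Proof. by rewrite expf_neq0. Qed.
Let p1 : md p < 1. Proof. exact: md_expr_lt1. Qed.
Let qz0 n : q ^ n != 0. Proof. exact: expfz_neq0. Qed.

(** Comparison of moduli: an equality with a power of q^12 would force 12 to divide a. *)
Lemma generic_monomial (c : R[i]) (a : int) : md c = 1 -> (forall n : int, a <> 12 * n) ->
  generic p (c * q ^ a).
Proof.
move=> c1 ha n; apply/eqP => /(congr1 (@md R)); rewrite mdM c1 mul1r !mdXz mdX exprnP exprz_exp.
have m0 : 0 < md q by rewrite md_gt0.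
move=> h; apply: (ha n); apply: (ieexprIz m0 _ h).
by rewrite lt_eqF.
Qed.

Lemma theta_term_monomial (a : nat) (n : int) :
  theta_term (- q ^+ a * p) p n = q ^ (6 * n ^+ 2 + (6 + a%:Z) * n).
Proof.
rewrite /theta_term mulNr -exprD -[- q ^+ _]mulN1r. rewrite [X in _ * X]expfzMl mulrACA -expfzMl mulrNN mulr1 exp1rz mul1r.
rewrite !exprnP !exprz_exp -expfzDr //; congr (q ^ _).
by rewrite -[n ^ 2]exprnP; have := bin2z_double n; nia.
Qed.

Lemma pole_monomial (a : nat) (n : int) :
  theta_term (- q ^+ a * p) p n / (1 - q ^+ 2 * (- q ^+ a) * p ^ n) =
  q ^ (6 * n ^+ 2 + (6 + a%:Z) * n) / (1 + q ^ (12 * n + 2 + a%:Z)).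
Proof.
rewrite theta_term_monomial; congr (_ / (1 + _)).
rewrite mulrN mulNr opprK !exprnP exprz_exp -!expfzDr //; congr (q ^ _); lia.
Qed.

(** Gives terms of negative index the same denominator as those of nonnegative index. *)
Lemma pole_flip (e d : int) : 1 + q ^ d != 0 -> q ^ e / (1 + q ^ (- d)) = q ^ (e + d) / (1 + q ^ d).
Proof.
move=> h; rewrite expfzDr // -invr_expz; have := qz0 d.
by move: (q ^ d) (q ^ e) h => X Y h h'; field; rewrite h' h.
Qed.

(* The error term in (1 - y)/(1 + y) = (1 - y^3)/(1 + y^3) - 2 (y - y^2)/(1 + y^3),
   y = q^(2k+1). *)
Definition nu_correction k := (-1) ^+ k * q ^+ (3 * 'C(k.+1, 2)) *
  ((q ^+ (2 * k).+1 - q ^+ (2 * k).+1 ^+ 2) / (1 + q ^+ (2 * k).+1 ^+ 3)).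

Lemma watson_alpha_cube k : q ^+ (k * k + k) * watson_alpha q k =
  watson_alpha (q ^+ 3) k - 2 * nu_correction k.
Proof.
rewrite /watson_alpha /nu_correction !(exprAC q 3).
have -> : (k * k + k = 'C(k.+1, 2) * 2)%N by have := bin2_double k; lia.
rewrite (mulnC 3) !exprM.
have := one_add_neq0 q1 (2 * k); have := one_add_neq0 (md_expr_lt1 q1 (ltn0Sn 2)) (2 * k).
rewrite (exprAC q 3).
by move: (q ^+ (2 * k).+1) (q ^+ 'C(_, _)) ((-1) ^+ k) => y B e h1 h2; field; rewrite h1 h2.
Qed.

(** The two monomials of y - y^2 are one term from each of two bilateral sums. For k = 2m these are
    n = m at z = -q and n = -m-1 at z = -q^7; odd k exchanges the roles, so together each sum runs
    over all integers. *)
Lemma nu_correction_even m : nu_correction (2 * m) =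
  q * (theta_term (- q ^+ 1 * p) p m%:Z / (1 - q ^+ 2 * (- q ^+ 1) * p ^ m%:Z))
  - q ^+ 6 * (theta_term (- q ^+ 7 * p) p (- m.+1%:Z) / (1 - q ^+ 2 * (- q ^+ 7) * p ^ (- m.+1%:Z))).
Proof.
rewrite !pole_monomial.
have -> : 12 * - m.+1%:Z + 2 + 7%N%:Z = - (12 * m + 3)%N%:Z by lia.
have -> : 12 * m%:Z + 2 + 1%N%:Z = (12 * m + 3)%N%:Z by lia.
have h : 1 + q ^ (12 * m + 3)%N%:Z != 0 by rewrite -exprnP addnS one_add_neq0.
rewrite pole_flip // !mulrA [q ^+ 6]exprnP -{1}(expr1z q) -!expfzDr // -mulrBl.
rewrite /nu_correction -signr_odd mul2n odd_double expr0 mul1r -mul2n.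
have e : (3 * 'C((2 * m).+1, 2) = 6 * m * m + 3 * m)%N by have := bin2_double (2 * m); lia.
rewrite e -!exprM mulrA mulrBr -!exprD; congr ((_ - _) / (1 + _)).
- by rewrite exprnP; congr (q ^ _); lia.
- by rewrite exprnP; congr (q ^ _); lia.
- by rewrite exprnP; congr (q ^ _); lia.
Qed.

Lemma nu_correction_odd m : nu_correction (2 * m + 1) =
  q * (theta_term (- q ^+ 1 * p) p (- m.+1%:Z) / (1 - q ^+ 2 * (- q ^+ 1) * p ^ (- m.+1%:Z)))
  - q ^+ 6 * (theta_term (- q ^+ 7 * p) p m%:Z / (1 - q ^+ 2 * (- q ^+ 7) * p ^ m%:Z)).
Proof.
rewrite !pole_monomial.
have -> : 12 * - m.+1%:Z + 2 + 1%N%:Z = - (12 * m + 9)%N%:Z by lia.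
have -> : 12 * m%:Z + 2 + 7%N%:Z = (12 * m + 9)%N%:Z by lia.
have h : 1 + q ^ (12 * m + 9)%N%:Z != 0 by rewrite -exprnP addnS one_add_neq0.
rewrite pole_flip // !mulrA [q ^+ 6]exprnP -{1}(expr1z q) -!expfzDr // -mulrBl.
rewrite /nu_correction -signr_odd oddD mul2n odd_double expr1 mulN1r -mul2n.
have e : (3 * 'C((2 * m + 1).+1, 2) = 6 * m * m + 9 * m + 3)%N by have := bin2_double (2 * m + 1); lia.
rewrite e -!exprM mulrA mulNr mulrBr -!exprD opprB; congr ((_ - _) / (1 + _)).
- by rewrite exprnP; congr (q ^ _); lia.
- by rewrite exprnP; congr (q ^ _); lia.
- by rewrite exprnP; congr (q ^ _); lia.
Qed.

Lemma pole_family_summable (a : nat) : (forall n : int, a%:Z <> 12 * n) ->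
  (forall n : int, a%:Z + 2 <> 12 * n) ->
  abs_summable (fun n => theta_term (- q ^+ a * p) p n / (1 - q ^+ 2 * (- q ^+ a) * p ^ n)).
Proof.
move=> ha ha2; have qa0 : - q ^+ a != 0 by rewrite oppr_eq0 expf_neq0.
have qq0 : q ^+ 2 != 0 by rewrite expf_neq0.
have N0 : - 1 != 0 :> R[i] by rewrite oppr_eq0 oner_neq0.
have [||h _] := residue_sum_cvg p0 p1 qq0 qa0 N0 _ _; last exact: h.
  have := @generic_monomial 1 (- a%:Z) md1; rewrite mul1r -invr_expz.
  have -> : -1 / - q ^+ a = (q ^+ a)^-1 by field; rewrite expf_neq0.
  by apply=> n h; apply: (ha (- n)); lia.
have := @generic_monomial (-1) (a%:Z + 2); rewrite mdN md1 => /(_ erefl ha2).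
by rewrite expfzDr // mulN1r mulrN mulrC.
Qed.

Lemma nu_correction_summable : abs_summable nu_correction.
Proof.
have [s _] := nu_watson q0 q1.
have s3 := watson_alpha_summable (expf_neq0 3 q0) (md_expr_lt1 q1 (ltn0Sn 2)).
apply: eq_abs_summable (abs_summableZ (2^-1) (abs_summableD s3 (abs_summableZ (- 1) s))) => k.
rewrite watson_alpha_cube; move: (watson_alpha _ _) (nu_correction _) => a b.
by field.
Qed.

Lemma nu_correction_sum : csum nu_correction =
  q * pole_sum p (q ^+ 2) (- q ^+ 1) - q ^+ 6 * pole_sum p (q ^+ 2) (- q ^+ 7).
Proof.
have hS := nu_correction_summable.
have [s1 s7] : abs_summable (fun n => theta_term (- q ^+ 1 * p) p n / (1 - q ^+ 2 * (- q ^+ 1) * p ^ n)) /\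
    abs_summable (fun n => theta_term (- q ^+ 7 * p) p n / (1 - q ^+ 2 * (- q ^+ 7) * p ^ n)).
  by split; apply: pole_family_summable => n; lia.
pose f n := theta_term (- q ^+ 1 * p) p n / (1 - q ^+ 2 * (- q ^+ 1) * p ^ n).
pose g n := theta_term (- q ^+ 7 * p) p n / (1 - q ^+ 2 * (- q ^+ 7) * p ^ n).
rewrite csum_usum // usum_nat_parity //.
rewrite (eq_usum (v := fun m : nat => q * f m%:Z - q ^+ 6 * g (- m.+1%:Z)) nu_correction_even).
rewrite (eq_usum (v := fun m : nat => q * f (- m.+1%:Z) - q ^+ 6 * g m%:Z) nu_correction_odd).
rewrite /pole_sum -/f -/g (usum_int_nat s1) (usum_int_nat s7) -/f -/g.
have i1 : injective Posz by move=> x y [].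
have i2 : injective (fun n : nat => - n.+1%:Z) by move=> x y; lia.
have h1 := abs_summable_inj i1 s1; have h2 := abs_summable_inj i2 s1.
have h3 := abs_summable_inj i1 s7; have h4 := abs_summable_inj i2 s7.
have E (c d : R[i]) (u v : nat -> R[i]) : abs_summable u -> abs_summable v ->
    usum (fun n => c * u n - d * v n) = c * usum u - d * usum v.
  move=> hu hv; rewrite -!usumZ // -mulN1r -usumZ; last exact: abs_summableZ.
  rewrite -usumD; [by apply: eq_usum => n; rewrite mulN1r | exact: abs_summableZ |].
  by do 2 apply: abs_summableZ.
rewrite (E _ _ _ _ h1 h4) (E _ _ _ _ h2 h3) /comp /f /g.
by move: (usum _) (usum _) (usum _) (usum _) => a b c d; ring.
Qed.

Local Notation th x := (theta x p).

Lemma theta_reflectX (c : R[i]) m n : c = 1 \/ c = -1 -> (m + n = 12)%N ->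
  th (c * q ^+ n) = th (c * q ^+ m).
Proof.
move=> hc mn; have cm : c * q ^+ m != 0.
  by rewrite mulf_neq0 ?expf_neq0 //; case: hc => ->; rewrite ?oppr_eq0 oner_neq0.
apply: etrans _ (theta_reflect p0 cm); congr (theta _ p).
have h : q ^+ m != 0 by rewrite expf_neq0.
have -> : p = q ^+ m * q ^+ n by rewrite -exprD mn.
by case: hc => ->; field.
Qed.

(** J_1 = j(q;q^3), split into even and odd terms. *)
Lemma eta1_dissect : J 1 = th (- q ^+ 5) - q * th (- q).
Proof.
have := theta_base3_pos q0 q1; rewrite (theta_dissect (expf_neq0 3 q0) (md_expr_lt1 q1 (ltn0Sn 2)) q0) -!exprM -!exprD.
have := @theta_reflectX (-1) 1 11 (or_intror erefl) erefl; rewrite !mulN1r expr1.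
by move=> -> <-.
Qed.

Lemma theta_q_Nq3_dissect : theta q (- q ^+ 3) = th (q ^+ 5) - q * th q.
Proof.
have c0 : - q ^+ 3 != 0 by rewrite oppr_eq0 expf_neq0.
have c1 : md (- q ^+ 3) < 1 by rewrite mdN md_expr_lt1.
have r := @theta_reflectX 1 1 11 (or_introl erefl) erefl; rewrite !mul1r expr1 in r.
have e4 : (- q ^+ 3) ^+ 4 = p by rewrite exprNn -exprM -signr_odd expr0 mul1r.
have e5 : - (- q ^+ 3 * q ^+ 2) = q ^+ 5 by rewrite mulNr opprK -exprD.
have e11 : - ((- q ^+ 3) ^+ 3 * q ^+ 2) = q ^+ 11.
  by rewrite exprNn -exprM -signr_odd expr1 !mulN1r mulNr opprK -exprD.
by rewrite (theta_dissect c0 c1 q0) e4 e5 e11 r.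
Qed.

(** Both sums are moved to z = -1. Their coefficients combine as j(-q) - q^-1 j(-q^5) = - q^-1 J_1,
    and the numerators of the theta quotients by the analogous dissection of j(q;-q^3). *)
Lemma nu_correction_appell : th (- 1) * csum nu_correction =
  - q^-1 * J 1 * appell_sum p (q ^+ 2) (- 1)
  + q^-1 * J 12 ^+ 3 * th (q ^+ 3) * theta q (- q ^+ 3) / (th (- q ^+ 2) * th (- q ^+ 3)).
Proof.
have qq0 : q ^+ 2 != 0 by rewrite expf_neq0.
have N0 : - 1 != 0 :> R[i] by rewrite oppr_eq0 oner_neq0.
have gN (a : nat) : (forall n : int, a%:Z <> 12 * n) -> generic p (- q ^+ a).
  move=> ha; have := @generic_monomial (-1) a%:Z; rewrite mdN md1 => /(_ erefl ha).
  by rewrite mulN1r.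
have gP (a : nat) : (forall n : int, a%:Z <> 12 * n) -> generic p (q ^+ a).
  by move=> ha; have := @generic_monomial 1 a%:Z md1 ha; rewrite mul1r.
have H (a : nat) : (forall n : int, a%:Z <> 12 * n) -> (forall n : int, a%:Z + 2 <> 12 * n) ->
   th (- 1) * (q ^+ a * pole_sum p (q ^+ 2) (- q ^+ a)) = th (- q ^+ a) * appell_sum p (q ^+ 2) (- 1)
   - J 12 ^+ 3 * th (q ^+ a) * th (q ^+ (a + 2)) / (th (- q ^+ 2) * th (- q ^+ (a + 2))).
  move=> ha ha2; have qa0 : - q ^+ a != 0 by rewrite oppr_eq0 expf_neq0.
  have e1 : - q ^+ a / - 1 = q ^+ a by rewrite invrN1 mulrNN mulr1.
  have e2 : q ^+ 2 * - 1 = - q ^+ 2 by rewrite mulrN1.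
  have e3 : q ^+ 2 * - q ^+ a = - q ^+ (a + 2) by rewrite mulrN -exprD addnC.
  have e4 : q ^+ 2 * - 1 * - q ^+ a = q ^+ (a + 2) by rewrite mulrN1 mulrNN -exprD addnC.
  have := @appell_change_z _ p p0 p1 (q ^+ 2) (- 1) (- q ^+ a) qq0 N0 qa0.
  rewrite e4 e1 e2 e3 => h.
  have ha2' : forall n : int, (a + 2)%N%:Z <> 12 * n by move=> n; have := ha2 n; lia.
  have h2 : forall n : int, 2%N%:Z <> 12 * n by move=> n; lia.
  move: (h (gP _ ha) (gN _ h2) (gN _ ha2')).
  rewrite (appell_sumE p0 p1 qa0 (pole_family_summable ha ha2)) opprK.
  rewrite /Jk; move: (th (- q ^+ 2) * th (- q ^+ (a + 2)))^-1.
  move: (th (- 1)) (th (- q ^+ a)) (th (q ^+ a)) (th (q ^+ (a + 2))).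
  move: (q ^+ a) (pole_sum _ _ _) (appell_sum _ _ _) (qpoch_oo p p) => z X Y P A B C D t.
  by move=> e; rewrite -[LHS](subrK (B * Y)) e; ring.
have H1 : th (- 1) * (q ^+ 1 * pole_sum p (q ^+ 2) (- q ^+ 1)) = th (- q) * appell_sum p (q ^+ 2) (- 1)
   - J 12 ^+ 3 * th q * th (q ^+ 3) / (th (- q ^+ 2) * th (- q ^+ 3)).
  have -> : th (- q) = th (- q ^+ 1) by rewrite expr1.
  have -> : th q = th (q ^+ 1) by rewrite expr1.
  by apply: H => n; lia.
have H7 : th (- 1) * (q ^+ 7 * pole_sum p (q ^+ 2) (- q ^+ 7)) = th (- q ^+ 5) * appell_sum p (q ^+ 2) (- 1)
   - J 12 ^+ 3 * th (q ^+ 5) * th (q ^+ 3) / (th (- q ^+ 2) * th (- q ^+ 3)).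
  (* For a = 7 the exponents 7 and 9 reflect to 5 and 3, so both quotients share one denominator. *)
  have := @theta_reflectX (-1) 5 7 (or_intror erefl) erefl; rewrite !mulN1r => <-.
  have := @theta_reflectX (-1) 3 9 (or_intror erefl) erefl; rewrite !mulN1r => <-.
  have := @theta_reflectX 1 5 7 (or_introl erefl) erefl; rewrite !mul1r => <-.
  have := @theta_reflectX 1 3 9 (or_introl erefl) erefl; rewrite !mul1r => <-.
  by apply: H => n; lia.
have S : th (- 1) * csum nu_correction = th (- 1) * (q ^+ 1 * pole_sum p (q ^+ 2) (- q ^+ 1))
   - q^-1 * (th (- 1) * (q ^+ 7 * pole_sum p (q ^+ 2) (- q ^+ 7))).
  rewrite nu_correction_sum; move: (pole_sum _ _ _) (pole_sum _ _ _) (th _) => X Y Z.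
  by field.
rewrite [LHS]S [X in X - _]H1 [X in _ - _ * X]H7 eta1_dissect theta_q_Nq3_dissect.
move: (th (- q)) (th (- q ^+ 5)) (th q) (th (q ^+ 5)) (th (q ^+ 3)) (appell_sum _ _ _) (J 12) => a b c d e f g.
move: (_ * _)^-1 => t.
by field.
Qed.

Lemma watson_alpha_cube_sum : csum (watson_alpha (q ^+ 3)) = J 3 ^+ 3 * J 12 / J 6 ^+ 2.
Proof.
rewrite (watson_alpha_sum (expf_neq0 3 q0) (md_expr_lt1 q1 (ltn0Sn 2))) -exprM.
rewrite (eta_neg_oddX q0 q1 (k := 3) isT) -[qpoch_oo _ _]/(J 3).
have n3 : J 3 != 0 by exact: eta_neq0.
have n6 : J 6 != 0 by exact: eta_neq0.
have n12 : J 12 != 0 by exact: eta_neq0.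
have [-> ->] : (2 * 3 = 6 /\ 4 * 3 = 12)%N by [].
by move: n3 n6 n12; move: (J 3) (J 6) (J 12) => a b c h1 h2 h3; field; rewrite h1 h2 h3.
Qed.

Lemma nu_sub_correction : csum (fun n => q ^+ (n * (n + 1)) / qpoch (- q) (q ^+ 2) n.+1) =
  (J 1)^-1 * (csum (watson_alpha (q ^+ 3)) - 2 * csum nu_correction).
Proof.
have [_ ->] := nu_watson q0 q1; congr (_ * _).
have s3 := watson_alpha_summable (expf_neq0 3 q0) (md_expr_lt1 q1 (ltn0Sn 2)).
have sc := nu_correction_summable.
have sz : abs_summable (fun k => - 2 * nu_correction k) by exact: abs_summableZ.
rewrite (eq_csum watson_alpha_cube) !csum_usum //.
  rewrite -mulNr -usumZ // -usumD //; apply: eq_usum => k; by rewrite mulNr.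
by apply: eq_abs_summable (abs_summableD s3 sz) => k; rewrite mulNr.
Qed.

(** The Appell part comes from [nu_correction_appell] divided by j(-1;q^12) J_1. The two remaining
    eta quotients, from the sum with base q^3 and from the change of z, merge by
    [nu_theta_algebra]. *)
Theorem nu_appell : csum (fun n => q ^+ (n * (n + 1)) / qpoch (- q) (q ^+ 2) n.+1) =
  2 * q^-1 * appell_m (q ^+ 2) p (-1)
  - q^-1 * ((J 1 * J 3 * J 8 ^+ 2 * J 12 ^+ 2) / (J 2 * J 4 * J 6 * J 24 ^+ 2)).
Proof.
rewrite nu_sub_correction watson_alpha_cube_sum.
have -> : appell_m (q ^+ 2) p (-1) = (th (- 1))^-1 * appell_sum p (q ^+ 2) (- 1) by [].
have := nu_correction_appell.
rewrite (theta_N1_q12 q1) (theta_q3_q12 q0 q1) (theta_q_Nq3 q0 q1) (theta_Nq2_q12 q0 q1) (theta_Nq3_q12 q0 q1).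
have E1 := eta_dissect_13 q0 q1; have E2 := eta_dissect_31 q0 q1.
have E3 := eta_dissect_31 (expf_neq0 2 q0) (md_expr_lt1 q1 (ltn0Sn 1)).
have n1 : J 1 != 0 by exact: eta_neq0.
have n2 : J 2 != 0 by exact: eta_neq0.
have n3 : J 3 != 0 by exact: eta_neq0.
have n4 : J 4 != 0 by exact: eta_neq0.
have n6 : J 6 != 0 by exact: eta_neq0.
have n8 : J 8 != 0 by exact: eta_neq0.
have n12 : J 12 != 0 by exact: eta_neq0.
have n24 : J 24 != 0 by exact: eta_neq0.
rewrite !JkM in E3.
have [e1 e2 e3 e4] : [/\ 2 * 1 = 2, 2 * 2 = 4, 2 * 3 = 6 & 2 * 4 = 8]%N by [].
have [e5 e6] : (2 * 6 = 12 /\ 2 * 12 = 24)%N by [].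
rewrite e1 e2 e3 e4 e5 e6 in E3.
have A := nu_theta_algebra q0 n1 n2 n3 n4 n6 n8 n12 n24 E1 E2 E3.
move: A n1 n2 n3 n4 n6 n8 n12 n24 {E1 E2 E3}.
move: (J 1) (J 2) (J 3) (J 4) (J 6) (J 8) (J 12) (J 24) (csum _) (appell_sum _ _ _).
move=> a b c d e f g h S B A n1 n2 n3 n4 n6 n8 n12 n24 H.
have t0 : (2 : R[i]) != 0 by rewrite pnatr_eq0.
have -> : S = (2 * h ^+ 2 / g)^-1 * (2 * h ^+ 2 / g * S).
  by rewrite mulKf // mulf_neq0 ?invr_neq0 // mulf_neq0 // expf_neq0.
rewrite H.
have -> : - (q^-1 * (a * c * f ^+ 2 * g ^+ 2 / (b * d * e * h ^+ 2))) =
   c ^+ 3 * g / (a * e ^+ 2) - q^-1 * (g ^+ 4 * e * f / (b * d * h ^+ 3)).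
  by rewrite A mulNr.
by field; rewrite q0 n1 n2 n3 n4 n6 n8 n12 n24.
Qed.

End NuAppell.

Theorem corollary7p5 (R : realType) :
  (forall q : R[i], 0 < `|q| -> `|q| < 1 ->
    (* (i) *)
    (csum (fun n =>
       (-1) ^+ n * q ^+ (n.+1 ^ 2) * qpoch q (q ^+ 2) n
         / qpoch (- q) q (2 * n + 1))
     = q * (qpoch_oo q (q ^+ 2) / qpoch_oo (q ^+ 2) (q ^+ 2))
         * csum (fun n => symsum n (fun j =>
             (-1) ^ (n%:Z + j)
               * q ^ (3 * n%:Z ^+ 2 + 3 * n%:Z - j ^+ 2))))
    /\
    (* (ii) *)
    [/\ csum (fun n =>
          (-1) ^+ n * q ^+ (n * (n + 1)) * qpoch (q ^+ 2) (q ^+ 2) n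
            / qpoch (- q) q (2 * n + 1))
        = csum (fun n => symsum n (fun j =>
            (-1) ^ (n%:Z + j) * (1 - q ^+ (2 * n + 1))
              * q ^ (3 * n%:Z ^+ 2 + 2 * n%:Z - j ^+ 2))),
        csum (fun n => symsum n (fun j =>
            (-1) ^ (n%:Z + j) * (1 - q ^+ (2 * n + 1))
              * q ^ (3 * n%:Z ^+ 2 + 2 * n%:Z - j ^+ 2)))
        = hecke_fbar 1 2 1 (- q ^+ 4) (- q ^+ 4) (q ^+ 4)
          - q ^+ 5 * hecke_fbar 1 2 1 (- q ^+ 10) (- q ^+ 10) (q ^+ 4)
      & forall h : R[i], h ^+ 2 = q ->
        hecke_fbar 1 2 1 (- q ^+ 4) (- q ^+ 4) (q ^+ 4)
          - q ^+ 5 * hecke_fbar 1 2 1 (- q ^+ 10) (- q ^+ 10) (q ^+ 4)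
        = hecke_fbar 1 2 1 (h ^+ 3) (- h ^+ 3) q]
    /\
    (* (iii) *)
    [/\ csum (fun n => q ^+ (n * (n + 1)) / qpoch (- q) (q ^+ 2) n.+1)
        = qpoch_oo (- q ^+ 2) (q ^+ 2) / qpoch_oo (q ^+ 2) (q ^+ 2)
          * csum (fun n =>
              (1 - q ^+ (2 * n + 1)) * q ^+ (3 * n ^ 2 + 2 * n)
                * symsum n (fun j => (-1) ^ j * q ^ (- j ^+ 2))),
        qpoch_oo (- q ^+ 2) (q ^+ 2) / qpoch_oo (q ^+ 2) (q ^+ 2)
          * csum (fun n =>
              (1 - q ^+ (2 * n + 1)) * q ^+ (3 * n ^ 2 + 2 * n)
                * symsum n (fun j => (-1) ^ j * q ^ (- j ^+ 2)))
        = Jk q 4 / Jk q 2 ^+ 2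
          * (hecke_f 1 2 1 (q ^+ 4) (q ^+ 4) (q ^+ 4)
             + q ^+ 5 * hecke_f 1 2 1 (q ^+ 10) (q ^+ 10) (q ^+ 4))
      & Jk q 4 / Jk q 2 ^+ 2
          * (hecke_f 1 2 1 (q ^+ 4) (q ^+ 4) (q ^+ 4)
             + q ^+ 5 * hecke_f 1 2 1 (q ^+ 10) (q ^+ 10) (q ^+ 4))
        = 2 * q^-1 * appell_m (q ^+ 2) (q ^+ 12) (-1)
          - q^-1
            * ((Jk q 1 * Jk q 3 * Jk q 8 ^+ 2 * Jk q 12 ^+ 2)
               / (Jk q 2 * Jk q 4 * Jk q 6 * Jk q 24 ^+ 2))])
  /\
  (* equivalence of the first equality in (iii) with a further identity, each
     read as an identity valid for all q in the punctured unit disc *)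
  ((forall q : R[i], 0 < `|q| -> `|q| < 1 ->
      csum (fun n => q ^+ (n * (n + 1)) / qpoch (- q) (q ^+ 2) n.+1)
      = qpoch_oo (- q ^+ 2) (q ^+ 2) / qpoch_oo (q ^+ 2) (q ^+ 2)
        * csum (fun n =>
            (1 - q ^+ (2 * n + 1)) * q ^+ (3 * n ^ 2 + 2 * n)
              * symsum n (fun j => (-1) ^ j * q ^ (- j ^+ 2))))
   <->
   (forall q : R[i], 0 < `|q| -> `|q| < 1 ->
      csum (fun n => q ^+ (n * (n + 1)) / qpoch q (q ^+ 2) n.+1)
      = (qpoch_oo q q)^-1
        * csum (fun n => symsum n (fun j =>
            (-1) ^+ n
              * q ^ (2 * n%:Z ^+ 2 + 2 * n%:Z - ((j * (j + 1)) %/ 2)%Z))))).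
Proof.
have E (q : R[i]) : 0 < `|q| -> `|q| < 1 -> q != 0 /\ md q < 1.
  by rewrite normr_gt0 mdE -[X in _ < X]/(1%:C) ltcR => q0 q1.
split; last first.
  split=> _ q /E h /h[q0 q1]; first exact: identity_iv.
  exact: identity_iii_a.
move=> q /E h /h[q0 q1]; split; first exact: identity_i; split.
  split; [exact: identity_ii_a | exact: identity_ii_b |].
  move=> h' hq; have h'0 : h' != 0 by apply: contra q0 => /eqP h0; rewrite -hq h0 expr0n.
  have h'1 : md h' < 1 by rewrite -(expr_lt1 (n := 2)) ?md_ge0 // -mdX hq.
  by have := identity_ii_c h'0 h'1; rewrite hq.
have eP : qpoch_oo (- q ^+ 2) (q ^+ 2) / qpoch_oo (q ^+ 2) (q ^+ 2) = Jk q 4 / Jk q 2 ^+ 2.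
  have n2 : Jk q 2 != 0 by exact: eta_neq0.
  by rewrite (eta_negX q1 (k := 2) isT) -[qpoch_oo _ _]/(Jk q 2) expr2 invfM mulrA.
have eF : qpoch_oo (- q ^+ 2) (q ^+ 2) / qpoch_oo (q ^+ 2) (q ^+ 2)
          * csum (fun n =>
              (1 - q ^+ (2 * n + 1)) * q ^+ (3 * n ^ 2 + 2 * n)
                * symsum n (fun j => (-1) ^ j * q ^ (- j ^+ 2)))
        = Jk q 4 / Jk q 2 ^+ 2
          * (hecke_f 1 2 1 (q ^+ 4) (q ^+ 4) (q ^+ 4)
             + q ^+ 5 * hecke_f 1 2 1 (q ^+ 10) (q ^+ 10) (q ^+ 4)).
  by rewrite (identity_iii_b q0 q1) eP.
split; [exact: identity_iii_a | exact: eF |].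
by apply: etrans (esym eF) (etrans (esym (identity_iii_a q0 q1)) (nu_appell q0 q1)).
Qed.
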